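(* Let $\mathbb B$ be the unit ball in $\mathbb R^d$. For any $m,h\in\mathbb N$ with $h<m$ we have $$\lambda_1^{(m-h)}(\mathbb B)\le\lambda_1^{(m,m-h)}(\mathbb B)=O\left(2^{2m}e^{-2m}m^{2m-h+\frac d2}\right),$$ and similarly $$\left[\lambda_1^{(m,m-h)}(\mathbb B)\right]^{\frac1{2(m-h)}}=\frac{2m}{e}+O(\log m),$$ where the asymptotic statements are for $m\to\infty$ and fixed $h$.
   Context: Here $d\ge1$ is fixed. For an integer $p\ge 0$ set $\nabla^p u=\Delta^j u$ if $p=2j$ and $\nabla^p u=\nabla\Delta^j u$ if $p=2j+1$. For integers $1\le t\le m$, $\lambda_1^{(m,t)}(\mathbb B)$ denotes the first (smallest) eigenvalue of the problem $(-\Delta)^m u=\lambda(-\Delta)^{m-t}u$ in $\mathbb B$, $u=\frac{\partial u}{\partial\nu}=\dots=\frac{\partial^{m-1}u}{\partial\nu^{m-1}}=0$ on $\partial\mathbb B$, understood weakly in $H^m_0(\mathbb B)$; equivalently $\lambda_1^{(m,t)}(\mathbb B)=\min_{0\ne u\in H^m_0(\mathbb B)}\int_{\mathbb B}|\nabla^m u|^2\big/\int_{\mathbb B}|\nabla^{m-t}u|^2$. One writes $\lambda_1^{(m)}=\lambda_1^{(m,m)}$. *)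

(* Defs.v *)
From HB Require Import structures.
From mathcomp Require Import all_boot all_order all_algebra.
From mathcomp Require Import all_classical all_reals all_analysis.

Set Implicit Arguments.
Unset Strict Implicit.
Unset Printing Implicit Defensive.

Import Order.TTheory GRing.Theory Num.Theory.
Import numFieldNormedType.Exports.

Local Open Scope classical_set_scope.
Local Open Scope ring_scope.

Definition rV_display : measure_display.
Proof. exact: default_measure_display. Qed.

Section measurable_rV.
Context {R : realType} {n : nat}.

Definition rV_coord (i : 'I_n) (x : 'rV[R]_n) : measurableTypeR R := x ord0 i.

Let rV_set0 : g_sigma_preimage rV_coord set0.
Proof. exact: sigma_algebra0. Qed.

Let rV_setC A : g_sigma_preimage rV_coord A -> g_sigma_preimage rV_coord (~` A).
Proof. exact: sigma_algebraC. Qed.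

Let rV_bigcup (F : _^nat) : (forall i, g_sigma_preimage rV_coord (F i)) ->
  g_sigma_preimage rV_coord (\bigcup_i (F i)).
Proof. exact: sigma_algebra_bigcup. Qed.

(* The sigma-algebra generated by the coordinates, i.e. the Borel sets. *)
HB.instance Definition _ := @isMeasurable.Build rV_display
  'rV[R]_n (g_sigma_preimage rV_coord) rV_set0 rV_setC rV_bigcup.

Lemma measurable_rV_coord (i : 'I_n) :
  measurable_fun [set: 'rV[R]_n] (rV_coord i).
Proof.
move=> _ Y mY; rewrite setTI; apply: sub_sigma_algebra => /=.
rewrite -bigcup_seq/=; exists i => /=; first by rewrite mem_index_enum.
by exists Y => //; rewrite setTI.
Qed.

Lemma measurable_fun_rV d (T : measurableType d) (f : T -> 'rV[R]_n) :
  (forall i, measurable_fun [set: T] (rV_coord i \o f)) ->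
  measurable_fun [set: T] f.
Proof.
move=> mf; suff h : g_sigma_preimage (fun i => rV_coord i \o f) `<=` measurable.
  move=> _ A mA; apply: h; rewrite g_sigma_preimage_comp.
  by exists A.
apply: smallest_sub; first exact: sigma_algebra_measurable.
rewrite -bigcup_seq => A [i _ [B mB <-]].
exact: mf.
Qed.

End measurable_rV.

Section lebesgue_rV.
Context {R : realType}.

Definition rV_cons n (p : measurableTypeR R * 'rV[R]_n) : 'rV[R]_n.+1 :=
  row_mx (const_mx p.1 : 'rV[R]_1) p.2.

Lemma rV_consEl n (p : measurableTypeR R * 'rV[R]_n) (j : 'I_1) :
  rV_cons p ord0 (lshift n j) = p.1.
Proof.
transitivity ((const_mx p.1 : 'rV[R]_1) ord0 j); first exact: row_mxEl.
by rewrite mxE.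
Qed.

Lemma rV_consEr n (p : measurableTypeR R * 'rV[R]_n) (j : 'I_n) :
  rV_cons p ord0 (rshift 1 j) = p.2 ord0 j.
Proof. exact: row_mxEr. Qed.

Lemma measurable_rV_cons n : measurable_fun setT (@rV_cons n).
Proof.
apply: measurable_fun_rV => i; case: (@split_ordP 1 n i) => j ->{i}.
  rewrite (_ : _ \o _ = fst)//; apply/funext => -[a v] /=.
  exact: rV_consEl.
rewrite (_ : _ \o _ = rV_coord j \o snd); last first.
  by apply/funext => -[a v] /=; exact: rV_consEr.
by apply: measurableT_comp => //; exact: measurable_rV_coord.
Qed.

Definition rV_uncons n (v : 'rV[R]_n.+1) : measurableTypeR R * 'rV[R]_n :=
  (v ord0 ord0, rsubmx (v : 'rV[R]_(1 + n))).

Lemma rV_consK n : cancel (@rV_cons n) (@rV_uncons n).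
Proof.
case=> a v; rewrite /rV_uncons row_mxKr; congr pair.
have e : ord0 = lshift n (ord0 : 'I_1) :> 'I_(1 + n) by exact/val_inj.
exact: etrans (congr1 (rV_cons (a, v) ord0) e) (rV_consEl (a, v) ord0).
Qed.

Lemma rV_unconsK n : cancel (@rV_uncons n) (@rV_cons n).
Proof.
move=> v; apply/rowP => i; case: (@split_ordP 1 n i) => j ->{i}.
  apply: etrans (rV_consEl _ j) _; rewrite (ord1 j).
  by congr (v _ _); exact/val_inj.
by apply: etrans (rV_consEr _ j) _; rewrite mxE.
Qed.

Lemma measurable_rV_uncons n : measurable_fun setT (@rV_uncons n).
Proof.
apply/measurable_fun_pairP; split; first exact: measurable_rV_coord.
apply: measurable_fun_rV => i.
rewrite (_ : _ \o _ = rV_coord (rshift 1 i)); first exact: measurable_rV_coord.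
by apply/funext => v /=; rewrite /rV_coord mxE.
Qed.

HB.instance Definition _ n :=
  isMeasurableFun.Build _ _ _ _ (@rV_cons n) (@measurable_rV_cons n).

Section cons_measure.
Context (n : nat) (mu : {sigma_finite_measure set 'rV[R]_n -> \bar R}).

Definition cons_measure : set 'rV[R]_n.+1 -> \bar R :=
  pushforward (lebesgue_measure \x mu)%E (@rV_cons n).

Let cons_measure0 : cons_measure set0 = 0%E.
Proof. exact: measure0. Qed.

Let cons_measure_ge0 A : (0 <= cons_measure A)%E.
Proof. exact: measure_ge0. Qed.

Let cons_measure_sigma_additive : semi_sigma_additive cons_measure.
Proof. exact: measure_semi_sigma_additive. Qed.

HB.instance Definition _ := isMeasure.Build _ _ _ cons_measure
  cons_measure0 cons_measure_ge0 cons_measure_sigma_additive.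

Let cons_measure_sigma_finite : sigma_finite setT cons_measure.
Proof.
have /sigma_finiteP[F [TF ndF Foo]] := sigma_finiteT (@lebesgue_measure R).
have /sigma_finiteP[G [TG ndG Goo]] := sigma_finiteT mu.
exists (fun k => @rV_uncons n @^-1` (F k `*` G k)) => [|k].
  rewrite -preimage_bigcup -[LHS](@preimage_setT _ _ (@rV_uncons n)).
  congr (_ @^-1` _); apply/seteqP; split=> // -[x y] _.
  have [i _ Fix] : (\bigcup_i F i) x by rewrite -TF.
  have [j _ Gjy] : (\bigcup_i G i) y by rewrite -TG.
  exists (maxn i j) => //; split=> /=.
    by move: Fix; exact/subsetPset/ndF/leq_maxl.
  by move: Gjy; exact/subsetPset/ndG/leq_maxr.
have [mF Fk] := Foo k; have [mG Gk] := Goo k; split.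
  rewrite -[X in measurable X]setTI.
  by apply: measurable_rV_uncons => //; exact: measurableX.
rewrite /cons_measure /pushforward -comp_preimage.
rewrite (_ : _ \o _ = id); last by apply/funext => p; exact: rV_consK.
by rewrite preimage_id product_measure1E// lte_mul_pinfty// ge0_fin_numE.
Qed.

HB.instance Definition _ := Measure_isSigmaFinite.Build _ _ _ cons_measure
  cons_measure_sigma_finite.

End cons_measure.

Fixpoint lebesgue_rV n : {sigma_finite_measure set 'rV[R]_n -> \bar R} :=
  match n with
  | 0 => \d_(0 : 'rV[R]_0)
  | n'.+1 => cons_measure (lebesgue_rV n')
  end.

End lebesgue_rV.

(* The topology on ['rV_d] comes from the sup norm, hence the explicit
   Euclidean ball. *)
Definition unit_ball (R : realType) (d : nat) : set 'rV[R]_d :=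
  [set x | \sum_(i < d) x ord0 i ^+ 2 < 1].

Section sobolev.
Context {R : realType} {d : nat}.
Implicit Types (f u phi : 'rV[R]_d -> R) (s : seq 'I_d) (i : 'I_d).

Definition partial i f : 'rV[R]_d -> R := fun x => 'D_(delta_mx ord0 i) f x.

(* [partials [:: i1; ..; ik] f] is the derivative d_i1 (... (d_ik f)). *)
Definition partials s f : 'rV[R]_d -> R := foldr partial f s.

Definition smooth f : Prop :=
  forall s, continuous (partials s f) /\
    forall i x, derivable (partials s f) x (delta_mx ord0 i).

Context (Omega : set 'rV[R]_d).

Local Notation leb := (@lebesgue_rV R d).

Definition test_function phi : Prop :=
  smooth phi /\
  exists K, [/\ compact K, K `<=` Omega & forall x, ~ K x -> phi x = 0].

Definition square_integrable f : Prop :=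
  measurable_fun Omega f /\ (\int[leb]_(x in Omega) ((f x) ^+ 2)%:E < +oo)%E.

Definition weak_derivative s u g : Prop :=
  forall phi, test_function phi ->
    \int[leb]_(x in Omega) (u x * partials s phi x) =
    (-1) ^+ size s * \int[leb]_(x in Omega) (g x * phi x).

(* An element [u] of a Sobolev space is represented by the family [U] of its
   weak derivatives: [U [::]] is [u], and [U s] is a representative of the
   derivative of [u] along [s]. Only the [s] of size at most [m] matter in
   [H^m]. *)
Definition jet := seq 'I_d -> 'rV[R]_d -> R.
Implicit Types U V : jet.

Definition sobolev (m : nat) U : Prop :=
  forall s, (size s <= m)%N ->
    square_integrable (U s) /\ weak_derivative s (U [::]) (U s).

(* The closure of the test functions in [H^m]. *)
Definition sobolev0 (m : nat) U : Prop :=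
  sobolev m U /\
  exists phi : nat -> 'rV[R]_d -> R,
    (forall n, test_function (phi n)) /\
    forall s, (size s <= m)%N ->
      (\int[leb]_(x in Omega) ((U s x - partials s (phi n) x) ^+ 2)%:E)%E
        @[n --> \oo] --> 0%E.

Definition jet_laplacian U : jet :=
  fun s x => \sum_(i < d) U (s ++ [:: i; i]) x.

(* The integral over [Omega] of the product of nabla^p u and nabla^p v. *)
Definition grad_form (p : nat) U V : R :=
  let Lu := iter p./2 jet_laplacian U in
  let Lv := iter p./2 jet_laplacian V in
  if odd p then
    \sum_(i < d) \int[leb]_(x in Omega) (Lu [:: i] x * Lv [:: i] x)
  else \int[leb]_(x in Omega) (Lu [::] x * Lv [::] x).

Definition weak_eigenvalue (m t : nat) (lambda : R) : Prop :=
  exists U, [/\ sobolev0 m U, ~ (U [::] = cst 0 %[ae leb in Omega]) &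
    forall V, sobolev0 m V ->
      grad_form m U V = lambda * grad_form (m - t) U V].

(* The smallest eigenvalue, with the default value 0 should there be none. *)
Definition first_eigenvalue (m t : nat) : R :=
  xget 0 [set lambda | weak_eigenvalue m t lambda /\
    forall kappa, weak_eigenvalue m t kappa -> lambda <= kappa].

End sobolev.

(* Main.v *)
(* The eigenvalue is the infimum over test functions of [a_m / a_h], where [a_p u] is the
   integral of [|nabla^p u|^2]; Rellich compactness provides a minimizer.

   The forms are log-convex, [a_(p+1)^2 <= a_p a_(p+2)], whence
   [a_(m-h) a_h <= a_m a_0], which compares the two eigenvalues. In a single coordinate,
   the operators [D^* D] on the spaces of weight [(1 - x^2)^-k] differ from one [k] to the
   next by scalars only, so that [a_n u >= ||D^n u||^2 >= (2 n)! ||u||^2].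

   For the upper bound take [w^m] with [w = rho - |x|^2] and [rho = m / (m + 1)], made
   smooth as [w^m exp (- eps / w)] with [eps] tending to [0]. As [Delta^m w^m] is constant,
   [a_m] tends to a product of [2 n (2 n - 2 + d)] times the integral of [w^m], while
   [a_h >= a_0 (a_1 / a_0)^h] is bounded below by the uncertainty principle; integration by
   parts relates the integrals of successive powers of [w]. Stirling-type estimates
   conclude. *)

Require Import Defs.
From HB Require Import structures.
From mathcomp Require Import all_boot all_order all_algebra.
From mathcomp Require Import all_classical all_reals all_analysis.
From mathcomp Require Import measurable_realfun ring lra zify.

Import Order.TTheory GRing.Theory Num.Theory.
Import numFieldNormedType.Exports.

Local Open Scope classical_set_scope.
Local Open Scope ring_scope.

Set Implicit Arguments.
Unset Strict Implicit.
Unset Printing Implicit Defensive.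

(** * Integration on row vectors *)

(** Inequalities are only proved for test functions: elements of $H^m_0$ are limits of these, and
    the forms pass to the limit. Integrals therefore mostly concern bounded functions with bounded
    support. In the lower bound, [D] after its adjoint and the adjoint after [D] act on the same
    weighted space and differ there by a scalar, so $\|D^n u\|^2$ becomes a polynomial with known
    roots in a nonnegative operator; the weight, being at least 1, can then be dropped. With
    $n=m-h$, the value $(2n)!$ misses the upper bound by at most a power of $m$, which the root of
    order $2n$ reduces to the error $O(\log m)$. In the trial function, $\rho<1$ keeps the support
    inside the open ball, but each comparison of successive powers of $w$ costs a factor $1/\rho$;
    the value $\rho=m/(m+1)$ makes $m$ of them cost at most $e$. The exponential factor is there
    because $w^m$ cut off at $w=0$ is not smooth. The product equals $4^m\prod_{j<m}(j+1)(j+d/2)$,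
    of size $(2m/e)^{2m}m^{d/2}$, and the remaining $m^{-h}$ comes from $a_1/a_0$ being at least $m$
    in the limit. *)

Section bounded_box_support.
Context {R : realType} d (T : measurableType d).
Variable mu : {measure set T -> \bar R}.
Variable B : R -> set T.
Hypothesis mB : forall M, measurable (B M).
Hypothesis finB : forall M, (mu (B M) < +oo)%E.
Hypothesis subB : forall M N, M <= N -> B M `<=` B N.
Implicit Types f g : T -> R.

(** A single [M] bounds the values and locates the support. Integrability is then automatic, and the
    class is stable under sums and products because the sets [B M] increase with [M]; later
    integrability conditions reduce to these closure properties. *)
Definition bounded_in f := measurable_fun setT f /\
  exists M, (forall x, `|f x| <= M) /\ (forall x, f x != 0 -> B M x).

Lemma bounded_in_measurable f : bounded_in f -> measurable_fun setT f.
Proof. by case. Qed.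

Lemma bounded_in_integrable f : bounded_in f -> mu.-integrable setT (EFin \o f).
Proof.
move=> [mf [M [fM fB]]].
have -> : EFin \o f = (EFin \o f) \_ (B M).
  apply/funext => x; rewrite patchE; case: ifPn => // /negP xB /=.
  apply/congr1/eqP/negPn/negP => fx; apply: xB; rewrite inE; exact: fB.
apply/integrable_restrict => //; rewrite setTI.
apply: measurable_bounded_integrable => //.
- exact: measurable_funTS.
- exists M; split => //; first exact: num_real.
  by move=> x Mx y _ /=; rewrite (le_trans (fM _))// ltW.
Qed.

Lemma bounded_inD f g : bounded_in f -> bounded_in g ->
  bounded_in (fun x => f x + g x).
Proof.
move=> [mf [M [fM fB]]] [mg [N [gN gB]]]; split; first exact: measurable_funD.
exists (`|M| + `|N|); split=> x.
  by apply: le_trans (ler_normD _ _) _; rewrite lerD// (le_trans _ (ler_norm _)).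
move=> fg0; have [fx|fx] := eqVneq (f x) 0.
  apply: (@subB N); first by rewrite (le_trans (ler_norm _))// lerDr.
  by apply: gB; move: fg0; rewrite fx add0r.
by apply: (@subB M); [rewrite (le_trans (ler_norm _))// lerDl|exact: fB].
Qed.

Lemma bounded_inM f g : bounded_in f -> measurable_fun setT g ->
  (exists M, forall x, `|g x| <= M) -> bounded_in (fun x => f x * g x).
Proof.
move=> [mf [M [fM fB]]] mg [N gN]; split; first exact: measurable_funM.
exists (`|M| * `|N| + `|M|); split=> x.
  rewrite normrM (@le_trans _ _ (`|M| * `|N|))// ?lerDl//.
  by rewrite ler_pM// (le_trans _ (ler_norm _)).
rewrite mulf_eq0 negb_or => /andP[fx _].
apply: (@subB M); last exact: fB.
by rewrite (le_trans (ler_norm _))// lerDr mulr_ge0.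
Qed.

Lemma bounded_inMM f g : bounded_in f -> bounded_in g ->
  bounded_in (fun x => f x * g x).
Proof. by move=> bf [mg [N [gN _]]]; apply: bounded_inM => //; exists N. Qed.

Lemma bounded_inZ k f : bounded_in f -> bounded_in (fun x => k * f x).
Proof.
move=> bf; have -> : (fun x => k * f x) = (fun x => f x * cst k x).
  by apply/funext => x; rewrite mulrC.
by apply: bounded_inM => //; exists `|k|.
Qed.

Lemma bounded_inN f : bounded_in f -> bounded_in (fun x => - f x).
Proof.
move=> /(bounded_inZ (-1)); congr bounded_in.
by apply/funext => x; rewrite mulN1r.
Qed.

Lemma bounded_inB f g : bounded_in f -> bounded_in g ->
  bounded_in (fun x => f x - g x).
Proof. by move=> bf bg; apply: bounded_inD => //; exact: bounded_inN. Qed.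

Lemma bounded_inX f : bounded_in f -> bounded_in (fun x => f x ^+ 2).
Proof.
by move=> bf; under eq_fun do rewrite expr2; exact: bounded_inMM.
Qed.

Lemma bounded_in0 : bounded_in (fun=> 0).
Proof.
split=> //; exists 0; split=> x; first by rewrite normr0.
by rewrite eqxx.
Qed.

Lemma bounded_in_sum I (r : seq I) (P : pred I) (F : I -> T -> R) :
  (forall i, P i -> bounded_in (F i)) ->
  bounded_in (fun x => \sum_(i <- r | P i) F i x).
Proof.
move=> bF; elim: r => [|i r IH].
  by under eq_fun do rewrite big_nil; exact: bounded_in0.
under eq_fun do rewrite big_cons.
have [Pi|Pi] := boolP (P i); last exact: IH.
by apply: bounded_inD => //; exact: bF.
Qed.

Lemma Rint_sum I (r : seq I) (P : pred I) (F : I -> T -> R) :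
  (forall i, P i -> bounded_in (F i)) ->
  \int[mu]_x (\sum_(i <- r | P i) F i x) = \sum_(i <- r | P i) \int[mu]_x F i x.
Proof.
move=> bF; elim: r => [|i r IH].
  rewrite big_nil; under eq_Rintegral do rewrite big_nil.
  by rewrite Rintegral_cst// mul0r.
rewrite big_cons; under eq_Rintegral do rewrite big_cons.
have [Pi|Pi] := boolP (P i); last exact: IH.
rewrite RintegralD ?IH//; apply: bounded_in_integrable.
  exact: bF.
exact: bounded_in_sum.
Qed.

End bounded_box_support.

(** * Boxes, Fubini and measurability of continuous functions *)

Section box.
Context {R : realType}.
Local Notation leb n := (@lebesgue_rV R n).

Definition box n (M : R) : set 'rV[R]_n := [set x | forall i, `|x ord0 i| <= M].

Lemma sub_box n M N : M <= N -> @box n M `<=` @box n N.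
Proof. by move=> MN x xM i; rewrite (le_trans (xM i)). Qed.

Lemma measurable_box n M : measurable (@box n M).
Proof.
rewrite (_ : box _ = \big[setI/setT]_(i <- enum 'I_n)
    ((@rV_coord R n i) @^-1` [set t | `|t| <= M])).
  apply: bigsetI_measurable => i _; rewrite -[X in measurable X]setTI.
  apply: measurable_rV_coord => //.
  rewrite (_ : mkset _ = `[- M, M]%classic); first exact: measurable_itv.
  by apply/seteqP; split=> t /=; rewrite in_itv /= ler_norml.
rewrite -bigcap_seq; apply/seteqP; split=> x /= xM i; first by move=> _; exact: xM.
by apply: xM => /=; rewrite mem_enum.
Qed.

Definition seg (M : R) : set (measurableTypeR R) := `[- M, M]%classic.

Lemma measurable_seg M : measurable (seg M).
Proof. exact: measurable_itv. Qed.

Lemma seg_fin M : (lebesgue_measure (seg M) < +oo)%E.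
Proof.
have H := lebesgue_measure_itv `[- M, M]; rewrite [X in (X < _)%E]H /=.
by case: ifP => _; rewrite ?ltry// -EFinB ltry.
Qed.

Lemma sub_seg M N : M <= N -> seg M `<=` seg N.
Proof.
move=> MN x; rewrite /seg /= !in_itv/= -!ler_norml => xM.
exact: le_trans MN.
Qed.

Lemma box_fin n M : (leb n (@box n M) < +oo)%E.
Proof.
elim: n => [|n IH].
  by rewrite /= diracE; case: (_ \in _); rewrite ltry.
rewrite /= /cons_measure /pushforward.
rewrite (_ : _ @^-1` _ = seg M `*` @box n M).
  rewrite product_measure1E//; [|exact: measurable_seg|exact: measurable_box].
  by rewrite lte_mul_pinfty// ge0_fin_numE//; exact: seg_fin.
apply/seteqP; split=> -[a v] /=.
  move=> aM; split=> /=.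
    by move: (aM ord0); rewrite (_ : ord0 = lshift n (ord0 : 'I_1)) ?rV_consEl ?/seg/= ?in_itv/= ?ler_norml//; exact/val_inj.
  by move=> i; move: (aM (rshift 1 i)); rewrite rV_consEr.
move=> [aM vM] i; case: (@split_ordP 1 n i) => j ->{i}.
  by rewrite rV_consEl; move: aM; rewrite /seg/= in_itv/= ler_norml.
by rewrite rV_consEr; exact: vM.
Qed.

Definition bbR (f : measurableTypeR R -> R) := bounded_in seg f.
Definition bbV n (f : 'rV[R]_n -> R) := bounded_in (@box n) f.

Lemma bbR_integrable f : bbR f -> lebesgue_measure.-integrable setT (EFin \o f).
Proof. exact: (bounded_in_integrable measurable_seg seg_fin). Qed.

Lemma bbV_integrable n f : bbV f -> (leb n).-integrable setT (EFin \o f).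
Proof. exact: (bounded_in_integrable (@measurable_box n) (@box_fin n)). Qed.

Lemma norm_rV_cons n a (v : 'rV[R]_n) M :
  (@box n.+1 M) (rV_cons (a, v)) <-> `|a| <= M /\ box M v.
Proof.
split=> [aM|[aM vM] i].
  split; last by move=> i; move: (aM (rshift 1 i)); rewrite rV_consEr.
  by move: (aM (lshift n (ord0 : 'I_1))); rewrite rV_consEl.
case: (@split_ordP 1 n i) => j ->{i}; first by rewrite rV_consEl.
by rewrite rV_consEr; exact: vM.
Qed.

Lemma measurable_slice n (f : 'rV[R]_n.+1 -> R) a : measurable_fun setT f ->
  measurable_fun setT (fun v => f (rV_cons (a, v))).
Proof.
move=> mf; apply: (measurableT_comp mf).
by apply: (measurableT_comp (@measurable_rV_cons R n)).
Qed.

Lemma bbV_slice n (f : 'rV[R]_n.+1 -> R) a : bbV f ->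
  bbV (fun v => f (rV_cons (a, v))).
Proof.
move=> [mf [M [fM fB]]]; split; first exact: measurable_slice.
by exists M; split=> // v /fB /norm_rV_cons[].
Qed.

Lemma bbR_slice n (f : 'rV[R]_n.+1 -> R) v : bbV f ->
  bbR (fun a => f (rV_cons (a, v))).
Proof.
move=> [mf [M [fM fB]]]; split.
  apply: (measurableT_comp mf).
  by apply: (measurableT_comp (@measurable_rV_cons R n)).
exists M; split=> // a /fB /norm_rV_cons[].
by rewrite /seg/= in_itv/= ler_norml.
Qed.

Section fubini.
Context n (f : 'rV[R]_n.+1 -> R).
Hypothesis bf : bbV f.

Let F (p : measurableTypeR R * 'rV[R]_n) := (f (rV_cons p))%:E.

Let mF : measurable_fun setT F.
Proof.
apply/measurable_EFinP; apply: measurableT_comp; first by case: bf.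
exact: (@measurable_rV_cons R n).
Qed.

Let intF : (lebesgue_measure \x leb n)%E.-integrable setT F.
Proof.
apply/integrableP; split => //.
have /integrableP[_] := bbV_integrable bf.
rewrite /= (ge0_integral_pushforward (@measurable_rV_cons R n))//.
by apply/measurable_EFinP; apply: measurableT_comp => //; exact: bf.1.
Qed.

Lemma Rint_cons_prod : \int[leb n.+1]_x f x = fine (\int[lebesgue_measure \x leb n]_p F p)%E.
Proof.
rewrite /Rintegral /= (integral_pushforward (@measurable_rV_cons R n))//=.
exact: (measurable_int _ (bbV_integrable bf)).
Qed.

Lemma fubini_cons :
  \int[leb n.+1]_x f x = \int[lebesgue_measure]_a \int[leb n]_v f (rV_cons (a, v)).
Proof.
rewrite Rint_cons_prod -integral12_prod_meas1//=; congr fine.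
apply: eq_integral => a _; rewrite /fubini_F /F /Rintegral fineK//.
apply: integrable_fin_num => //.
exact: (bbV_integrable (bbV_slice a bf)).
Qed.

Lemma fubini_cons2 :
  \int[leb n.+1]_x f x = \int[leb n]_v \int[lebesgue_measure]_a f (rV_cons (a, v)).
Proof.
rewrite Rint_cons_prod -integral21_prod_meas1//=; congr fine.
apply: eq_integral => v _; rewrite /fubini_G /F /Rintegral fineK//.
apply: integrable_fin_num => //.
exact: (bbR_integrable (bbR_slice v bf)).
Qed.

(** Partial integrals stay in the class, which allows Fubini to be iterated. They are bounded by [M]
    times the volume of the box; the summand [|M|] of the witness serves the support. *)
Lemma bbR_Rint : bbR (fun a => \int[leb n]_v f (rV_cons (a, v))).
Proof.
have [mf [M [fM fB]]] := bf.
split.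
  apply: measurableT_comp => //.
  exact: (measurable_fubini_F intF).
pose c := fine (leb n (box M)).
exists (`|M| * `|c| + `|M|); split=> [a|a].
  apply: (@le_trans _ _ (`|M| * `|c|)); last by rewrite lerDl.
  apply: le_trans (le_normr_Rintegral _ (bbV_integrable (bbV_slice a bf))) _ => //.
  have -> : `|M| * `|c| = \int[leb n]_v (`|M| * \1_(box M) v).
    rewrite /Rintegral; under eq_integral do rewrite EFinM.
    have mb := @measurable_box n M; have fb := @box_fin n M.
    rewrite ge0_integralZl//=; last first.
      by apply/measurable_EFinP; exact: measurable_indic.
    rewrite integral_indic// setIT fineM//=; last by rewrite ge0_fin_numE.
    by rewrite [`|c|]ger0_norm// fine_ge0.
  have bM : bbV (\1_(box M) : 'rV[R]_n -> R).
    split; first by apply: measurable_indic; exact: measurable_box.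
    exists (1 + `|M|); split=> v.
      by rewrite indicE; case: (_ \in _); rewrite ?normr1 ?normr0 ?lerDl// addr_ge0.
    rewrite indicE; case: (boolP (v \in _)) => [|_]; last by rewrite eqxx.
    rewrite inE => /sub_box H _; apply: H.
    by rewrite (le_trans (ler_norm _))// lerDr.
  apply: le_Rintegral => //.
  - rewrite (_ : EFin \o _ = abse \o (EFin \o fun v => f (rV_cons (a, v)))); last exact/funext.
    exact/integrable_abse/bbV_integrable/bbV_slice.
  - by apply/bbV_integrable/bounded_inZ => //; exact: sub_box.
  move=> v _; rewrite indicE; have [vM|vM] := boolP (v \in _).
    by rewrite mulr1 (le_trans (fM _)) ?ler_norm.
  rewrite mulr0 normr_le0; apply/negPn/negP => /fB /norm_rV_cons[_ vB].
  by move: vM; rewrite notin_setE.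
move=> nz; have [aM|aM] := leP `|a| M.
  rewrite /seg/= in_itv/= -ler_norml (le_trans aM)// (le_trans (ler_norm _))//.
  by rewrite lerDr mulr_ge0.
move: nz; rewrite (_ : (fun v => _) = cst 0) ?Rintegral_cst// ?mul0r ?eqxx//.
apply/funext => v /=; apply/eqP/negPn/negP => /fB /norm_rV_cons[].
by rewrite leNgt aM.
Qed.

Lemma bbV_Rint : bbV (fun v => \int[lebesgue_measure]_a f (rV_cons (a, v))).
Proof.
have [mf [M [fM fB]]] := bf.
split.
  apply: measurableT_comp => //.
  exact: (measurable_fubini_G intF).
pose c := fine (lebesgue_measure (seg M)).
exists (`|M| * `|c| + `|M|); split=> [v|v].
  apply: (@le_trans _ _ (`|M| * `|c|)); last by rewrite lerDl.
  apply: le_trans (le_normr_Rintegral _ (bbR_integrable (bbR_slice v bf))) _ => //.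
  have -> : `|M| * `|c| = \int[lebesgue_measure]_a (`|M| * \1_(seg M) a).
    rewrite /Rintegral; under eq_integral do rewrite EFinM.
    have mb := @measurable_seg M; have fb := @seg_fin M.
    rewrite ge0_integralZl//=; last first.
      by apply/measurable_EFinP; exact: measurable_indic.
    rewrite integral_indic// setIT fineM//=; last by rewrite ge0_fin_numE.
    by rewrite [`|c|]ger0_norm// fine_ge0.
  have bM : bbR (\1_(seg M)).
    split; first by apply: measurable_indic; exact: measurable_seg.
    exists (1 + `|M|); split=> a.
      by rewrite indicE; case: (_ \in _); rewrite ?normr1 ?normr0 ?lerDl// addr_ge0.
    rewrite indicE; case: (boolP (a \in _)) => [|_]; last by rewrite eqxx.
    rewrite inE => /sub_seg H _; apply: H.
    by rewrite (le_trans (ler_norm _))// lerDr.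
  apply: le_Rintegral => //.
  - rewrite (_ : EFin \o _ = abse \o (EFin \o fun a => f (rV_cons (a, v)))); last exact/funext.
    exact/integrable_abse/bbR_integrable/bbR_slice.
  - by apply/bbR_integrable/bounded_inZ => //; exact: sub_seg.
  move=> a _; rewrite indicE; have [aM|aM] := boolP (a \in _).
    by rewrite mulr1 (le_trans (fM _)) ?ler_norm.
  rewrite mulr0 normr_le0; apply/negPn/negP => /fB /norm_rV_cons[aB _].
  by move: aM; rewrite notin_setE /seg /= in_itv/= -ler_norml aB.
move=> nz; apply: contrapT => vM; move: nz.
rewrite (_ : (fun a => _) = cst 0) ?Rintegral_cst// ?mul0r ?eqxx//.
apply/funext => a /=; apply/eqP/negPn/negP => /fB /norm_rV_cons[_ vB].
apply: vM; apply: sub_box vB.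
by rewrite (le_trans (ler_norm _))// lerDr mulr_ge0.
Qed.

End fubini.

(** The sigma-algebra is generated by the coordinates, not by the open sets. Rounding [x] down to
    the grid of mesh [1 / k.+1] gives functions with countably many values, constant on half-open
    cubes, and continuity makes them converge pointwise to [f]. *)
Lemma continuous_measurable n (f : 'rV[R]_n -> R) :
  continuous f -> measurable_fun setT f.
Proof.
move=> cf.
pose z (k : nat) (x : 'rV[R]_n) : 'rV[int]_n := \row_i Num.floor (k.+1%:R * x ord0 i).
pose g (k : nat) (u : 'rV[int]_n) : 'rV[R]_n := \row_i ((u ord0 i)%:~R / k.+1%:R).
apply: (@measurable_fun_cvg _ _ _ _ (fun k x => f (g k (z k x)))).
  move=> k _ A mA; rewrite setTI.
  (* [pickle] numbers the grid points, so that the union over them is indexed by natural numbers. *)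
  rewrite (_ : _ @^-1` _ = \bigcup_(p in [set p | exists2 u, pickle u = p & A (f (g k u))])
     \bigcup_(u in [set u | pickle u = p]) (z k @^-1` [set u])); last first.
    apply/seteqP; split=> x /=.
      by move=> Ax; exists (pickle (z k x)) => //=; [exists (z k x)|exists (z k x)].
    move=> [p [u up Au]] [u' /= up'] ->.
    by have -> : u' = u by apply: (pcan_inj pickleK); rewrite up up'.
  apply: bigcup_measurable => p [u up Au].
  rewrite (_ : [set u | _] = [set u]); last first.
    apply/seteqP; split=> u' /=; last by move=> ->.
    by move=> up'; apply: (pcan_inj pickleK); rewrite up up'.
  rewrite bigcup_set1.
  rewrite (_ : _ @^-1` _ = \big[setI/setT]_(i <- enum 'I_n)
    ((@rV_coord R n i) @^-1` [set t | Num.floor (k.+1%:R * t) == u ord0 i])).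
    apply: bigsetI_measurable => i _; rewrite -[X in measurable X]setTI.
    apply: measurable_rV_coord => //.
    rewrite (_ : mkset _ = `[(u ord0 i)%:~R / k.+1%:R, (u ord0 i + 1)%:~R / k.+1%:R[%classic).
      exact: measurable_itv.
    apply/seteqP; split=> t /=; rewrite in_itv/= floor_eq;
      by rewrite ler_pdivrMr// ltr_pdivlMr// [t * _]mulrC.
  rewrite -bigcap_seq; apply/seteqP; split=> x /=.
    by move=> <- i _ /=; rewrite mxE.
  move=> H; apply/rowP => i; rewrite mxE; apply/eqP.
  by apply: (H i) => /=; rewrite mem_enum.
move=> x _.
have H : (fun k => g k (z k x)) @ \oo --> x.
  apply/cvgrPdist_le => e e0.
  have := @near_infty_natSinv_lt R (PosNum e0).
  apply: filterS => k /= ke.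
  rewrite [leLHS]/Num.Def.normr/= mx_normrE; apply/bigmax_leP; split; first exact: ltW.
  move=> -[a i] _ /=; rewrite !mxE (ord1 a).
  apply: le_trans (ltW ke).
  have := floor_itv (k.+1%:R * x ord0 i); set q := Num.floor _ => /andP[q1 q2].
  rewrite ger0_norm; last by rewrite subr_ge0 ler_pdivrMr// mulrC.
  rewrite lerBlDr -[X in X + _]mul1r -mulrDl [X in X / _]addrC ler_pdivlMr// mulrC.
  by rewrite intrD in q2; exact: ltW.
exact: (@cvg_comp _ _ _ _ f _ _ _ H (cf x)).
Qed.

End box.

(** * Smooth functions and integration by parts *)

Section lines.
Context {R : realType} {n : nat}.
Implicit Types (f g : 'rV[R]_n -> R) (x : 'rV[R]_n) (i j : 'I_n).
Local Notation e i := (delta_mx ord0 i : 'rV[R]_n).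

Definition C1dir i f := (forall x, derivable f x (e i)) /\ continuous (partial i f).

(** Only difference quotients matter, so the two functions may live on different spaces. Lines,
    translations and slices [rV_cons (a, _)] are all treated through this. *)
Lemma eq_derive (V W V' : normedModType R) (f : V -> W) (g : V' -> W) a v b w :
  (forall h : R, f (h *: v + a) - f a = g (h *: w + b) - g b) -> 'D_v f a = 'D_w g b.
Proof.
move=> fg; rewrite /derive; set d := (fun _ : R => _); set d' := (fun _ : R => _).
suff -> : d = d' by [].
by apply/funext => h; rewrite /d /d' /= fg.
Qed.

Lemma eq_derivable (V W V' : normedModType R) (f : V -> W) (g : V' -> W) a v b w :
  (forall h : R, f (h *: v + a) - f a = g (h *: w + b) - g b) ->
  derivable f a v -> derivable g b w.
Proof.
move=> fg; rewrite /derivable; set d := (fun _ : R => _); set d' := (fun _ : R => _).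
suff -> : d = d' by [].
by apply/funext => h; rewrite /d /d' /= fg.
Qed.

Lemma line_quotient f x i t h :
  f (x + (h *: (1 : R^o) + t) *: e i) = f (h *: e i + (x + t *: e i)).
Proof. by rewrite scalerDl addrCA /= [h *: _]mulr1. Qed.

Lemma derivable_line f x i (t : R) : derivable f (x + t *: e i) (e i) ->
  derivable (fun s : R => f (x + s *: e i)) t 1.
Proof. by apply: eq_derivable => h; rewrite -line_quotient. Qed.

Lemma derive_line f x i (t : R) :
  'D_1 (fun s : R => f (x + s *: e i)) t = partial i f (x + t *: e i).
Proof. by apply: eq_derive => h; rewrite line_quotient. Qed.

Lemma is_derive_line f x i (t : R) : derivable f (x + t *: e i) (e i) ->
  is_derive t 1 (fun s : R => f (x + s *: e i)) (partial i f (x + t *: e i)).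
Proof. by move=> df; apply: DeriveDef; [exact: derivable_line|exact: derive_line]. Qed.

Lemma continuous_line f x i : continuous f ->
  continuous (fun s : R => f (x + s *: e i)).
Proof.
move=> cf t; apply: (@continuous_comp _ _ _ (fun s : R => x + s *: e i) f); last exact: cf.
apply: cvgD; first exact: cvg_cst.
by apply: cvgZ; [exact: cvg_id|exact: cvg_cst].
Qed.

Lemma continuous_line_derivable f x i : (forall x, derivable f x (e i)) ->
  continuous (fun s : R => f (x + s *: e i)).
Proof.
move=> df t; apply: differentiable_continuous.
by apply/derivable1_diffP; apply: derivable_line.
Qed.

Lemma line_MVT f x i (h : R) : 0 < h -> (forall x, derivable f x (e i)) ->
  exists2 s, 0 < s < h & f (x + h *: e i) - f x = h * partial i f (x + s *: e i).
Proof.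
move=> h0 df.
have [] := @MVT R (fun s => f (x + s *: e i)) (fun s => partial i f (x + s *: e i)) 0 h h0.
- by move=> s _; apply: is_derive_line.
- exact/continuous_subspaceT/continuous_line_derivable.
move=> s; rewrite in_itv/= => sh; rewrite scale0r addr0 subr0 mulrC => E.
by exists s.
Qed.

Lemma coord_delta i j : (e i) ord0 j = (i == j)%:R :> R.
Proof. by rewrite mxE eqxx eq_sym. Qed.

Lemma mx_norm_le x (M : R) : 0 <= M -> (`|x| <= M) = [forall i, `|x ord0 i| <= M].
Proof.
move=> M0; rewrite /Num.Def.normr/= mx_normrE.
apply/idP/forallP => [/bigmax_leP[_ H] i|H]; first exact: (H (ord0, i)).
by apply/bigmax_leP; split=> // -[a i] _; rewrite (ord1 a); exact: H.
Qed.

Lemma coord_le_norm x i : `|x ord0 i| <= `|x|.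
Proof. by have := mx_norm_le x (normr_ge0 x); rewrite lexx => /esym/forallP. Qed.

Lemma norm_delta i : `|e i| <= 1 :> R.
Proof.
rewrite mx_norm_le//; apply/forallP => j; rewrite coord_delta.
by case: (_ == _); rewrite ?normr1 ?normr0.
Qed.

(** The mean value theorem is used twice: along [e i] for the difference [g] taken in direction [j],
    then along [e j] for [partial i f]. *)
Lemma double_difference f i j x (h : R) : 0 < h ->
  (forall x, derivable f x (e i)) -> (forall x, derivable (partial i f) x (e j)) ->
  exists2 y, `|y - x| <= h *+ 2 &
  f (x + h *: e i + h *: e j) - f (x + h *: e i) - f (x + h *: e j) + f x =
  h * (h * partial j (partial i f) y).
Proof.
move=> h0 df ddf; pose g y := f (y + h *: e j) - f y.
have shE y : (fun y => f (y + h *: e j)) y = f (y + h *: e j) by [].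
have dsh y : derivable (fun y => f (y + h *: e j)) y (e i).
  by apply: eq_derivable (df (y + h *: e j)) => k; rewrite addrA.
have psh y : partial i (fun y => f (y + h *: e j)) y = partial i f (y + h *: e j).
  by apply: eq_derive => k; rewrite addrA.
have dg y : derivable g y (e i) by apply: derivableB.
have pg y : partial i g y = partial i f (y + h *: e j) - partial i f y.
  by rewrite -psh /partial; apply: deriveB.
have [s /andP[s0 sh] E] := line_MVT x h0 dg.
have [t /andP[t0 th] E'] := line_MVT (x + s *: e i) h0 ddf.
exists (x + s *: e i + t *: e j).
  rewrite -[x + _ + _]addrA [x + _]addrC addrK (le_trans (ler_normD _ _))// mulr2n.
  by apply: lerD; rewrite normrZ gtr0_norm// -[leRHS]mulr1 ler_pM ?norm_delta// ltW.
by rewrite -E' -pg -E /g opprB [f x - _]addrC addrA.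
Qed.

(** Schwarz's theorem. The double difference is symmetric in [i] and [j], so the two mixed
    derivatives take a common value at two points within [2 h] of [x]; continuity at [x]
    concludes. *)
Lemma partialC f i j :
  (forall x, derivable f x (e i)) -> (forall x, derivable f x (e j)) ->
  C1dir j (partial i f) -> C1dir i (partial j f) ->
  partial i (partial j f) = partial j (partial i f).
Proof.
move=> dfi dfj [dij cij] [dji cji]; apply/funext => x.
apply/eqP; rewrite -subr_eq0 -normr_le0; apply/ler_addgt0Pr => r r0; rewrite add0r.
have r20 : 0 < r / 2 by rewrite divr_gt0.
have /cvgrPdist_le/(_ _ r20) := cij x; have /cvgrPdist_le/(_ _ r20) := cji x.
move=> /nbhs_ballP[a /= a0 Ha] /nbhs_ballP[b /= b0 Hb].
have [h h0 [ha hb]] : exists2 h : R, 0 < h & h *+ 2 < a /\ h *+ 2 < b.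
  have m0 : 0 < Num.min a b by rewrite lt_min a0.
  exists (Num.min a b / 4); first by rewrite divr_gt0.
  have : (Num.min a b / 4) *+ 2 < Num.min a b.
    by rewrite -mulr_natr -mulrA gtr_pMr// mulrC ltr_pdivrMr// mul1r ltr_nat.
  by rewrite lt_min => /andP.
have [y yx Ey] := double_difference x h0 dfi dij.
have [z zx Ez] := double_difference x h0 dfj dji.
have {Ey Ez} E : partial j (partial i f) y = partial i (partial j f) z.
  apply: (mulfI (lt0r_neq0 h0)); apply: (mulfI (lt0r_neq0 h0)).
  apply: (etrans (esym Ey)); apply: (etrans _ Ez).
  by rewrite (addrAC x) -!addrA; congr (_ + _); rewrite !addrA; congr (_ + _); rewrite addrC.
rewrite (_ : _ - _ = (partial i (partial j f) x - partial i (partial j f) z) +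
   (partial j (partial i f) y - partial j (partial i f) x)); last first.
  by rewrite E addrA subrK.
apply: (le_trans (ler_normD _ _)); rewrite [leRHS](splitr r); apply: lerD.
  by apply: Ha; rewrite -ball_normE /= distrC; exact: le_lt_trans zx ha.
by rewrite distrC; apply: Hb; rewrite -ball_normE /= distrC; exact: le_lt_trans yx hb.
Qed.

Lemma partialD f g i x : derivable f x (e i) -> derivable g x (e i) ->
  partial i (fun y => f y + g y) x = partial i f x + partial i g x.
Proof. exact: deriveD. Qed.

Lemma partialM f g i x : derivable f x (e i) -> derivable g x (e i) ->
  partial i (fun y => f y * g y) x = partial i f x * g x + f x * partial i g x.
Proof.
move=> df dg; rewrite addrC /partial (deriveM df dg); congr (_ + _).
by rewrite /GRing.scale/= mulrC.
Qed.

Lemma partial_cst (c : R) i x : partial i (fun=> c) x = 0.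
Proof. exact: derive_cst. Qed.

Lemma is_derive_coord i j x : is_derive x (e i) (fun y : 'rV[R]_n => y ord0 j) (i == j)%:R.
Proof.
have H : (fun h : R => h^-1 *: ((fun y : 'rV[R]_n => y ord0 j) (h *: e i + x) - x ord0 j)) @ 0^'
   --> ((i == j)%:R : R).
  apply: (@cvg_trans _ ((fun=> (i == j)%:R : R) @ (0:R)^')); last exact: cvg_cst.
  apply: near_eq_cvg; near=> h.
  have h0 : h != 0 by near: h; exact: nbhs_dnbhs_neq.
  by rewrite 2!mxE coord_delta addrK scalerA mulVf// scale1r.
by split; [apply/cvg_ex; eexists; exact: H|exact: cvg_lim H].
Unshelve. all: by end_near. Qed.

Lemma derivable_coord i j x : derivable (fun y : 'rV[R]_n => y ord0 j) x (e i).
Proof. by case: (is_derive_coord i j x). Qed.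

Lemma partial_coord i j x : partial i (fun y : 'rV[R]_n => y ord0 j) x = (i == j)%:R.
Proof. by case: (is_derive_coord i j x). Qed.

Lemma partial_near i f g x : (\near x, f x = g x) -> partial i f x = partial i g x.
Proof. exact: near_eq_derive. Qed.

End lines.

(** * Closure properties of smooth functions *)

Section smooth.
Context {R : realType} {n : nat}.
Implicit Types (f g : 'rV[R]_n -> R) (x : 'rV[R]_n) (i j : 'I_n).
Local Notation e i := (delta_mx ord0 i : 'rV[R]_n).

Lemma smooth_continuous f : smooth f -> continuous f.
Proof. by move=> /(_ [::])[]. Qed.

Lemma smooth_derivable f i x : smooth f -> derivable f x (e i).
Proof. by move=> /(_ [::])[_]; exact. Qed.

Lemma smooth_partial f i : smooth f -> smooth (partial i f).
Proof.
move=> sf s; have := sf (rcons s i); rewrite /partials foldr_rcons //.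
Qed.

Lemma smooth_C1dir f i : smooth f -> C1dir i f.
Proof.
move=> sf; split; last exact/smooth_continuous/smooth_partial.
by move=> x; exact: smooth_derivable.
Qed.

Lemma smooth_partialC f i j : smooth f ->
  partial i (partial j f) = partial j (partial i f).
Proof.
move=> sf; apply: partialC.
- by move=> x; exact: smooth_derivable.
- by move=> x; exact: smooth_derivable.
- exact/smooth_C1dir/smooth_partial.
- exact/smooth_C1dir/smooth_partial.
Qed.

(** [smooth] speaks of all iterated derivatives; a class stable under partial derivatives provides
    them all at once. *)
Lemma smooth_bisim (S : set ('rV[R]_n -> R)) :
  (forall f, S f -> continuous f /\
     forall i, (forall x, derivable f x (e i)) /\ S (partial i f)) ->
  forall f, S f -> smooth f.
Proof.
move=> HS f Sf s.
have SS : S (partials s f).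
  by elim: s => //= i s IH; have [_ /(_ i)[]] := HS _ IH.
split; first exact: (HS _ SS).1.
by move=> i x; have [_ /(_ i)[]] := HS _ SS.
Qed.

Inductive alg_closure (G : set ('rV[R]_n -> R)) : set ('rV[R]_n -> R) :=
| alg_gen f : G f -> alg_closure G f
| alg_cst c : alg_closure G (fun=> c)
| alg_add f g : alg_closure G f -> alg_closure G g -> alg_closure G (fun x => f x + g x)
| alg_mul f g : alg_closure G f -> alg_closure G g -> alg_closure G (fun x => f x * g x).

(** The derivatives of a generator need only be polynomials in the generators. This suits quotients
    by a weight and radial profiles, whose derivatives carry additional factors. *)
Lemma smooth_alg_closure (G : set ('rV[R]_n -> R)) :
  (forall f, G f -> continuous f /\
     forall i, (forall x, derivable f x (e i)) /\ alg_closure G (partial i f)) ->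
  forall f, alg_closure G f -> smooth f.
Proof.
move=> HG; apply: (@smooth_bisim (alg_closure G)) => f; elim=> {f}[f Gf|c|f g Af [cf df] Ag [cg dg]|f g Af [cf df] Ag [cg dg]].
- have [cf df] := HG _ Gf; split=> // i; have [dfi Afi] := df i; split=> //.
- split; first exact: cst_continuous.
  move=> i; split; first by move=> x; exact: derivable_cst.
  have -> : partial i (fun=> c) = fun=> 0 by apply/funext => x; exact: partial_cst.
  exact: alg_cst.
- split; first by move=> x; exact: continuousD (cf x) (cg x).
  move=> i; have [dfi Afi] := df i; have [dgi Agi] := dg i; split.
    by move=> x; apply: derivableD.
  by rewrite (_ : partial i _ = fun x => partial i f x + partial i g x);
    [exact: alg_add|apply/funext => x; exact: partialD].
- split; first by move=> x; exact: continuousM (cf x) (cg x).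
  move=> i; have [dfi Afi] := df i; have [dgi Agi] := dg i; split.
    by move=> x; apply: derivableM.
  rewrite (_ : partial i _ = fun x => partial i f x * g x + f x * partial i g x).
    by apply: alg_add; apply: alg_mul.
  by apply/funext => x; exact: partialM.
Qed.

Lemma smooth_alg f : alg_closure smooth f -> smooth f.
Proof.
apply: smooth_alg_closure => {}f sf; split; first exact: smooth_continuous.
move=> i; split; first by move=> x; exact: smooth_derivable.
exact/alg_gen/smooth_partial.
Qed.

Lemma smoothD f g : smooth f -> smooth g -> smooth (fun x => f x + g x).
Proof. by move=> sf sg; apply: smooth_alg; apply: alg_add; exact: alg_gen. Qed.

Lemma smoothM f g : smooth f -> smooth g -> smooth (fun x => f x * g x).
Proof. by move=> sf sg; apply: smooth_alg; apply: alg_mul; exact: alg_gen. Qed.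

Lemma smooth_cst c : smooth (fun _ : 'rV[R]_n => c).
Proof. by apply: smooth_alg; exact: alg_cst. Qed.

Lemma smooth_coord j : smooth (fun x : 'rV[R]_n => x ord0 j).
Proof.
apply: (@smooth_alg_closure [set (fun x : 'rV[R]_n => x ord0 j)]); last exact: alg_gen.
move=> _ ->; split; first exact: coord_continuous.
move=> i; split; first by move=> x; exact: derivable_coord.
rewrite (_ : partial i _ = fun=> (i == j)%:R); first exact: alg_cst.
by apply/funext => x; exact: partial_coord.
Qed.

End smooth.

(** * Integrals of partial derivatives *)

Section ibp.
Context {R : realType}.
Local Notation leb n := (@lebesgue_rV R n).
Local Notation e i := (delta_mx ord0 i).

Lemma bbV_continuous n (f : 'rV[R]_n -> R) M :
  continuous f -> (forall x, f x != 0 -> box M x) -> bbV f.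
Proof.
move=> cf fM; split; first exact: continuous_measurable.
have cb : compact (@box R n `|M|).
  rewrite (_ : box _ = [set v | forall i, `[- `|M|, `|M|]%classic (v ord0 i)]).
    by apply: (@rV_compact _ _ (fun=> `[- `|M|, `|M|]%classic)) => _; exact: segment_compact.
  by apply/seteqP; split=> x xM i; move: (xM i); rewrite /= in_itv/= ler_norml.
have := @continuous_compact _ _ f _ (continuous_subspaceT cf) cb.
move=> /compact_bounded[N [_ HN]].
exists (`|M| + `|N| + 1); split=> x.
  have [->|fx] := eqVneq (f x) 0; first by rewrite normr0 !addr_ge0.
  apply: (@le_trans _ _ (`|N| + 1)); last by rewrite -addrA lerDr.
  apply: HN; first by rewrite ltr_pwDr// ler_norm.
  by exists x => //; apply: sub_box (fM _ fx); exact: ler_norm.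
by move=> /fM; apply: sub_box; rewrite -addrA (le_trans (ler_norm _))// lerDl addr_ge0.
Qed.

(** The box is closed, so off it [f] vanishes in a neighbourhood and its derivative vanishes too. *)
Lemma partial_support n (f : 'rV[R]_n -> R) i M :
  (forall x, f x != 0 -> box M x) -> forall x, partial i f x != 0 -> box M x.
Proof.
move=> fM x; apply: contraNP => xM; apply/eqP.
rewrite -(@partial_cst R n 0 i x); apply: partial_near.
have [j xj] : exists j, M < `|x ord0 j|.
  by apply: contra_notP xM => /forallNP H j; rewrite leNgt; apply/negP.
have /cvgrPdist_lt/(_ (`|x ord0 j| - M)) := @coord_continuous R 1 n ord0 j x.
rewrite subr_gt0 => /(_ xj); apply: filterS => y yx.
apply/eqP/negPn/negP => /fM /(_ j); apply/negP; rewrite -ltNge.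
have := ler_normD (x ord0 j - y ord0 j) (y ord0 j); rewrite subrK.
by move: yx; set a := `|_|; set b := `|_|; set c := `|_|; lra.
Qed.

Lemma Rint_seg (f : measurableTypeR R -> R) M : (forall x, f x != 0 -> seg M x) ->
  \int[lebesgue_measure]_x f x = \int[lebesgue_measure]_(x in seg M) f x.
Proof.
move=> fM; rewrite [RHS]Rintegral_mkcond; apply: eq_Rintegral => x _.
rewrite patchE; case: ifPn => // xM; apply/eqP/negPn/negP => /fM xs.
by move: xM; rewrite notin_setE; apply.
Qed.

(** The support bounds are strict so that [F] vanishes at both ends [M] and [- M]. *)
Lemma Rint_derive (F f : R -> R) (M : R) : (forall x : R, is_derive x 1 F (f x)) ->
  continuous f -> (forall x, F x != 0 -> `|x| < M) -> (forall x, f x != 0 -> `|x| < M) ->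
  \int[@lebesgue_measure R]_x f x = 0.
Proof.
move=> dF cf FM fM.
have [M0|M0] := leP M 0.
  rewrite (_ : (fun x => f x) = cst 0); first by rewrite Rintegral_cst// mul0r.
  apply/funext => x; apply/eqP/negPn/negP => /fM.
  by apply/negP; rewrite -leNgt (le_trans M0).
rewrite (@Rint_seg _ M); last first.
  by move=> x /fM/ltW; rewrite /seg /= in_itv/= ler_norml.
have cF : continuous F.
  move=> t; apply: differentiable_continuous; apply/derivable1_diffP.
  by case: (dF t).
rewrite /Rintegral /seg (@continuous_FTC2 _ f F).
- have -> : F M = 0 by apply/eqP/negPn/negP => /FM; rewrite gtr0_norm// ltxx.
  have -> : F (- M) = 0 by apply/eqP/negPn/negP => /FM; rewrite normrN gtr0_norm// ltxx.
  by rewrite -EFinB subr0.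
- by rewrite gtrN.
- exact: continuous_subspaceT.
- split.
  + by move=> x _; case: (dF x).
  + exact/cvg_at_right_filter/cF.
  + exact/cvg_at_left_filter/cF.
- by move=> x _; rewrite derive1E; case: (dF x).
Qed.

Lemma rV_cons_line n (a : R) (v : 'rV[R]_n) :
  rV_cons (a, v) = rV_cons (0, v) + a *: e (lshift n (ord0 : 'I_1) : 'I_n.+1).
Proof.
apply/rowP => i; rewrite [RHS]mxE [X in _ + X]mxE coord_delta.
case: (@split_ordP 1 n i) => j ->{i}.
  by rewrite !rV_consEl (ord1 j) eqxx mulr1 add0r.
by rewrite !rV_consEr (eq_lrshift (ord0 : 'I_1) j) mulr0 addr0.
Qed.

Lemma rV_cons_shift n (a : R) (v : 'rV[R]_n) (j : 'I_n) h :
  rV_cons (a, h *: e j + v) = h *: e (rshift 1 j : 'I_n.+1) + rV_cons (a, v).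
Proof.
apply/rowP => i; rewrite [RHS]mxE [X in _ = X + _]mxE coord_delta.
case: (@split_ordP 1 n i) => k ->{i}.
  by rewrite !rV_consEl (eq_rlshift j k) mulr0 add0r.
by rewrite !rV_consEr (eq_rshift 1 j k) /= [LHS]mxE [X in X + _ = _]mxE coord_delta.
Qed.

Lemma derivable_cons n (f : 'rV[R]_n.+1 -> R) (a : R) v (j : 'I_n) :
  derivable f (rV_cons (a, v)) (e (rshift 1 j : 'I_n.+1)) ->
  derivable (fun w => f (rV_cons (a, w))) v (e j).
Proof. by apply: eq_derivable => h; rewrite rV_cons_shift. Qed.

Lemma partial_cons n (f : 'rV[R]_n.+1 -> R) (a : R) v (j : 'I_n) :
  partial j (fun w => f (rV_cons (a, w))) v = partial (rshift 1 j : 'I_n.+1) f (rV_cons (a, v)).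
Proof. by apply: eq_derive => h; rewrite rV_cons_shift. Qed.

Lemma continuous_cons n (a : R) : continuous (fun v : 'rV[R]_n => rV_cons (a, v)).
Proof.
move=> v; apply/(@cvgrPdist_le _ _ _ (nbhs v) (nbhs_filter v)) => r r0.
apply/nbhs_ballP; exists r => //= w; rewrite -ball_normE /= => /ltW vw; rewrite mx_norm_le ?ltW//; apply/forallP => i.
rewrite [X in `|X|]mxE [X in _ + X]mxE.
case: (@split_ordP 1 n i) => k ->{i}.
  by rewrite !rV_consEl subrr normr0 ltW.
rewrite !rV_consEr /=; apply: le_trans vw; apply: le_trans (coord_le_norm _ k).
by rewrite [X in _ <= `|X|]mxE [X in _ <= `|_ + X|]mxE.
Qed.

(** Induction on the dimension. A derivative along the first coordinate is integrated first in that
    coordinate, where it is a total derivative; any other one is a derivative on the slices. *)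
Lemma Rint_partial n (f : 'rV[R]_n -> R) i M :
  (forall x, f x != 0 -> box M x) -> C1dir i f ->
  \int[leb n]_x partial i f x = 0.
Proof.
elim: n f i => [f []//|n IH f i] fM [df cf].
have bp : bbV (partial i f).
  by apply: (@bbV_continuous _ _ M) => //; exact: partial_support.
case: (@split_ordP 1 n i) => j ij.
  rewrite fubini_cons2// (_ : (fun v => _) = cst 0) ?Rintegral_cst ?mul0r//.
  apply/funext => v /=.
  have {ij} ij : i = lshift n (ord0 : 'I_1) by rewrite ij (ord1 j).
  subst i; under eq_Rintegral do rewrite rV_cons_line.
  (* [M + 1] turns the closed box into the strict bound. *)
  apply: (@Rint_derive (fun a => f (rV_cons (0, v) + a *: e (lshift n (ord0 : 'I_1) : 'I_n.+1))) _ (M + 1)).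
  - by move=> a; apply: is_derive_line.
  - exact: continuous_line.
  - move=> a /fM; rewrite -rV_cons_line => /norm_rV_cons[aM _].
    by rewrite (le_lt_trans aM)// ltrDl.
  - move=> a /(partial_support fM); rewrite -rV_cons_line => /norm_rV_cons[aM _].
    by rewrite (le_lt_trans aM)// ltrDl.
rewrite fubini_cons// (_ : (fun v => _) = cst 0) ?Rintegral_cst ?mul0r//.
apply/funext => a /=; subst i.
under eq_Rintegral do rewrite -partial_cons.
apply: IH; first by move=> v /fM/norm_rV_cons[].
split; first by move=> v; apply: derivable_cons.
rewrite (_ : partial j _ = partial (rshift 1 j : 'I_n.+1) f \o (fun v => rV_cons (a, v))).
  by move=> v; apply: continuous_comp; [exact: continuous_cons|exact: cf].
by apply/funext => v; rewrite /= partial_cons.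
Qed.

End ibp.

(** * Semi-inner products and iterated derivatives *)

Section semi_inner_product.
Context {R : realType} {V : lmodType R}.
Implicit Types (ip : V -> V -> R) (u v w : V).

Definition sip ip := [/\ forall u v w, ip (u + v) w = ip u w + ip v w,
  forall (a : R) u v, ip (a *: u) v = a * ip u v,
  forall u v, ip u v = ip v u & forall u, 0 <= ip u u].

Context {ip : V -> V -> R} (ipP : sip ip).

Lemma ipDl u v w : ip (u + v) w = ip u w + ip v w. Proof. by case: ipP. Qed.
Lemma ipZl (a : R) u v : ip (a *: u) v = a * ip u v. Proof. by case: ipP. Qed.
Lemma ipC u v : ip u v = ip v u. Proof. by case: ipP. Qed.
Lemma ip_ge0 u : 0 <= ip u u. Proof. by case: ipP. Qed.
Lemma ipDr u v w : ip w (u + v) = ip w u + ip w v.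
Proof. by rewrite ipC ipDl ipC (ipC v). Qed.
Lemma ipZr (a : R) u v : ip u (a *: v) = a * ip u v.
Proof. by rewrite ipC ipZl ipC. Qed.
Lemma ipNl u v : ip (- u) v = - ip u v.
Proof. by rewrite -scaleN1r ipZl mulN1r. Qed.
Lemma ipNr u v : ip u (- v) = - ip u v.
Proof. by rewrite ipC ipNl ipC. Qed.
Lemma ipBl u v w : ip (u - v) w = ip u w - ip v w.
Proof. by rewrite ipDl ipNl. Qed.
Lemma ipBr u v w : ip w (u - v) = ip w u - ip w v.
Proof. by rewrite ipDr ipNr. Qed.
Lemma ip0l v : ip 0 v = 0.
Proof. by rewrite -(scale0r 0) ipZl mul0r. Qed.
Lemma ip_suml I (r : seq I) (F : I -> V) v :
  ip (\sum_(i <- r) F i) v = \sum_(i <- r) ip (F i) v.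
Proof.
by elim: r => [|i r IH]; rewrite ?big_nil ?ip0l// !big_cons ipDl IH.
Qed.
Lemma ip_sumr I (r : seq I) (F : I -> V) v :
  ip v (\sum_(i <- r) F i) = \sum_(i <- r) ip v (F i).
Proof. by rewrite ipC ip_suml; apply: eq_bigr => i _; rewrite ipC. Qed.

Lemma ip_sqrD u v (t : R) :
  ip (u + t *: v) (u + t *: v) = ip u u + 2 * t * ip u v + t ^+ 2 * ip v v.
Proof. by rewrite ipDl !ipDr !ipZl !ipZr (ipC v u); ring. Qed.

Lemma sip_CauchySchwarz u v : ip u v ^+ 2 <= ip u u * ip v v.
Proof.
have [v0|v0] := eqVneq (ip v v) 0.
  have [->|b0] := eqVneq (ip u v) 0; first by rewrite expr0n/= v0 mulr0.
  (* As [ip v v = 0], the quadratic in the coefficient of [v] is affine; this coefficient gives it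
     the value -1. *)
  have := ip_ge0 (u + (- (ip u u + 1) / (2 * ip u v)) *: v).
  rewrite ip_sqrD v0 mulr0 addr0.
  rewrite (_ : ip u u + _ = - 1); first by rewrite oppr_ge0 ler10.
  by field.
have vp : 0 < ip v v by rewrite lt_def v0 ip_ge0.
have := ip_ge0 (u + (- ip u v / ip v v) *: v).
rewrite ip_sqrD (_ : _ + _ = (ip u u * ip v v - ip u v ^+ 2) / ip v v).
  by rewrite pmulr_lge0 ?invr_gt0// subr_ge0.
by field.
Qed.

Lemma ip_parallelogram u v :
  ip (u - v) (u - v) = 2 * ip u u + 2 * ip v v - ip (u + v) (u + v).
Proof. by rewrite !ipBl !ipDl !ipBr !ipDr; ring. Qed.

Lemma ip_sqrD_le u v : ip (u + v) (u + v) <= 2 * ip u u + 2 * ip v v.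
Proof. by rewrite -subr_ge0 -ip_parallelogram ip_ge0. Qed.

End semi_inner_product.

Section operator_product.
Context {R : realType} {V : lmodType R}.
Variables (q : V -> V -> R) (T : V -> V).
Hypothesis qP : sip q.
Hypothesis Tsym : forall u v, q (T u) v = q u (T v).
Hypothesis Tpos : forall u, 0 <= q u (T u).

(** The product of the factors [S + a] for [a] in [L]: a polynomial in [S], given by the opposites
    of its roots. *)
Definition shift_prod (S : V -> V) (L : seq nat) (u : V) : V :=
  foldr (fun a v => S v + a%:R *: v) u L.

Lemma iter_sym k u v : q (iter k T u) v = q u (iter k T v).
Proof. by elim: k u v => //= k IH u v; rewrite Tsym IH -iterSr. Qed.

Lemma iter_pos k u : 0 <= q u (iter k T u).
Proof.
have [j [->|->]] : exists j, k = (j + j)%N \/ k = (j + j).+1 by exists k./2; lia.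
  by rewrite iterD -(iter_sym j) (ip_ge0 qP).
by rewrite iterS iterD -iterS iterSr -(iter_sym j) Tpos.
Qed.

(** Since [T] is nonnegative, each factor [T + a] is at least [a]. The power [k] accommodates the
    term with one more [T] that the induction produces. *)
Lemma shift_prod_ge L k u :
  (\prod_(a <- L) a)%:R * q u (iter k T u) <= q (iter k T u) (shift_prod T L u).
Proof.
elim: L k => [|a L IH] k /=.
  by rewrite big_nil mul1r (ipC qP).
rewrite big_cons natrM (ipDr qP) (ipZr qP) -Tsym -iterS.
have := IH k.+1; have := IH k; move=> H1 H2; apply: le_trans (lerD H2 (ler_wpM2l (ler0n R a) H1)).
by rewrite mulrA lerDr mulr_ge0//; exact: iter_pos.
Qed.

End operator_product.

(** * The weighted inequality in one coordinate *)

Section weighted_inequality.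
Context {R : realType} {V : lmodType R} (ip : V -> V -> R).
Variables (D X W : {linear V -> V}).
Hypothesis ipP : sip ip.
Hypothesis Dskew : forall u v, ip (D u) v = - ip u (D v).
Hypothesis Xsym : forall u v, ip (X u) v = ip u (X v).
Hypothesis Wsym : forall u v, ip (W u) v = ip u (W v).
Hypothesis Wpos : forall u, 0 <= ip u (W u).
Hypothesis DX : forall u, D (X u) = X (D u) + u.
Hypothesis DW : forall u, D (W u) = W (D u) + 2 *: X (W (W u)).
Hypothesis XW : forall u, X (W u) = W (X u).
Hypothesis WX : forall u, W u - W (X (X u)) = u.

Let q k u v := ip u (iter k W v).

Lemma weight_iterZ k a u : iter k W (a *: u) = a *: iter k W u.
Proof. by elim: k => //= k ->; rewrite linearZ. Qed.
Lemma weight_iterD k u v : iter k W (u + v) = iter k W u + iter k W v.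
Proof. by elim: k => //= k ->; rewrite linearD. Qed.
Lemma weight_iterN k u : iter k W (- u) = - iter k W u.
Proof. by rewrite -scaleN1r weight_iterZ scaleN1r. Qed.
Lemma weight_iterX k u : iter k W (X u) = X (iter k W u).
Proof. by elim: k => //= k ->; rewrite XW. Qed.

Lemma weighted_sip k : sip (q k).
Proof.
split=> [u v w|a u v|u v|u]; rewrite /q.
- by rewrite (ipDl ipP).
- by rewrite (ipZl ipP).
- by rewrite (ipC ipP) (iter_sym Wsym).
- exact: (iter_pos ipP Wsym Wpos).
Qed.

Lemma D_weight k u : D (iter k W u) = iter k W (D u) + (2 * k)%:R *: X (iter k.+1 W u).
Proof.
elim: k => [|k IH]; first by rewrite /= scale0r addr0.
rewrite iterS DW IH linearD/= linearZ/= -XW -addrA; congr (_ + _).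
by rewrite -scalerDl; congr (_ *: _); rewrite -natrD; congr _%:R; lia.
Qed.

(* The adjoint of [D] from the space with weight [w^-(k+1)] to the one with
   weight [w^-k], where [w = 1 - x^2] is the inverse of [W]:
   [g |-> - w g' - 2 k x g]. *)
Let adj k g := X (X (D g)) - D g - (2 * k)%:R *: X g.

Lemma D_adj k v g : q k (D v) g = q k.+1 v (adj k g).
Proof.
rewrite /q Dskew D_weight /adj -(ipNr ipP); congr (ip _ _).
rewrite !weight_iterD !weight_iterN weight_iterZ !weight_iterX opprD; congr (_ - _).
rewrite -{1}(WX (D g)) weight_iterD weight_iterN opprB.
by rewrite -!iterSr !weight_iterX.
Qed.

(** The ladder relation: on the space of weight [w^-(k+1)], the left side is [D] after its adjoint,
    the first term on the right is the adjoint after [D], and only a scalar separates them. *)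
Lemma D_adj_comm k g : D (adj k.+1 g) = adj k (D g) - (2 * k.+1)%:R *: g.
Proof.
rewrite /adj !linearB/= linearZ/= !DX linearD/= scalerDr opprD addrA; congr (_ - _).
set A := X (X _); set B := X (D g); set C := D (D g).
have -> : A + B + B = A + 2%:R *: B by rewrite -addrA -mulr2n scaler_nat.
rewrite mulnS natrD (scalerDl B 2%:R (2 * k)%:R) (opprD (2%:R *: B)).
by rewrite addrA [A + _ - C]addrAC addrK.
Qed.

Let N k u := adj k (D u).

(* Roots (with opposite signs) of the polynomial [P_m], characterised by
   [P_0 = 1] and [P_(m+1)(z) = z P_m(z + 2 m)], for which
   [(D^m u, D^m u) = (u, P_m(N) u)] in the space of weight [w^-m]. *)
Fixpoint shifts m := if m is m'.+1 then 0%N :: [seq (a + 2 * m')%N | a <- shifts m']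
  else [::].

Lemma shift_prod_D m L u :
  shift_prod (N m) L (D u) = D (shift_prod (N m.+1) [seq (a + 2 * m.+1)%N | a <- L] u).
Proof.
elim: L => //= a L ->; rewrite linearD linearZ/=; set z := shift_prod _ _ _.
by rewrite /N D_adj_comm natrD scalerDl [a%:R *: _ + _]addrC addrA subrK.
Qed.

(** In the induction the innermost derivative is [D u]. Pulling [D] out of the polynomial shifts its
    roots by [2 * m.+1], and moving the other [D] to its adjoint adds a factor [N], which is the
    root 0. *)
Lemma iter_D_shift_prod m u :
  ip (iter m.+1 D u) (iter m.+1 D u) = q m.+1 u (shift_prod (N m) (shifts m.+1) u).
Proof.
elim: m u => [|m IH] u.
  by rewrite [LHS](@D_adj 0) /= scale0r addr0.
rewrite !(iterSr m.+1) IH shift_prod_D D_adj -/(N _ _).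
by rewrite [shifts m.+2]/= /shift_prod/= scale0r addr0.
Qed.

(** One of the shifts is 0, so positivity of [N m] alone would yield nothing. Writing [N m] as
    [D (adj m.+1 _)] plus [2 * m.+1] makes every shift positive while the operator remains
    nonnegative. *)
Lemma shift_prod_adj m L u : shift_prod (N m) L u =
  shift_prod (fun u => D (adj m.+1 u)) [seq (a + 2 * m.+1)%N | a <- L] u.
Proof.
elim: L => //= a L ->; set z := shift_prod _ _ _.
by rewrite D_adj_comm natrD scalerDl [a%:R *: _ + _]addrC addrA subrK.
Qed.

(** This is the value $(a+2m)!/a!$ of $P_m$ at $(a+1)(2m+a)$. Only [a = 0] is wanted, but the
    recursion for $P_m$ shifts the argument, which turns [a] into [a.+1]. *)
Lemma prod_shifts m a :
  (a`! * \prod_(c <- shifts m) (c + a.+1 * (2 * m + a)))%N = ((a + 2 * m)`!)%N.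
Proof.
elim: m a => [|m IH] a; first by rewrite big_nil muln1 muln0 addn0.
rewrite /= big_cons big_map.
have Ec c : (c + 2 * m + a.+1 * (2 * m.+1 + a) = c + a.+2 * (2 * m + a.+1))%N.
  by lia.
under eq_bigr do rewrite Ec.
have := IH a.+1; rewrite factS => E.
set P := (\prod_(c <- _) _)%N in E *.
rewrite add0n (_ : a`! * (a.+1 * (2 * m.+1 + a) * P) = (2 * m.+1 + a) * (a.+1 * a`! * P))%N; last by ring.
rewrite E.
rewrite (_ : (a + 2 * m.+1)%N = (a.+1 + 2 * m).+1); last by lia.
rewrite factS; congr (_ * _)%N; lia.
Qed.

(** Division by [w] exceeds the identity by the nonnegative [x^2 / w]. *)
Lemma weight_iter_ge k u : ip u u <= q k u u.
Proof.
elim: k => // k IH; apply: le_trans IH _; rewrite /q -subr_ge0 -(ipBr ipP) iterSr.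
rewrite -weight_iterN -weight_iterD.
have -> : W u - u = W (X (X u)) by rewrite -[X in _ - X = _](WX u) opprB addrC subrK.
rewrite -iterSr weight_iterX -Xsym.
exact: (iter_pos ipP Wsym Wpos).
Qed.

Lemma fact_ip_iter_D m u :
  (2 * m)`!%:R * ip u u <= ip (iter m D u) (iter m D u).
Proof.
case: m => [|m]; first by rewrite mul1r.
rewrite iter_D_shift_prod shift_prod_adj.
(* Moving [D] across leaves the product of [adj m.+1 v] and [adj m.+1 w] in the next weight, which
   is symmetric and nonnegative. *)
have Msym v w : q m.+1 (D (adj m.+1 v)) w = q m.+1 v (D (adj m.+1 w)).
  by rewrite D_adj (ipC (weighted_sip m.+1)) D_adj (ipC (weighted_sip m.+2)).
have Mpos v : 0 <= q m.+1 v (D (adj m.+1 v)).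
  by rewrite (ipC (weighted_sip m.+1)) D_adj (ip_ge0 (weighted_sip m.+2)).
have := @shift_prod_ge _ _ _ _ (weighted_sip m.+1) Msym Mpos
  [seq (a + 2 * m.+1)%N | a <- shifts m.+1] 0 u.
apply: le_trans; rewrite big_map.
have := prod_shifts m.+1 0; rewrite fact0 mul1n add0n => <-.
have Ec c : (c + 1 * (2 * m.+1 + 0) = c + 2 * m.+1)%N by lia.
under eq_bigr do rewrite Ec.
by rewrite ler_wpM2l// weight_iter_ge.
Qed.

End weighted_inequality.

(** * Polyharmonic forms *)

Section polyharmonic_forms.
Context {R : realType} {V : lmodType R} {d : nat} (ip : V -> V -> R).
Variable D : 'I_d -> {linear V -> V}.
Hypothesis ipP : sip ip.
Hypothesis Dskew : forall i u v, ip (D i u) v = - ip u (D i v).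
Hypothesis DC : forall i j u, D i (D j u) = D j (D i u).

Definition laplacian (u : V) : V := \sum_i D i (D i u).

Fact laplacian_linear : linear laplacian.
Proof.
move=> a u v; rewrite /laplacian scaler_sumr -big_split/=.
by apply: eq_bigr => i _; rewrite !linearP.
Qed.
HB.instance Definition _ := GRing.isLinear.Build R V V *:%R laplacian laplacian_linear.

Lemma laplacian_sym u v : ip (laplacian u) v = ip u (laplacian v).
Proof.
rewrite (ip_suml ipP) (ip_sumr ipP); apply: eq_bigr => i _.
by rewrite !Dskew opprK.
Qed.

Lemma D_laplacian i u : D i (laplacian u) = laplacian (D i u).
Proof. by rewrite linear_sum; apply: eq_bigr => j _; rewrite DC (DC i j u). Qed.

Lemma D_iter_laplacian i k u : D i (iter k laplacian u) = iter k laplacian (D i u).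
Proof. by elim: k => //= k <-; exact: D_laplacian. Qed.

Definition polyform p u v :=
  if odd p then \sum_i ip (D i (iter p./2 laplacian u)) (D i (iter p./2 laplacian v))
  else ip (iter p./2 laplacian u) (iter p./2 laplacian v).

(** With all derivatives moved to the right, only the sign remembers the parity of [p]; later proofs
    need no case distinction. *)
Lemma polyformE p u v : polyform p u v = (-1) ^+ p * ip u (iter p laplacian v).
Proof.
rewrite /polyform -signr_odd; set k := p./2; have pk := odd_double_half p.
case: (odd p) pk => /= <-; rewrite -/k -addnn.
  rewrite expr1 mulN1r add1n iterS iterD -iterS iterSr -(iter_sym laplacian_sym k).
  set w := iter k _ u; set z := iter k _ v.
  rewrite -/laplacian /laplacian (ip_sumr ipP) -sumrN; apply: eq_bigr => i _.
  by rewrite Dskew.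
by rewrite expr0 mul1r add0n iterD (iter_sym laplacian_sym).
Qed.

Lemma polyform_sip p : sip (polyform p).
Proof.
split=> [u v w|a u v|u v|u].
- by rewrite !polyformE (ipDl ipP) mulrDr.
- by rewrite !polyformE (ipZl ipP) mulrCA.
- by rewrite !polyformE (ipC ipP) (iter_sym laplacian_sym).
- rewrite /polyform; case: (odd p); last exact: (ip_ge0 ipP).
  by apply: sumr_ge0 => i _; exact: (ip_ge0 ipP).
Qed.

Lemma polyform0 u v : polyform 0 u v = ip u v. Proof. by []. Qed.

(** Splits off one derivative, so that an inequality of order [p], applied to the partial
    derivatives of [u], yields the one of order [p.+1]. *)
Lemma polyform_grad p u : \sum_i polyform p (D i u) (D i u) = polyform p.+1 u u.
Proof.
rewrite [RHS]polyformE exprS mulN1r mulNr iterS [X in ip u X]/laplacian (ip_sumr ipP).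
rewrite mulr_sumr -sumrN; apply: eq_bigr => i _.
by rewrite polyformE -D_iter_laplacian Dskew mulrN.
Qed.

Lemma polyform_laplacian p u v : polyform p u (laplacian v) = - polyform p.+1 u v.
Proof. by rewrite !polyformE -iterSr exprS mulN1r mulNr opprK. Qed.

Lemma polyform_laplacian2 p u : polyform p (laplacian u) (laplacian u) = polyform p.+2 u u.
Proof.
by rewrite polyform_laplacian (ipC (polyform_sip _)) polyform_laplacian opprK.
Qed.

(** Cauchy-Schwarz for the form of order [p] between [u] and its Laplacian. *)
Lemma polyform_log_convex p u : polyform p.+1 u u ^+ 2 <= polyform p u u * polyform p.+2 u u.
Proof.
have := sip_CauchySchwarz (polyform_sip p) u (laplacian u).
by rewrite polyform_laplacian sqrrN polyform_laplacian2.
Qed.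

Lemma polyform_iter_D p i u : ip (iter p (D i) u) (iter p (D i) u) <= polyform p u u.
Proof.
elim: p u => [|p IH] u; first by rewrite polyform0.
rewrite iterSr; apply: le_trans (IH _) _; rewrite -polyform_grad (bigD1 i)//= lerDl.
by apply: sumr_ge0 => j _; exact: (ip_ge0 (polyform_sip p)).
Qed.

Lemma polyform_foldr_D s u : ip (foldr D u s) (foldr D u s) <= polyform (size s) u u.
Proof.
elim: s u => [|i s IH] u; first by rewrite polyform0.
have E : D i (foldr D u s) = foldr D (D i u) s.
  by elim: s {IH} => //= j s <-; rewrite DC.
rewrite /= E; apply: le_trans (IH _) _; rewrite -polyform_grad (bigD1 i)//= lerDl.
by apply: sumr_ge0 => j _; exact: (ip_ge0 (polyform_sip _)).
Qed.

Section poincare.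
Variables (c : R) (i0 : 'I_d).
Hypothesis c0 : 0 <= c.
Hypothesis poincare : forall u, c * ip u u <= ip (D i0 u) (D i0 u).

Lemma polyform_poincare p u : c * polyform p u u <= polyform p.+1 u u.
Proof.
elim: p u => [|p IH] u.
  rewrite polyform0; apply: le_trans (poincare u) _; rewrite -polyform_grad (bigD1 i0)//= lerDl.
  by apply: sumr_ge0 => j _; exact: (ip_ge0 ipP).
by rewrite -!polyform_grad mulr_sumr; apply: ler_sum => i _; exact: IH.
Qed.

Lemma polyform_poincare_iter p k u : c ^+ k * polyform p u u <= polyform (p + k) u u.
Proof.
elim: k => [|k IH]; first by rewrite mul1r addn0.
rewrite exprS -mulrA addnS; apply: le_trans (polyform_poincare _ _).
by rewrite ler_wpM2l.
Qed.

End poincare.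

(** Log-convexity makes the quotient of consecutive forms nondecreasing in [p], so [k] steps up from
    [h] gain at least as much as [k] steps up from 0. *)
Lemma polyform_ratio u k h : (forall p, 0 < polyform p u u) ->
  polyform k u u * polyform h u u <= polyform (k + h) u u * polyform 0 u u.
Proof.
move=> pos.
have ratio p : polyform p.+1 u u / polyform p u u <= polyform p.+2 u u / polyform p.+1 u u.
  rewrite ler_pdivrMr// mulrAC ler_pdivlMr//.
  by have := polyform_log_convex p u; rewrite expr2 [X in _ <= X]mulrC.
have ratioh p : polyform p.+1 u u / polyform p u u <= polyform (p + h).+1 u u / polyform (p + h) u u.
  elim: (h) => [|n IH]; first by rewrite addn0.
  by apply: le_trans IH _; rewrite addnS; exact: ratio.
elim: k => [|k IH]; first by rewrite add0n mulrC.
have := ler_pM _ _ (ratioh k) IH.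
rewrite !divr_ge0 ?mulr_ge0 ?(ltW (pos _))// => /(_ isT isT).
rewrite mulrA divfK ?lt0r_neq0// addSn.
by rewrite mulrA divfK ?lt0r_neq0.
Qed.

Lemma polyform_power u h : (forall p, 0 < polyform p u u) ->
  polyform 1 u u ^+ h * polyform 0 u u <= polyform h u u * polyform 0 u u ^+ h.
Proof.
move=> pos; elim: h => [|h IH]; first by rewrite mul1r mulr1.
rewrite exprS -mulrA; apply: (@le_trans _ _ (polyform 1 u u * (polyform h u u * polyform 0 u u ^+ h))).
  by rewrite ler_wpM2l// ltW.
rewrite mulrA exprS mulrA ler_wpM2r ?exprn_ge0 ?(ltW (pos _))//.
by have := polyform_ratio 1 h pos; rewrite add1n.
Qed.

(** Expansion of the square of [D i u + t *: X i u]: as [D i] and [X i] commute up to the identity,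
    the cross term [ip (D i u) (X i u)] is half of [- ip u u]. The parameter [t] stays free, to be
    optimized on the trial function. *)
Lemma polyform1_uncertainty (X : 'I_d -> V -> V) (t : R) u :
  (forall i u v, ip (X i u) v = ip u (X i v)) ->
  (forall i u, D i (X i u) = X i (D i u) + u) ->
  t * d%:R * ip u u - t ^+ 2 * \sum_i ip (X i u) (X i u) <= polyform 1 u u.
Proof.
move=> Xsym DX; rewrite -polyform_grad lerBlDr.
have -> : t * d%:R * ip u u = \sum_(i < d) t * ip u u.
  by rewrite sumr_const card_ord -(mulr_natl (t * _)); ring.
rewrite mulr_sumr -big_split; apply: ler_sum => i _ /=.
rewrite polyform0 -subr_ge0.
have E : ip (D i u) (X i u) = - (ip u u / 2).
  have : ip (D i (X i u)) u = - ip (X i u) (D i u) by exact: Dskew.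
  rewrite DX (ipDl ipP) (ipC ipP (X i u) (D i u)) Xsym => H; lra.
have := ip_ge0 ipP (D i u + t *: X i u).
by rewrite (ip_sqrD ipP) E; congr (0 <= _); field.
Qed.

End polyharmonic_forms.

(** * Square-integrable functions *)

Lemma quadratic_ge0 (R : realType) (a b c : R) : 0 <= c ->
  (forall t, 0 <= a + 2 * t * b + t ^+ 2 * c) -> b ^+ 2 <= a * c.
Proof.
rewrite le_eqVlt => /predU1P[<-|c0] H.
  have [->|b0] := eqVneq b 0; first by rewrite expr0n/= mulr0.
  have := H (- (a + 1) / (2 * b)).
  rewrite mulr0 addr0 (_ : a + _ = - 1); first by rewrite oppr_ge0 ler10.
  by field.
have := H (- b / c); rewrite (_ : _ + _ = (a * c - b ^+ 2) / c).
  by rewrite pmulr_lge0 ?invr_gt0// subr_ge0.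
by field; rewrite gt_eqF.
Qed.

Lemma cvg_sqr0 (R : realType) (u v : nat -> R) : (forall n, u n ^+ 2 <= v n) ->
  v @ \oo --> 0 -> u @ \oo --> 0.
Proof.
move=> uv /cvgrPdist_le v0; apply/cvgrPdist_le => e e0.
have := v0 (e ^+ 2); rewrite exprn_gt0// => /(_ isT); apply: filterS => n.
rewrite !sub0r !normrN => vn.
have : `|u n| ^+ 2 <= e ^+ 2.
  by rewrite real_normK ?num_real// (le_trans (uv n))// (le_trans (ler_norm _)).
by rewrite ler_pXn2r// nnegrE ltW.
Qed.

Section L2.
Context {R : realType} d (T : measurableType d).
Variables (mu : {measure set T -> \bar R}) (D : set T).
Hypothesis mD : measurable D.
Implicit Types f g h : T -> R.

Definition L2 f := measurable_fun D f /\ (\int[mu]_(x in D) ((f x) ^+ 2)%:E < +oo)%E.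

Definition L2ip f g : R := \int[mu]_(x in D) (f x * g x).

Lemma L2_integrable f g : L2 f -> L2 g -> mu.-integrable D (EFin \o (fun x => f x * g x)).
Proof.
move=> [mf fi] [mg gi].
have int_sqr h : measurable_fun D h -> (\int[mu]_(x in D) ((h x) ^+ 2)%:E < +oo)%E ->
    mu.-integrable D (fun x => (h x ^+ 2)%:E).
  move=> mh hi; apply/integrableP; split.
    exact/measurable_EFinP/measurable_funX.
  by under eq_integral do rewrite /= ger0_norm ?sqr_ge0//.
have := integrableD mD (int_sqr _ mf fi) (int_sqr _ mg gi).
apply: le_integrable => //; first exact/measurable_EFinP/measurable_funM.
move=> x _ /=; rewrite lee_fin [leRHS]ger0_norm ?addr_ge0 ?sqr_ge0// ler_norml.
have := sqr_ge0 (f x + g x); have := sqr_ge0 (f x - g x).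
by have := sqr_ge0 (f x); have := sqr_ge0 (g x); nra.
Qed.

Lemma L2_sqr f : L2 f -> mu.-integrable D (EFin \o (fun x => f x ^+ 2)).
Proof. by move=> Lf; under eq_fun do rewrite expr2; exact: L2_integrable. Qed.

Lemma L2_sqrP f : measurable_fun D f ->
  mu.-integrable D (EFin \o (fun x => f x ^+ 2)) -> L2 f.
Proof.
move=> mf /integrableP[_]; split=> //; move: b.
by under eq_integral do rewrite /= ger0_norm ?sqr_ge0//.
Qed.

Lemma L2D f g : L2 f -> L2 g -> L2 (fun x => f x + g x).
Proof.
move=> Lf Lg; have [[mf _] [mg _]] := (Lf, Lg).
apply: L2_sqrP; first exact: measurable_funD.
have := integrableD mD (integrableD mD (L2_sqr Lf) (L2_sqr Lg))
  (integrableD mD (L2_integrable Lf Lg) (L2_integrable Lf Lg)).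
congr (_.-integrable _ _); apply/funext => x /=; rewrite -!EFinD; congr EFin; ring.
Qed.

Lemma L2Z (a : R) f : L2 f -> L2 (fun x => a * f x).
Proof.
move=> Lf; have [mf _] := Lf.
apply: L2_sqrP; first exact: measurable_funM.
have := integrableZl mD (a ^+ 2) (L2_sqr Lf).
by congr (_.-integrable _ _); apply/funext => x /=; rewrite -EFinM exprMn.
Qed.

Lemma L2N f : L2 f -> L2 (fun x => - f x).
Proof. by move=> /(L2Z (-1)); under eq_fun do rewrite mulN1r. Qed.

Lemma L2B f g : L2 f -> L2 g -> L2 (fun x => f x - g x).
Proof. by move=> Lf Lg; apply: L2D => //; exact: L2N. Qed.

Lemma L20 : L2 (fun=> 0).
Proof.
by split=> //; under eq_integral do rewrite expr0n/=; rewrite integral0.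
Qed.

Lemma L2_sum I (r : seq I) (F : I -> T -> R) : (forall i, L2 (F i)) ->
  L2 (fun x => \sum_(i <- r) F i x).
Proof.
move=> LF; elim: r => [|i r IH]; first by under eq_fun do rewrite big_nil; exact: L20.
by under eq_fun do rewrite big_cons; exact: L2D.
Qed.

Lemma L2ipC f g : L2ip f g = L2ip g f.
Proof. by apply: eq_Rintegral => x _; rewrite mulrC. Qed.

Lemma L2ipDl f g h : L2 f -> L2 g -> L2 h ->
  L2ip (fun x => f x + g x) h = L2ip f h + L2ip g h.
Proof.
move=> Lf Lg Lh; rewrite /L2ip -RintegralD//; [|exact: L2_integrable..].
by apply: eq_Rintegral => x _; rewrite mulrDl.
Qed.

Lemma L2ipZl (a : R) f g : L2 f -> L2 g -> L2ip (fun x => a * f x) g = a * L2ip f g.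
Proof.
move=> Lf Lg; rewrite /L2ip -RintegralZl//; last exact: L2_integrable.
by apply: eq_Rintegral => x _; rewrite mulrA.
Qed.

Lemma L2ipNl f g : L2 f -> L2 g -> L2ip (fun x => - f x) g = - L2ip f g.
Proof.
by move=> Lf Lg; rewrite -mulN1r -L2ipZl//; apply: eq_Rintegral => x _; rewrite mulN1r.
Qed.

Lemma L2ipBl f g h : L2 f -> L2 g -> L2 h ->
  L2ip (fun x => f x - g x) h = L2ip f h - L2ip g h.
Proof. by move=> Lf Lg Lh; rewrite L2ipDl// ?L2ipNl//; exact: L2N. Qed.

Lemma L2ip_ge0 f : 0 <= L2ip f f.
Proof. by apply: Rintegral_ge0 => x _; rewrite -expr2 sqr_ge0. Qed.

Lemma L2ip_sqr f : L2ip f f = fine (\int[mu]_(x in D) ((f x) ^+ 2)%:E)%E.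
Proof. by congr fine; apply: eq_integral => x _; rewrite expr2. Qed.

Lemma L2ip_EFin f : L2 f -> (\int[mu]_(x in D) ((f x) ^+ 2)%:E)%E = (L2ip f f)%:E.
Proof.
move=> [mf fi]; rewrite L2ip_sqr fineK// ge0_fin_numE//.
by apply: integral_ge0 => x _; rewrite lee_fin sqr_ge0.
Qed.

Lemma L2_CauchySchwarz f g : L2 f -> L2 g -> L2ip f g ^+ 2 <= L2ip f f * L2ip g g.
Proof.
move=> Lf Lg; apply: quadratic_ge0; first exact: L2ip_ge0.
move=> t; have Ltg := L2Z t Lg; have Lftg := L2D Lf Ltg.
have := L2ip_ge0 (fun x => f x + t * g x).
rewrite (L2ipDl Lf Ltg Lftg) (L2ipZl t Lg Lftg) (L2ipC f) (L2ipC g).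
rewrite (L2ipDl Lf Ltg Lf) (L2ipDl Lf Ltg Lg) (L2ipZl t Lg Lf) (L2ipZl t Lg Lg) (L2ipC g f).
by congr (0 <= _); ring.
Qed.

Lemma L2ip_sqrD f g : L2 f -> L2 g ->
  L2ip (fun x => f x + g x) (fun x => f x + g x) = L2ip f f + 2 * L2ip f g + L2ip g g.
Proof.
move=> Lf Lg; have Lfg := L2D Lf Lg.
rewrite (L2ipDl Lf Lg Lfg) (L2ipC f) (L2ipC g (fun x => _ + _)).
by rewrite (L2ipDl Lf Lg Lf) (L2ipDl Lf Lg Lg) (L2ipC g f); ring.
Qed.

Definition L2cvg (fn : nat -> T -> R) f :=
  L2ip (fun x => f x - fn n x) (fun x => f x - fn n x) @[n --> \oo] --> 0.

Lemma L2cvgP fn f : (forall n, L2 (fn n)) -> L2 f ->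
  ((\int[mu]_(x in D) ((f x - fn n x) ^+ 2)%:E)%E @[n --> \oo] --> 0%E) <-> L2cvg fn f.
Proof.
move=> Lfn Lf; have E n := L2ip_EFin (L2B Lf (Lfn n)).
have {}E : (fun n => \int[mu]_(x in D) ((f x - fn n x) ^+ 2)%:E)%E =
    (fun n => (L2ip (fun x => f x - fn n x) (fun x => f x - fn n x))%:E).
  by apply/funext => n; exact: E.
by rewrite /L2cvg E; split=> [/fine_cvgP[]//|H]; apply: cvg_EFin => //; exact: nearW.
Qed.

Lemma L2ip_cvg fn gn f g : (forall n, L2 (fn n)) -> (forall n, L2 (gn n)) -> L2 f -> L2 g ->
  L2cvg fn f -> L2cvg gn g -> L2ip (fn n) (gn n) @[n --> \oo] --> L2ip f g.
Proof.
move=> Lfn Lgn Lf Lg cf cg.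
have Lbf n := L2B Lf (Lfn n); have Lbg n := L2B Lg (Lgn n).
pose df n x := f x - fn n x; pose dg n x := g x - gn n x.
have E : (fun n => L2ip (fn n) (gn n)) =
    (fun n => L2ip f g - L2ip (df n) g - L2ip (dg n) f + L2ip (df n) (dg n)).
  apply/funext => n.
  rewrite (L2ipBl Lf (Lfn n) Lg) (L2ipBl Lg (Lgn n) Lf) (L2ipBl Lf (Lfn n) (Lbg n)).
  rewrite (L2ipC f (dg n)) (L2ipC (fn n) (dg n)).
  rewrite (L2ipBl Lg (Lgn n) Lf) (L2ipBl Lg (Lgn n) (Lfn n)).
  by rewrite (L2ipC g f) (L2ipC (gn n) f) (L2ipC g (fn n)) (L2ipC (gn n) (fn n)); ring.
rewrite E; rewrite -[X in _ --> X]addr0; apply: cvgD; last first.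
  apply: (@cvg_sqr0 _ _ (fun n => L2ip (df n) (df n) * L2ip (dg n) (dg n))).
    by move=> n; exact: L2_CauchySchwarz (Lbf n) (Lbg n).
  by rewrite -[X in _ --> X](mulr0 0); apply: cvgM.
rewrite -[X in _ --> X]subr0; apply: cvgB; last first.
  apply: (@cvg_sqr0 _ _ (fun n => L2ip (dg n) (dg n) * L2ip f f)).
    by move=> n; exact: L2_CauchySchwarz (Lbg n) Lf.
  by rewrite -[X in _ --> X](mul0r (L2ip f f)); apply: cvgM => //; exact: cvg_cst.
rewrite -[X in _ --> X]subr0; apply: cvgB; first exact: cvg_cst.
apply: (@cvg_sqr0 _ _ (fun n => L2ip (df n) (df n) * L2ip g g)).
  by move=> n; exact: L2_CauchySchwarz (Lbf n) Lg.
by rewrite -[X in _ --> X](mul0r (L2ip g g)); apply: cvgM => //; exact: cvg_cst.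
Qed.

Lemma L2cvgD fn gn f g : (forall n, L2 (fn n)) -> (forall n, L2 (gn n)) -> L2 f -> L2 g ->
  L2cvg fn f -> L2cvg gn g ->
  L2cvg (fun n x => fn n x + gn n x) (fun x => f x + g x).
Proof.
move=> Lfn Lgn Lf Lg cf cg.
have Lbf n := L2B Lf (Lfn n); have Lbg n := L2B Lg (Lgn n).
pose df n x := f x - fn n x; pose dg n x := g x - gn n x.
rewrite /L2cvg; have E n : (fun x => f x + g x - (fn n x + gn n x)) = (fun x => df n x + dg n x).
  by apply/funext => x; rewrite /df /dg opprD addrACA.
under eq_fun do rewrite E.
have {}E : (fun n => L2ip (fun x => df n x + dg n x) (fun x => df n x + dg n x)) =
    (fun n => L2ip (df n) (df n) + 2 * L2ip (df n) (dg n) + L2ip (dg n) (dg n)).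
  by apply/funext => n; exact: L2ip_sqrD (Lbf n) (Lbg n).
have H : L2ip (df n) (dg n) @[n --> \oo] --> 0.
  apply: (@cvg_sqr0 _ _ (fun n => L2ip (df n) (df n) * L2ip (dg n) (dg n))).
    by move=> n; exact: L2_CauchySchwarz (Lbf n) (Lbg n).
  by rewrite -[X in _ --> X](mulr0 0); apply: cvgM.
have H2 : 2 * L2ip (df n) (dg n) @[n --> \oo] --> 0.
  by rewrite -[X in _ --> X](mulr0 2); apply: cvgM => //; exact: cvg_cst.
have HH := cvgD (cvgD cf H2) cg; rewrite !addr0 in HH.
rewrite E; exact: HH.
Qed.

Lemma L2cvg_sum I (r : seq I) (Fn : I -> nat -> T -> R) (F : I -> T -> R) :
  (forall i n, L2 (Fn i n)) -> (forall i, L2 (F i)) ->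
  (forall i, L2cvg (Fn i) (F i)) ->
  L2cvg (fun n x => \sum_(i <- r) Fn i n x) (fun x => \sum_(i <- r) F i x).
Proof.
move=> LFn LF cF; elim: r => [|i r IH].
  rewrite /L2cvg; under eq_fun => n do under eq_fun do rewrite !big_nil subr0.
  rewrite (_ : (fun=> _) = fun=> 0); first exact: cvg_cst.
  apply/funext => n; rewrite /L2ip; under eq_Rintegral do rewrite mulr0.
  by rewrite Rintegral_cst// mul0r.
rewrite (_ : (fun n x => _) = (fun n x => Fn i n x + \sum_(j <- r) Fn j n x)); last first.
  by apply/funext => n; apply/funext => x; rewrite big_cons.
rewrite (_ : (fun x => _) = (fun x => F i x + \sum_(j <- r) F j x)); last first.
  by apply/funext => x; rewrite big_cons.
by apply: L2cvgD => // [n|]; exact: L2_sum.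
Qed.

(** * Completeness under geometric Cauchy bounds *)

Section completeness.
Variables (f : nat -> T -> R) (C : R).
Hypothesis Lf : forall n, L2 (f n).
Hypothesis fC : forall n k, (n <= k)%N ->
  L2ip (fun x => f k x - f n x) (fun x => f k x - f n x) <= C / 4 ^+ n.

(** Squares of increments decay like [4^-n], so the factor [2^n] leaves summable integrals. Since
    [|a| <= 2^-n + 2^n a^2], finiteness of the sum of the [b n x] makes the increments at [x]
    absolutely summable. *)
Let b n x : R := 2 ^+ n * (f n.+1 x - f n x) ^+ 2.
Let S x : \bar R := (\sum_(n <oo) (b n x)%:E)%E.

Let b0 n x : 0 <= b n x.
Proof. by apply: mulr_ge0; [exact: exprn_ge0|exact: sqr_ge0]. Qed.

Let mf n : measurable_fun D (f n). Proof. by case: (Lf n). Qed.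

Let mb n : measurable_fun D (fun x => (b n x)%:E).
Proof.
by apply/measurable_EFinP/measurable_funM => //; apply: measurable_funX; exact: measurable_funB.
Qed.

Let mS : measurable_fun D S.
Proof. by apply: ge0_emeasurable_sum => // n x _ _; rewrite lee_fin. Qed.

Let intb n : (\int[mu]_(x in D) (b n x)%:E <= ((2 * C) / (2 ^ (n + 1))%:R)%:E)%E.
Proof.
under eq_integral do rewrite /b EFinM.
rewrite ge0_integralZl//; last 2 first.
- by apply/measurable_EFinP/measurable_funX/measurable_funB.
- by move=> x _; rewrite lee_fin sqr_ge0.
rewrite (L2ip_EFin (L2B (Lf n.+1) (Lf n))) -EFinM lee_fin.
have z0 : 0 < 2 ^+ n :> R by rewrite exprn_gt0.
apply: le_trans (ler_wpM2l (ltW z0) (fC (leqnSn n))) _.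
rewrite addn1 natrX exprS le_eqVlt; apply/orP; left.
rewrite (_ : 4 = 2 * 2); last by ring.
rewrite exprMn; move: z0; set z := _ ^+ n => z0; apply/eqP; field.
by rewrite gt_eqF.
Qed.

Let C0 : 0 <= C.
Proof.
have := fC (leqnn 0); rewrite expr0 divr1; apply: le_trans; exact: L2ip_ge0.
Qed.

Let intS : mu.-integrable D S.
Proof.
apply/integrableP; split => //.
rewrite (eq_integral S); last first.
  by move=> x _; rewrite gee0_abs// nneseries_ge0// => n _ _; rewrite lee_fin.
rewrite integral_nneseries//; last by move=> n x _; rewrite lee_fin.
apply: (@le_lt_trans _ _ (\sum_(n <oo) ((2 * C) / (2 ^ (n + 1))%:R)%:E)%E).
  apply: lee_nneseries => [n _ _|n _]; last exact: intb.
  by apply: integral_ge0 => x _; rewrite lee_fin.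
have := @cvg_geometric_eseries_half R (2 * C) 0.
by move=> /cvg_lim; rewrite /eseries => -> //; rewrite ltry.
Qed.

(** On [E] the sequence converges pointwise; setting it to 0 elsewhere gives a limit at every point,
    hence a measurable one. *)
Let E := D `&` [set x | S x \is a fin_num].

Let mE : measurable E. Proof. exact: emeasurable_fin_num. Qed.

Let f' n := f n \_ E.

Let f'_cvg x : cvgn (f' ^~ x).
Proof.
rewrite /f'; have [xE|xE] := boolP (x \in E); last first.
  rewrite (_ : (fun n => _) = fun=> 0); first exact: is_cvg_cst.
  by apply/funext => n; rewrite patchE (negbTE xE).
rewrite (_ : (fun n => _) = f ^~ x); last by apply/funext => n; rewrite patchE xE.
have Sx : S x \is a fin_num by move: xE; rewrite inE => -[].
pose a n := f n.+1 x - f n x.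
have -> : f ^~ x = (fun n => f 0%N x + series a n).
  apply/funext => n; rewrite (eq_sum_telescope (f ^~ x) n).
  by congr (_ + series _ n); apply/funext => k; rewrite /telescope.
apply: is_cvgD; first exact: is_cvg_cst.
apply: normed_cvg; apply: (@nondecreasing_is_cvgn _ (series (fun k => `|a k|))).
  by apply/nondecreasing_seqP => n; rewrite seriesSr lerDl.
exists (2 + fine (S x)) => _ [n _ <-]; rewrite seriesEnat.
apply: (@le_trans _ _ (\sum_(0 <= k < n) ((1 / 2) ^+ k + b k x))).
  apply: ler_sum => k _; rewrite /b -/(a k).
  have := sqr_ge0 (1 - 2 ^+ k * `|a k|); set z : R := 2 ^+ k.
  have z0 : 0 < z by rewrite exprn_gt0.
  rewrite expr_div_n expr1n -/z.
  have -> : a k ^+ 2 = `|a k| ^+ 2 by rewrite real_normK ?num_real.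
  rewrite -(@ler_pM2l _ z)// mulrDr mul1r divff ?gt_eqF//.
  have := normr_ge0 (a k); set w := `|_| => w0 H; have := mulr_ge0 (ltW z0) w0; nra.
rewrite big_split/=; apply: lerD.
  rewrite (_ : \sum_(0 <= k < n) (1 / 2) ^+ k = series (geometric 1 (1 / 2)) n); last first.
    by rewrite seriesEnat; apply: eq_bigr => k _; exact: esym (mul1r _).
  rewrite geometric_seriesE; last by rewrite lt_eqF// ltr_pdivrMr// mul1r ltr1n.
  have : 0 <= (1 / 2) ^+ n :> R by rewrite exprn_ge0.
  rewrite /= (_ : 1 - 1 / 2 = 2^-1 :> R); last by field.
  by rewrite invrK mul1r; set z := _ ^+ n; lra.
rewrite -lee_fin fineK// -sumEFin; apply: nneseries_lim_ge => k _ _.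
by rewrite lee_fin.
Qed.

Lemma L2_complete : exists2 g, L2 g &
  forall n, L2ip (fun x => g x - f n x) (fun x => g x - f n x) <= C / 4 ^+ n.
Proof.
pose g x := limn (f' ^~ x).
have cg x : f' ^~ x @ \oo --> g x by exact: f'_cvg.
have mf' n : measurable_fun D (f' n).
  have := (measurable_restrict (f n) mE mD).1; apply.
  by apply: measurable_funS (mf n) => // x [].
have mg : measurable_fun D g by apply: (measurable_fun_cvg mf') => x _; exact: cg.
have [N [mN N0 subN]] := integrable_ae mD intS.
(* Fatou's lemma for [f (k + n)] with [n] fixed; off the null set [N] the truncated sequence is the
   original one. *)
have key n : (\int[mu]_(x in D) ((g x - f n x) ^+ 2)%:E <= (C / 4 ^+ n)%:E)%E.
  pose u k x := ((f' (k + n)%N x - f n x) ^+ 2)%:E : \bar R.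
  have mu_ k : measurable_fun D (u k).
    by apply/measurable_EFinP/measurable_funX/measurable_funB.
  have lu x : limn_einf (u ^~ x) = ((g x - f n x) ^+ 2)%:E.
    apply: (cvg_limn_einf_sup _).1; apply: cvg_EFin; first exact: nearW.
    have H : f' (k + n)%N x - f n x @[k --> \oo] --> g x - f n x.
      by apply: cvgB; [have := cg x; rewrite -(@cvg_shiftn n)|exact: cvg_cst].
    rewrite expr2 (_ : _ \o _ = (fun k => (f' (k + n)%N x - f n x) * (f' (k + n)%N x - f n x))).
      exact: (cvgM H H).
    by apply/funext => k; rewrite /u /= expr2.
  rewrite (eq_integral (fun x => limn_einf (u ^~ x))); last by move=> x _; rewrite lu.
  apply: le_trans (fatou mu mD mu_ _) _; first by move=> k x _; rewrite lee_fin sqr_ge0.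
  rewrite limn_einf_lim; apply: lime_le; first exact: is_cvg_einfs.
  apply: nearW => k; apply: (@le_trans _ _ (\int[mu]_(x in D) u k x)%E).
    by apply: ereal_inf_lbound; exists k => /=.
  rewrite (_ : (\int[mu]_(x in D) u k x)%E = \int[mu]_(x in D) ((f (k + n)%N x - f n x) ^+ 2)%:E)%E.
    by rewrite (L2ip_EFin (L2B (Lf _) (Lf _))) lee_fin fC// leq_addl.
  apply: ge0_ae_eq_integral => //.
  - by apply/measurable_EFinP/measurable_funX/measurable_funB.
  - by move=> x _; rewrite lee_fin sqr_ge0.
  - by move=> x _; rewrite lee_fin sqr_ge0.
  exists N; split=> // x; apply: contra_notP => Nx Dx; rewrite /u /f' patchE ifT//.
  rewrite inE; split=> //=; apply: contra_notP Nx => Sx; apply: subN => /=.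
  by move=> /(_ Dx).
have Lgf n : L2 (fun x => g x - f n x).
  by split; [exact: measurable_funB|exact: le_lt_trans (key n) (ltry _)].
exists g.
  have := L2D (Lgf 0%N) (Lf 0%N); congr L2; apply/funext => x; exact: subrK.
by move=> n; rewrite -lee_fin -L2ip_EFin.
Qed.

End completeness.
End L2.

(** * Rellich compactness *)

Lemma le_of_eq (R : realType) (x y : R) : x = y -> x <= y.
Proof. by move=> ->. Qed.

Section rellich.
Context {R : realType}.
Local Notation leb n := (@lebesgue_rV R n).
Local Notation mu1 := (@lebesgue_measure R).
Local Notation e i := (delta_mx ord0 i).

Lemma bbR_D f g : bbR f -> bbR g -> bbR (fun x : measurableTypeR R => f x + g x).
Proof. by apply: bounded_inD => //; exact: sub_seg. Qed.
Lemma bbR_M f g : bbR f -> bbR g -> bbR (fun x : measurableTypeR R => f x * g x).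
Proof. by apply: bounded_inMM => //; exact: sub_seg. Qed.
Lemma bbR_Z k f : bbR f -> bbR (fun x : measurableTypeR R => k * f x).
Proof. by apply: bounded_inZ => //; exact: sub_seg. Qed.
Lemma bbV_B n (f g : 'rV[R]_n -> R) : bbV f -> bbV g -> bbV (fun x => f x - g x).
Proof. by apply: bounded_inB => //; exact: sub_box. Qed.
Lemma bbV_M n (f g : 'rV[R]_n -> R) : bbV f -> bbV g -> bbV (fun x => f x * g x).
Proof. by apply: bounded_inMM => //; exact: sub_box. Qed.
Lemma bbV_Z n k (f : 'rV[R]_n -> R) : bbV f -> bbV (fun x => k * f x).
Proof. by apply: bounded_inZ => //; exact: sub_box. Qed.
Lemma bbV_X n (f : 'rV[R]_n -> R) : bbV f -> bbV (fun x => f x ^+ 2).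
Proof. by apply: bounded_inX => //; exact: sub_box. Qed.
Lemma bbR_X (f : measurableTypeR R -> R) : bbR f -> bbR (fun x => f x ^+ 2).
Proof. by apply: bounded_inX => //; exact: sub_seg. Qed.

Lemma bbR_L2 (f : measurableTypeR R -> R) : bbR f -> L2 mu1 setT f.
Proof.
move=> bf; apply: L2_sqrP => //; first by case: bf.
exact/bbR_integrable/bbR_X.
Qed.

Lemma bbV_L2 n (f : 'rV[R]_n -> R) : bbV f -> L2 (leb n) setT f.
Proof.
move=> bf; apply: L2_sqrP => //; first by case: bf.
exact/bbV_integrable/bbV_X.
Qed.

Section interval_average.
Variables (a b : R).
Hypothesis ab : a < b.
Let I : set (measurableTypeR R) := `[a, b[%classic.

Let mI : measurable I. Proof. exact: measurable_itv. Qed.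

Lemma bbR_indic (J : set (measurableTypeR R)) : measurable J -> J `<=` `[a, b]%classic ->
  bbR (\1_J : measurableTypeR R -> R).
Proof.
move=> mJ JI; split; first exact: measurable_indic.
exists (1 + `|a| + `|b|); split=> x.
  rewrite indicE; case: (_ \in _); rewrite ?normr1 ?normr0 ?addr_ge0//.
  by rewrite -addrA lerDl addr_ge0.
rewrite indicE; case: (boolP (x \in J)) => [|_]; last by rewrite eqxx.
rewrite inE => /JI /=; rewrite in_itv/= => /andP[ax xb] _.
rewrite /seg /= in_itv/= -ler_norml ler_norml.
have := ler_norm b; have := ler_norm (- a); rewrite normrN.
by have := normr_ge0 a; have := normr_ge0 b; lra.
Qed.

Lemma bbR_indicI : bbR (\1_I : measurableTypeR R -> R).
Proof. by apply: bbR_indic => // x; rewrite /I /= !in_itv/= => /andP[-> /ltW ->]. Qed.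

Lemma Rint_indicI : \int[mu1]_x \1_I x = b - a.
Proof.
rewrite /Rintegral integral_indic// setIT.
have H := lebesgue_measure_itv `[a, b[; rewrite [X in fine X]H /=.
by rewrite lte_fin ab.
Qed.

(** The integral of the square splits into the contribution of the mean [m] and the variance, and
    [psi] stays within [r] of its mean. *)
Lemma average_bound (psi : measurableTypeR R -> R) (r : R) : bbR psi -> 0 <= r ->
  (forall x y, I x -> I y -> `|psi x - psi y| <= r) ->
  \int[mu1]_x (psi x ^+ 2 * \1_I x) <=
    (b - a)^-1 * (\int[mu1]_x (psi x * \1_I x)) ^+ 2 + (b - a) * r ^+ 2.
Proof.
move=> bp r0 pr; set eta := b - a; have eta0 : 0 < eta by rewrite subr_gt0.
have bI := bbR_indicI; have bpI := bbR_M bp bI.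
have Eeta : eta = \int[mu1]_x \1_I x by rewrite Rint_indicI.
set s := \int[mu1]_x (psi x * \1_I x); pose m := s / eta.
have pm x : I x -> `|psi x - m| <= r.
  move=> Ix; rewrite -(ler_pM2r eta0) -{1}(gtr0_norm eta0) -normrM mulrBl divfK ?gt_eqF//.
  have -> : psi x * eta - s = \int[mu1]_y ((psi x - psi y) * \1_I y).
    rewrite Eeta -RintegralZl//; last exact: bbR_integrable.
    rewrite /s -RintegralB//; [|exact/bbR_integrable/bbR_Z|exact: bbR_integrable].
    by apply: eq_Rintegral => y _; rewrite mulrBl.
  have bd : bbR (fun y => (psi x - psi y) * \1_I y).
    have := bbR_D (bbR_Z (psi x) bI) (bbR_Z (-1) bpI).
    by congr bbR; apply/funext => y; ring.
  apply: le_trans (le_normr_Rintegral measurableT (bbR_integrable bd)) _.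
  rewrite Eeta -RintegralZl//; last exact: bbR_integrable.
  apply: le_Rintegral => //.
  - rewrite (_ : EFin \o _ = abse \o (EFin \o fun y => (psi x - psi y) * \1_I y)); last exact/funext.
    exact/integrable_abse/bbR_integrable.
  - exact/bbR_integrable/bbR_Z.
  move=> y _; rewrite normrM [`|\1_I y|]ger0_norm//.
  rewrite indicE; case: (boolP (y \in I)) => [|_]; last by rewrite !mulr0.
  by rewrite inE !mulr1 => Iy; exact: pr.
have E : \int[mu1]_x (psi x ^+ 2 * \1_I x) =
    \int[mu1]_x ((psi x - m) ^+ 2 * \1_I x) + eta^-1 * s ^+ 2.
  have bq : bbR (fun x => (psi x - m) ^+ 2 * \1_I x).
    have := bbR_D (bbR_M (bbR_X bp) bI) (bbR_D (bbR_Z (- 2 * m) bpI) (bbR_Z (m ^+ 2) bI)).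
    by congr bbR; apply/funext => y; ring.
  have -> : eta^-1 * s ^+ 2 = 2 * m * s - m ^+ 2 * eta.
    by rewrite /m; field; rewrite gt_eqF.
  rewrite Eeta /s -!RintegralZl//; try exact: bbR_integrable.
  rewrite -RintegralB//; try exact/bbR_integrable/bbR_Z.
  rewrite -RintegralD//; last 2 first.
  - exact: bbR_integrable.
  - have := bbR_D (bbR_Z (2 * m) bpI) (bbR_Z (- (m ^+ 2)) bI) => /bbR_integrable.
    by congr (_.-integrable _ _); apply/funext => y /=; congr EFin; ring.
  by apply: eq_Rintegral => y _; ring.
rewrite E addrC lerD2l Eeta mulrC -RintegralZl//; last exact: bbR_integrable.
apply: le_Rintegral => //; last first.
  move=> x _; rewrite indicE; case: (boolP (x \in I)) => [|_]; last by rewrite !mulr0.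
  rewrite inE => Ix; rewrite !mulr1.
  by rewrite -real_normK ?num_real// ler_pXn2r ?nnegrE// pm.
- exact/bbR_integrable/bbR_Z.
- have := bbR_D (bbR_M (bbR_X bp) bI) (bbR_D (bbR_Z (- 2 * m) bpI) (bbR_Z (m ^+ 2) bI)).
  move=> /bbR_integrable; congr (_.-integrable _ _).
  by apply/funext => y /=; congr EFin; ring.
Qed.

(** The fundamental theorem of calculus on the segment from [y] to [x], then Cauchy-Schwarz. *)
Lemma increment_bound (F f : R -> R) (x y : R) : (forall x : R, is_derive x 1 F (f x)) ->
  continuous f -> I x -> I y ->
  bbR f -> (F x - F y) ^+ 2 <= (b - a) * \int[mu1]_s (f s ^+ 2 * \1_I s).
Proof.
move=> dF cf; wlog xy : x y / y <= x.
  move=> H; have [|/ltW] := leP y x; first exact: H.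
  by rewrite -sqrrN opprB => xy Ix Iy; exact: H.
move=> Ix Iy bf; move: xy; rewrite le_eqVlt => /predU1P[->|yx].
  rewrite subrr expr0n/=; apply: mulr_ge0; first by rewrite subr_ge0 ltW.
  by apply: Rintegral_ge0 => s _; apply: mulr_ge0; rewrite ?sqr_ge0.
pose J : set (measurableTypeR R) := `[y, x]%classic.
have JI : J `<=` I.
  move: Ix Iy; rewrite /J /I /= !in_itv/= => /andP[ax xb] /andP[ay yb] s /=.
  by rewrite !in_itv/= => /andP[ys sx]; rewrite (le_trans ay ys) (le_lt_trans sx xb).
have mJ : measurable J by exact: measurable_itv.
have bJ : bbR (\1_J : measurableTypeR R -> R).
  by apply: bbR_indic => // s /JI; rewrite /I /= !in_itv/= => /andP[-> /ltW ->].
have cF : continuous F.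
  move=> t; apply: differentiable_continuous; apply/derivable1_diffP.
  by case: (dF t).
have FTC : F x - F y = \int[mu1]_(s in J) f s.
  rewrite /Rintegral /J (@continuous_FTC2 _ f F)//.
  - exact: continuous_subspaceT.
  - split; [by move=> s _; case: (dF s)|exact/cvg_at_right_filter/cF|
      exact/cvg_at_left_filter/cF].
  - by move=> s _; rewrite derive1E; case: (dF s).
have bI := bbR_indicI; have bfI := bbR_M bf bI.
have -> : F x - F y = L2ip mu1 setT (\1_J : measurableTypeR R -> R) (fun s => f s * \1_I s).
  rewrite FTC Rintegral_mkcond /L2ip; apply: eq_Rintegral => s _.
  rewrite patchE indicE; case: ifPn => sJ; last by rewrite mul0r.
  by rewrite indicE mem_set ?mulr1 ?mul1r//; apply: JI; rewrite inE in sJ.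
apply: le_trans (L2_CauchySchwarz measurableT (bbR_L2 bJ) (bbR_L2 bfI)) _.
have sqI (A : set (measurableTypeR R)) s : \1_A s * \1_A s = \1_A s :> R.
  by rewrite indicE; case: (_ \in _); rewrite ?mulr1 ?mulr0.
apply: ler_pM.
- exact: L2ip_ge0.
- exact: L2ip_ge0.
- rewrite /L2ip (eq_Rintegral _ (g := \1_J)); last by move=> s _; exact: sqI.
  rewrite -Rint_indicI; apply: le_Rintegral => //; try exact: bbR_integrable.
  move=> s _; rewrite !indicE; case: (boolP (s \in J)) => // sJ.
  by rewrite mem_set//; apply: JI; rewrite inE in sJ.
- rewrite /L2ip le_eqVlt; apply/orP; left; apply/eqP.
  by apply: eq_Rintegral => s _; rewrite mulrACA sqI expr2.
Qed.

End interval_average.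

(** The cells cut [[-2, 2[] into [N.+1] equal half-open intervals; the margin around [[-1, 1]],
    where the supports lie, avoids trouble at the end points. *)
Definition cell (N j : nat) : R := - 2 + j%:R * (4 / N.+1%:R).

Lemma cellS N j : cell N j.+1 - cell N j = 4 / N.+1%:R.
Proof. by rewrite /cell -addn1 natrD; ring. Qed.

Lemma cell_lt N j : cell N j < cell N j.+1.
Proof. by rewrite -subr_gt0 cellS divr_gt0. Qed.

Local Notation cell_itv N j := (`[cell N j, cell N j.+1[%classic : set (measurableTypeR R)).

Lemma sum_cells N (x : R) : `|x| <= 1 -> \sum_(j < N.+1) \1_(cell_itv N j) x = 1 :> R.
Proof.
rewrite ler_norml => /andP[x1 x2].
have E (j : nat) : \1_(cell_itv N j) x = (x < cell N j.+1)%R%:R - (x < cell N j)%R%:R :> R.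
  rewrite indicE mem_setE in_itv/= leNgt; have := cell_lt N j.
  have [x3|x3] := ltP x (cell N j) => H; last by rewrite subr0.
  by rewrite (lt_trans x3 H) subrr.
under eq_bigr do rewrite E.
rewrite -(big_mkord xpredT (fun j => (x < cell N j.+1)%R%:R - (x < cell N j)%R%:R)).
rewrite telescope_sumr// /cell mul0r addr0 mulrCA divff ?mulr1 ?pnatr_eq0//.
by rewrite [X in X - _](_ : _ = 1) ?[X in _ - X](_ : _ = 0) ?subr0//;
  case: ltP => // ?; exfalso; lra.
Qed.

Definition C1box n (f : 'rV[R]_n -> R) := [/\ continuous f, forall i, C1dir i f &
  forall x, f x != 0 -> box 1 x].

Lemma C1box_bbV n (f : 'rV[R]_n -> R) : C1box f -> bbV f.
Proof. by move=> [cf _ f1]; apply: (bbV_continuous cf f1). Qed.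

Lemma C1box_partial n (f : 'rV[R]_n -> R) i : C1box f -> bbV (partial i f).
Proof.
by move=> [cf /(_ i)[_ cp] f1]; exact: (bbV_continuous cp (partial_support f1)).
Qed.

Lemma C1box_slice n (f : 'rV[R]_n.+1 -> R) (a : R) : C1box f ->
  C1box (fun v => f (rV_cons (a, v))).
Proof.
move=> [cf pf f1]; split; last by move=> v /f1/norm_rV_cons[].
  by move=> v; apply: (continuous_comp (@continuous_cons _ _ a v)); exact: cf.
move=> j; have [dj cj] := pf (rshift 1 j); split; first by move=> v; exact: derivable_cons.
rewrite (_ : partial j _ = partial (rshift 1 j : 'I_n.+1) f \o (fun v => rV_cons (a, v))).
  by move=> v; apply: (continuous_comp (@continuous_cons _ _ a v)); exact: cj.
by apply/funext => v; rewrite /= partial_cons.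
Qed.

Definition lift_last n (g : 'rV[R]_n -> R) (u : 'rV[R]_n.+1) := g (rV_uncons u).2.
Definition lift_first n (g : R -> R) (u : 'rV[R]_n.+1) := g (rV_uncons u).1.

Lemma bbV_lift n g (w : 'rV[R]_n -> R) : bbR g -> bbV w ->
  bbV (fun u : 'rV[R]_n.+1 => lift_first g u * lift_last w u).
Proof.
move=> [mg [M [gM gs]]] [mw [N [wN ws]]]; split.
  apply: measurable_funM.
    apply: (measurableT_comp mg); apply: (measurableT_comp (@measurable_fst _ _ _ _)).
    exact: measurable_rV_uncons.
  apply: (measurableT_comp mw); apply: (measurableT_comp (@measurable_snd _ _ _ _)).
  exact: measurable_rV_uncons.
exists (`|M| * `|N| + `|M| + `|N|); split=> u.
  apply: (@le_trans _ _ (`|M| * `|N|)); last by rewrite -addrA lerDl addr_ge0.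
  rewrite normrM; apply: ler_pM => //.
    exact: le_trans (gM _) (ler_norm _).
  exact: le_trans (wN _) (ler_norm _).
rewrite mulf_eq0 negb_or => /andP[/gs u1 /ws u2].
rewrite -(rV_unconsK u) (surjective_pairing (rV_uncons u)); apply/norm_rV_cons; split.
  move: u1; rewrite /seg /= in_itv/= -ler_norml => /le_trans; apply.
  rewrite (le_trans (ler_norm _))// -addrA [`|M| + _]addrC addrA lerDr.
  by rewrite addr_ge0// mulr_ge0.
apply: sub_box u2; rewrite (le_trans (ler_norm _))// lerDr.
by rewrite addr_ge0// mulr_ge0.
Qed.

Section step.
Variables (n : nat) (f : 'rV[R]_n.+1 -> R) (w : 'rV[R]_n -> R) (N : nat).
Hypothesis Cf : C1box f.
Hypothesis bw : bbV w.

Local Notation o := (lshift n (ord0 : 'I_1) : 'I_n.+1).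

Let bf : bbV f := C1box_bbV Cf.
Let bp : bbV (partial o f) := C1box_partial o Cf.

Lemma bbV_lift_last (F : 'rV[R]_n.+1 -> R) (g : 'rV[R]_n -> R) : bbV F -> bbV g -> bbV (fun u => F u * lift_last g u).
Proof.
move=> bF [mg [M [gM _]]]; apply: bounded_inM => //; [exact: sub_box| |by exists M => u; exact: gM].
apply: measurableT_comp => //; apply: (measurableT_comp (@measurable_snd _ _ _ _)).
exact: measurable_rV_uncons.
Qed.

Lemma bbV_lift_first (F : 'rV[R]_n.+1 -> R) g : bbV F -> bbR g -> bbV (fun u => F u * lift_first g u).
Proof.
move=> bF [mg [M [gM _]]]; apply: bounded_inM => //; [exact: sub_box| |by exists M => u; exact: gM].
apply: (measurableT_comp mg); apply: (measurableT_comp (@measurable_fst _ _ _ _)).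
exact: measurable_rV_uncons.
Qed.

Lemma lift_last_cons (g : 'rV[R]_n -> R) p : lift_last g (rV_cons p) = g p.2.
Proof. by rewrite /lift_last rV_consK. Qed.

Lemma lift_first_cons g (p : R * 'rV[R]_n) : lift_first g (rV_cons p) = g p.1.
Proof. by rewrite /lift_first rV_consK. Qed.

Let psi (a : measurableTypeR R) := \int[leb n]_v (f (rV_cons (a, v)) * w v).
Let Ew := \int[leb n]_v (w v ^+ 2).
Let eta : R := 4 / N.+1%:R.
Let ind j : measurableTypeR R -> R := \1_(cell_itv N j).
Let G j := \int[leb n.+1]_u (partial o f u ^+ 2 * lift_first (ind j) u).

Let bind j : bbR (ind j). Proof. exact: bbR_indicI. Qed.

Let bpsi : bbR psi.
Proof.
have := bbR_Rint (bbV_lift_last bf bw); congr bbR; apply/funext => a.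
by apply: eq_Rintegral => v _; rewrite lift_last_cons.
Qed.

Let Ew0 : 0 <= Ew. Proof. by apply: Rintegral_ge0 => v _; rewrite sqr_ge0. Qed.

Let G0 j : 0 <= G j.
Proof.
by apply: Rintegral_ge0 => v _; rewrite mulr_ge0 ?sqr_ge0// /lift_first /ind indicE.
Qed.

Let eta0 : 0 < eta. Proof. by rewrite divr_gt0. Qed.

Lemma psi_increment j x y : (cell_itv N j) x -> (cell_itv N j) y ->
  (psi x - psi y) ^+ 2 <= Ew * (eta * G j).
Proof.
move=> Ix Iy; have bx := bbV_slice x bf; have by_ := bbV_slice y bf.
have bd := bbV_B bx by_.
have -> : psi x - psi y =
    L2ip (leb n) setT w (fun v => f (rV_cons (x, v)) - f (rV_cons (y, v))).
  rewrite /psi /L2ip -RintegralB//; [|exact/bbV_integrable/bbV_M..].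
  by apply: eq_Rintegral => v _; ring.
apply: le_trans (L2_CauchySchwarz measurableT (bbV_L2 bw) (bbV_L2 bd)) _.
have -> : L2ip (leb n) setT w w = Ew by apply: eq_Rintegral => v _; rewrite expr2.
rewrite ler_wpM2l//.
have bG := bbV_lift_first (bbV_X bp) (bind j).
have bi := bbV_Rint bG.
rewrite /G (fubini_cons2 bG) -RintegralZl//; last exact: bbV_integrable.
apply: le_Rintegral => //.
- exact/bbV_integrable/bbV_M.
- exact/bbV_integrable/bbV_Z.
move=> v _; rewrite -expr2.
have [cf pf f1] := Cf; have [df cpf] := pf o.
have := @increment_bound (cell N j) (cell N j.+1) (cell_lt N j)
  (fun a => f (rV_cons (0, v) + a *: e o)) (fun a => partial o f (rV_cons (0, v) + a *: e o)) x y.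
rewrite -!rV_cons_line cellS => H; apply: le_trans (H _ _ Ix Iy _) _.
- by move=> a; apply: is_derive_line.
- exact: continuous_line.
- have := bbR_slice v bp; congr bbR; apply/funext => a; by rewrite rV_cons_line.
apply: ler_wpM2l; first exact: ltW.
apply: le_of_eq; apply: eq_Rintegral => s _.
by rewrite -rV_cons_line lift_first_cons.
Qed.

(** [psi] is the moment of the slices of [f] against [w]. Its integral over a cell is a moment of
    [f] against an indicator times [w], and its oscillation there is controlled by the first partial
    derivative, with a factor that is small for short cells. *)
Lemma psi_bound : \int[mu1]_a (psi a ^+ 2) <=
  eta^-1 * \sum_(j < N.+1)
     (\int[leb n.+1]_u (f u * (lift_first (ind j) u * lift_last w u))) ^+ 2 +
  eta ^+ 2 * Ew * \int[leb n.+1]_u (partial o f u ^+ 2).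
Proof.
have [cf pf f1] := Cf.
have -> : \int[mu1]_a (psi a ^+ 2) = \sum_(j < N.+1) \int[mu1]_a (psi a ^+ 2 * ind j a).
  rewrite -(Rint_sum measurable_seg seg_fin sub_seg)//; last first.
    by move=> j _; apply: bbR_M; [exact: bbR_X|exact: bind].
  apply: eq_Rintegral => a _; rewrite -mulr_sumr.
  have [a1|a1] := leP `|a| 1; first by rewrite sum_cells// mulr1.
  rewrite (_ : psi a = 0) ?expr0n/= ?mul0r// /psi (_ : (fun v => _) = cst 0).
    by rewrite Rintegral_cst// mul0r.
  apply/funext => v /=; have [->|/f1/norm_rV_cons[]] := eqVneq (f (rV_cons (a, v))) 0.
    by rewrite mul0r.
  by rewrite leNgt a1.
have -> : \int[leb n.+1]_u (partial o f u ^+ 2) = \sum_(j < N.+1) G j.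
  rewrite -(Rint_sum (@measurable_box _ _) (@box_fin _ _) (@sub_box _ _))//; last first.
    by move=> j _; apply: bbV_lift_first; [exact: bbV_X|exact: bind].
  apply: eq_Rintegral => u _; rewrite -mulr_sumr.
  have [->|/(partial_support f1) u1] := eqVneq (partial o f u) 0.
    by rewrite expr0n/= mul0r.
  by rewrite /lift_first sum_cells ?mulr1//; exact: u1.
rewrite !mulr_sumr -big_split/=; apply: ler_sum => j _.
have r0 : 0 <= Num.sqrt (Ew * (eta * G j)) by exact: sqrtr_ge0.
have := @average_bound _ _ (cell_lt N j) psi _ bpsi r0.
rewrite cellS sqr_sqrtr; last by rewrite mulr_ge0// mulr_ge0// ltW.
move=> H; apply: le_trans (H _) _.
  move=> x y Ix Iy; rewrite -sqrtr_sqr ler_wsqrtr//.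
  exact: psi_increment Ix Iy.
rewrite -/eta -/(ind j); apply: lerD; last by apply: le_of_eq; ring.
apply: ler_wpM2l; first by rewrite invr_ge0 ltW.
have bfi := bbV_lift_last (bbV_lift_first bf (bind j)) bw.
apply: le_of_eq; congr (_ ^+ 2).
transitivity (\int[leb n.+1]_u (f u * lift_first (ind j) u * lift_last w u)); last first.
  by apply: eq_Rintegral => u _; rewrite mulrA.
rewrite (fubini_cons bfi); apply: eq_Rintegral => a _.
rewrite /psi -RintegralZr//; last exact/bbV_integrable/bbV_M/bw/bbV_slice.
apply: eq_Rintegral => v _; rewrite lift_first_cons lift_last_cons/=; ring.
Qed.

End step.

(** Compactness in quantitative form: up to a small multiple of the Dirichlet energy, the norm sees
    finitely many linear functionals. By induction on the dimension, the slices satisfy such an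
    estimate with moments that depend on the first coordinate, and these moments are then averaged
    over cells. *)
Lemma rellich n (eps : R) : 0 < eps ->
  exists (C : R) (I : finType) (w : I -> 'rV[R]_n -> R),
    [/\ 0 <= C, forall k, bbV (w k) & forall f, C1box f ->
      \int[leb n]_x (f x ^+ 2) <= eps * \sum_(i < n) \int[leb n]_x (partial i f x ^+ 2) +
        C * \sum_k (\int[leb n]_x (f x * w k x)) ^+ 2].
Proof.
move=> eps0; elim: n => [|n [C [I [w [C0 bw IH]]]]].
  (* In dimension 0 a function is a single number, which one functional recovers. *)
  exists 1, unit, (fun _ _ => 1); split=> // [_|f Cf].
    split=> //; exists 1; split=> [x|x _ []//]; by rewrite normr1.
  rewrite big_ord0 mulr0 add0r mul1r big_const card_unit /= addr0 /Rintegral /=.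
  have -> : f = cst (f 0) by apply/funext => x /=; rewrite (thinmx0 x).
  by rewrite !integral_dirac//= indicE mem_set// !mul1r mulr1.
pose S := \sum_k \int[leb n]_v (w k v ^+ 2).
have S0 : 0 <= S by apply: sumr_ge0 => k _; apply: Rintegral_ge0 => v _; rewrite sqr_ge0.
(* The 16 is the square of the 4 in the cell length [4 / N.+1]; this [N] lets [eps] times the first
   derivative absorb the averaging error. *)
pose N := Num.truncn (16 * C * S / eps).
have NP : (4 / N.+1%:R) ^+ 2 * (C * S) <= eps.
  have CS0 : 0 <= 16 * C * S by rewrite !mulr_ge0.
  have : 16 * C * S / eps < N.+1%:R by apply: truncnS_gt; rewrite divr_ge0// ltW.
  rewrite ltr_pdivrMr// => H.
  rewrite expr_div_n mulrAC ler_pdivrMr ?exprn_gt0//.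
  have N1 : 1 <= N.+1%:R :> R by rewrite ler1n.
  apply: (@le_trans _ _ (N.+1%:R * eps)); first by apply: le_trans (ltW H); nra.
  rewrite [X in X <= _]mulrC; apply: ler_wpM2l; first exact: ltW.
  by rewrite expr2 ler_peMr.
pose eta : R := 4 / N.+1%:R.
exists (C / eta), (I * 'I_N.+1)%type, (fun (kj : I * 'I_N.+1) u =>
  lift_first (\1_(cell_itv N kj.2)) u * lift_last (w kj.1) u).
split=> [|[k j]|f Cf].
- by rewrite divr_ge0// divr_ge0.
- exact: (bbV_lift (bbR_indicI _ _) (bw k)).
have bf := C1box_bbV Cf; have bp := fun i => C1box_partial i Cf.
rewrite (fubini_cons (bbV_X bf)).
pose psi k (a : measurableTypeR R) := \int[leb n]_v (f (rV_cons (a, v)) * w k v).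
have bpsi k : bbR (psi k).
  have := bbR_Rint (bbV_lift_last bf (bw k)); congr bbR; apply/funext => a.
  by apply: eq_Rintegral => v _; rewrite lift_last_cons.
pose Q j (a : measurableTypeR R) :=
  \int[leb n]_v (partial (rshift 1 j : 'I_n.+1) f (rV_cons (a, v)) ^+ 2).
have bQ j : bbR (Q j) by apply: (bbR_Rint (bbV_X (bp _))).
have bsum1 : bbR (fun a => \sum_j Q j a).
  by apply: (bounded_in_sum sub_seg) => j _; exact: bQ.
have bsum2 : bbR (fun a => \sum_k psi k a ^+ 2).
  by apply: (bounded_in_sum sub_seg) => k _; exact: bbR_X.
apply: (@le_trans _ _ (\int[mu1]_a (eps * (\sum_j Q j a) + C * \sum_k psi k a ^+ 2))).
  apply: le_Rintegral => //.
  - exact/bbR_integrable/(bbR_Rint (bbV_X bf)).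
  - exact/bbR_integrable/bbR_D/bbR_Z/bsum2/bbR_Z.
  move=> a _; have := IH _ (C1box_slice a Cf).
  by under eq_bigr do under eq_Rintegral do rewrite partial_cons.
rewrite RintegralD//; [|exact/bbR_integrable/bbR_Z..].
rewrite !RintegralZl//; [|exact/bbR_integrable..].
rewrite (Rint_sum measurable_seg seg_fin sub_seg)//; last by move=> j _; exact: bQ.
rewrite (Rint_sum measurable_seg seg_fin sub_seg)//; last by move=> k _; exact: bbR_X.
have Esum (F : 'I_n.+1 -> R) : \sum_(i < n.+1) F i =
    F (lshift n (ord0 : 'I_1) : 'I_n.+1) + \sum_(j < n) F (rshift 1 j : 'I_n.+1).
  by rewrite -[LHS]/(\sum_(i < 1 + n) F i) big_split_ord big_ord1.
rewrite Esum.
have -> : \sum_j \int[mu1]_a Q j a =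
    \sum_(j < n) \int[leb n.+1]_u (partial (rshift 1 j : 'I_n.+1) f u ^+ 2).
  by apply: eq_bigr => j _; rewrite (fubini_cons (bbV_X (bp _))).
set A := \sum_(j < n) _; set B := Rintegral _ _ _.
have B0 : 0 <= B by apply: Rintegral_ge0 => u _; rewrite sqr_ge0.
rewrite mulrDr [eps * B + _]addrC -addrA lerD2l.
apply: (@le_trans _ _ (C * \sum_k (eta^-1 * \sum_(j < N.+1)
     (\int[leb n.+1]_u (f u * (lift_first (\1_(cell_itv N j)) u * lift_last (w k) u))) ^+ 2 +
  eta ^+ 2 * (\int[leb n]_v (w k v ^+ 2)) * B))).
  by rewrite ler_wpM2l//; apply: ler_sum => k _; exact: psi_bound.
rewrite big_split/= mulrDr addrC; apply: lerD.
  by rewrite -mulr_sumr mulrA pair_big/=.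
rewrite -mulr_suml -mulr_sumr -/S mulrA.
by apply: ler_wpM2r => //; apply: le_trans NP; rewrite -/eta; apply: le_of_eq; ring.
Qed.

End rellich.

(** * Test functions on the unit ball *)

Section test_functions.
Context {R : realType} {d : nat}.
Local Notation rV := ('rV[R]_d).
Local Notation leb := (@lebesgue_rV R d).
Local Notation Omega := (@unit_ball R d).
Local Notation e i := (delta_mx ord0 i : 'rV[R]_d).
Implicit Types (f g : rV -> R) (i j : 'I_d) (x : rV).

Lemma unit_ball_box x : Omega x -> box 1 x.
Proof.
move=> x1 i; rewrite -(@ler_pXn2r _ 2)// ?nnegrE// real_normK ?num_real// expr1n.
apply: le_trans (ltW x1); rewrite (bigD1 i)//= lerDl.
by apply: sumr_ge0 => j _; exact: sqr_ge0.
Qed.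

Lemma unit_ball_coord x i : Omega x -> x ord0 i ^+ 2 < 1.
Proof.
move=> x1; apply: le_lt_trans x1; rewrite (bigD1 i)//= lerDl.
by apply: sumr_ge0 => j _; exact: sqr_ge0.
Qed.

Lemma measurable_unit_ball : measurable Omega.
Proof.
have m : measurable_fun setT (fun x : rV => \sum_(i < d) x ord0 i ^+ 2).
  by apply: measurable_sum => i; apply: measurable_funX; exact: measurable_rV_coord.
rewrite (_ : Omega = setT `&` (fun x : rV => \sum_(i < d) x ord0 i ^+ 2) @^-1` `]-oo, 1[%classic).
  by apply: m => //; exact: measurable_itv.
by rewrite setTI; apply/seteqP; split=> x; rewrite /unit_ball /= in_itv.
Qed.

(** The compact support is closed in the whole space, so [f] vanishes near boundary points as well.
    This makes division by weights that degenerate there harmless. *)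
Lemma test_near0 f x : test_function Omega f -> ~ Omega x -> \near x, f x = 0.
Proof.
move=> [sf [K [cK KO fK]]] xO.
have oK : open (~` K).
  by apply: closed_openC; apply: compact_closed cK; exact: norm_hausdorff.
have : nbhs x (~` K) by apply: open_nbhs_nbhs; split=> //= /KO.
by apply: filterS => y /fK.
Qed.

Lemma test_out f x : test_function Omega f -> ~ Omega x -> f x = 0.
Proof. by move=> tf xO; apply: (nbhs_singleton (test_near0 tf xO)). Qed.

Lemma test_smooth f : test_function Omega f -> smooth f. Proof. by case. Qed.

Lemma testM f g : test_function Omega f -> smooth g ->
  test_function Omega (fun x => f x * g x).
Proof.
move=> [sf [K [cK KO fK]]] sg; split; first exact: smoothM.
by exists K; split=> // x /fK ->; rewrite mul0r.
Qed.

Lemma testD f g : test_function Omega f -> test_function Omega g ->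
  test_function Omega (fun x => f x + g x).
Proof.
move=> [sf [K [cK KO fK]]] [sg [L [cL LO gL]]]; split; first exact: smoothD.
exists (K `|` L); split; first exact: compactU.
  by move=> x [/KO|/LO].
by move=> x /not_orP[/fK -> /gL ->]; rewrite addr0.
Qed.

Lemma test_partial f i : test_function Omega f -> test_function Omega (partial i f).
Proof.
move=> [sf [K [cK KO fK]]]; split; first exact: smooth_partial.
exists K; split=> // x xK; rewrite -(@partial_cst R d 0 i x); apply: partial_near.
have oK : open (~` K).
  by apply: closed_openC; apply: compact_closed cK; exact: norm_hausdorff.
by apply: filterS (open_nbhs_nbhs (conj oK xK)) => y /fK.
Qed.

Lemma test0 : test_function Omega (fun=> 0).
Proof.
split; first exact: smooth_cst.
by exists set0; split=> //; exact: compact0.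
Qed.

Definition test_pred : {pred (rV -> R)} := fun f => `[< test_function Omega f >].

Lemma test_predP f : (f \in test_pred) = `[< test_function Omega f >]. Proof. by []. Qed.

Fact test_submod_closed : submod_closed test_pred.
Proof.
split; first by rewrite test_predP; apply/asboolP; exact: test0.
move=> a f g /asboolP tf /asboolP tg; rewrite test_predP; apply/asboolP.
apply: (@testD (fun x => a * f x) g) => //.
by under eq_fun do rewrite mulrC; apply: testM => //; exact: smooth_cst.
Qed.

HB.instance Definition _ := GRing.isSubmodClosed.Build R (rV -> R) test_pred
  test_submod_closed.

(** Test functions form a module, to which the operator inequalities stated for an abstract
    semi-inner product apply. *)
Record testf := TestF { testf_fun :> rV -> R; testf_in : testf_fun \in test_pred }.
HB.instance Definition _ := [isSub for testf_fun].
HB.instance Definition _ := [Choice of testf by <:].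
HB.instance Definition _ := [SubChoice_isSubLmodule of testf by <:].

Implicit Types u v : testf.

Lemma testfP u : test_function Omega u. Proof. by case: u => f fi; apply/asboolP; exact: fi. Qed.
Definition mk_testf f (tf : test_function Omega f) : testf := TestF (asboolT tf).

Lemma testf_eq u v : (forall x, u x = v x) -> u = v.
Proof. by move=> uv; apply: val_inj; exact/funext. Qed.

Lemma testfD u v x : (u + v) x = u x + v x. Proof. by []. Qed.
Lemma testfZ a u x : (a *: u) x = a * u x. Proof. by []. Qed.
Lemma testfB u v x : (u - v) x = u x - v x. Proof. by []. Qed.
Lemma testf_sum I (r : seq I) (F : I -> testf) x :
  (\sum_(i <- r) F i) x = \sum_(i <- r) F i x.
Proof. by elim: r => [|i r IH]; rewrite ?big_nil// !big_cons testfD IH. Qed.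

Lemma testf_smooth u : smooth u. Proof. exact/test_smooth/testfP. Qed.
Lemma testf_derivable u i x : derivable u x (e i).
Proof. exact/smooth_derivable/testf_smooth. Qed.

Definition tpartial i u : testf := mk_testf (test_partial i (testfP u)).
Definition tmul g (sg : smooth g) u : testf := mk_testf (testM (testfP u) sg).

Lemma tmulE g (sg : smooth g) u x : tmul sg u x = u x * g x. Proof. by []. Qed.

Fact tpartial_linear i : linear (tpartial i).
Proof.
move=> a u v; apply: testf_eq => x.
transitivity (partial i (fun y => a * u y + v y) x) => //.
rewrite (@partialD _ _ (fun y => a * u y)); last exact: testf_derivable.
  rewrite (@partialM _ _ (fun=> a) u); last exact: testf_derivable.
    by rewrite partial_cst mul0r add0r.
  exact: derivable_cst.
by apply: (@derivableM _ _ (fun=> a) u); [exact: derivable_cst|exact: testf_derivable].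
Qed.
HB.instance Definition _ i := GRing.isLinear.Build R testf testf *:%R (tpartial i)
  (tpartial_linear i).

Fact tmul_linear g (sg : smooth g) : linear (tmul sg).
Proof.
by move=> a u v; apply: testf_eq => x; rewrite testfD testfZ !tmulE testfD testfZ mulrDl mulrA.
Qed.
HB.instance Definition _ g (sg : smooth g) :=
  GRing.isLinear.Build R testf testf *:%R (tmul sg) (tmul_linear sg).

Lemma tpartialC i j u : tpartial i (tpartial j u) = tpartial j (tpartial i u).
Proof.
by apply: testf_eq => x; rewrite /= (smooth_partialC i j (testf_smooth u)).
Qed.

Lemma tpartials_foldr s u : foldr tpartial u s = partials s u :> (rV -> R).
Proof. by elim: s => //= i s; rewrite /partials => <-. Qed.

Lemma testf_C1box u : C1box u.
Proof.
have su := testf_smooth u; split.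
- exact: smooth_continuous.
- by move=> i; exact: smooth_C1dir.
- move=> x ux; apply: unit_ball_box; apply: contrapT => /(test_out (testfP u)) u0.
  by rewrite u0 eqxx in ux.
Qed.

Lemma testf_bbV u : bbV u. Proof. exact/C1box_bbV/testf_C1box. Qed.

Lemma L2_restrict f : L2 leb setT f -> L2 leb Omega f.
Proof.
move=> [mf fi]; split; first exact: measurable_funS mf.
apply: le_lt_trans fi; apply: ge0_subset_integral => //; first exact: measurable_unit_ball.
  exact/measurable_EFinP/measurable_funX.
by move=> x _; rewrite lee_fin sqr_ge0.
Qed.

Lemma testf_L2 u : L2 leb Omega u.
Proof. exact/L2_restrict/bbV_L2/testf_bbV. Qed.

Definition tip u v : R := L2ip leb Omega u v.

Lemma tip_sip : sip tip.
Proof.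
split=> [u v w|a u v|u v|u]; rewrite /tip.
- exact: (L2ipDl measurable_unit_ball (testf_L2 u) (testf_L2 v) (testf_L2 w)).
- exact: (L2ipZl measurable_unit_ball a (testf_L2 u) (testf_L2 v)).
- exact: L2ipC.
- exact: L2ip_ge0.
Qed.

Lemma Rint_unit_ball f : (forall x, ~ Omega x -> f x = 0) ->
  \int[leb]_(x in Omega) f x = \int[leb]_x f x.
Proof.
move=> f0; rewrite Rintegral_mkcond; apply: eq_Rintegral => x _.
by rewrite patchE; case: ifPn => //; rewrite notin_setE => /f0.
Qed.

Lemma tipE u v : tip u v = \int[leb]_x (u x * v x).
Proof.
by rewrite /tip /L2ip Rint_unit_ball// => x /(test_out (testfP u)) ->; rewrite mul0r.
Qed.

Lemma tip_skew i u v : tip (tpartial i u) v = - tip u (tpartial i v).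
Proof.
apply/eqP; rewrite -addr_eq0; apply/eqP; rewrite !tipE -RintegralD//; last 2 first.
- by apply/bbV_integrable/bbV_M; exact: testf_bbV.
- by apply/bbV_integrable/bbV_M; exact: testf_bbV.
pose uv := tmul (testf_smooth v) u.
have [_ /(_ i) C1 s1] := testf_C1box uv.
rewrite -(Rint_partial s1 C1); apply: eq_Rintegral => x _.
by apply/esym/partialM; exact: testf_derivable.
Qed.

Definition tcoord i : testf -> testf := tmul (@smooth_coord R d i).

Lemma tcoord_sym i u v : tip (tcoord i u) v = tip u (tcoord i v).
Proof. by apply: eq_Rintegral => x _; rewrite !tmulE -mulrA [v x * _]mulrC. Qed.

Lemma tpartial_coord i u : tpartial i (tcoord i u) = tcoord i (tpartial i u) + u.
Proof.
apply: testf_eq => x; rewrite testfD tmulE.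
transitivity (partial i (fun y => u y * y ord0 i) x) => //.
rewrite (@partialM _ _ u); [|exact: testf_derivable|exact: derivable_coord].
by rewrite partial_coord eqxx mulr1.
Qed.

(** * Division by 1 - x_i^2 on test functions *)

Section weight.
Variable i : 'I_d.

Let w x : R := 1 - x ord0 i ^+ 2.

Lemma w_gt0 x : Omega x -> 0 < w x.
Proof. by move=> xO; rewrite subr_gt0 unit_ball_coord. Qed.

Let smooth_w : smooth w.
Proof.
have := smoothD (@smooth_cst R d 1)
  (smoothM (@smooth_cst R d (-1)) (smoothM (@smooth_coord R d i) (@smooth_coord R d i))).
by congr smooth; apply/funext => x; rewrite /w expr2 mulN1r.
Qed.

Let partial_w j x : partial j w x = - 2 * x ord0 i * (j == i)%:R.
Proof.
have E : w = (fun x => 1 + (- 1 * x ord0 i) * x ord0 i).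
  by apply/funext => y; rewrite /w expr2 mulN1r mulNr.
have dc y := @derivable_coord R d j i y.
have dN y : derivable (fun x : rV => -1 * x ord0 i) y (e j).
  by apply: (@derivableM _ _ (fun=> -1)); [exact: derivable_cst|].
have d1 (c : R) : derivable (fun _ : rV => c) x (e j) by exact: derivable_cst.
rewrite E (@partialD _ _ (fun=> 1) _ _ _ (d1 1) (derivableM (dN x) (dc x))).
rewrite partial_cst (@partialM _ _ (fun x : rV => -1 * x ord0 i) _ _ _ (dN x) (dc x)).
by rewrite (@partialM _ _ (fun=> -1) _ _ _ (d1 (-1)) (dc x)) partial_cst partial_coord; ring.
Qed.

(** [w] may vanish, but only outside the ball; a test function vanishes around such points, so the
    conventional value of the inverse does not matter. *)
Definition wpow k f x := f x * ((w x)^-1) ^+ k.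

Lemma wpow_near0 k f x : test_function Omega f -> w x = 0 -> \near x, wpow k f x = 0.
Proof.
move=> tf w0; have xO : ~ Omega x by move=> /w_gt0; rewrite w0 ltxx.
by apply: filterS (test_near0 tf xO) => y; rewrite /wpow => ->; rewrite mul0r.
Qed.

Lemma is_derive_wpow k f j x : test_function Omega f ->
  is_derive x (e j) (wpow k f)
    (wpow k (partial j f) x + k%:R * (2 * x ord0 i * (j == i)%:R) * wpow k.+1 f x).
Proof.
move=> tf; have [w0|w0] := eqVneq (w x) 0.
  have xO : ~ Omega x by move=> /w_gt0; rewrite w0 ltxx.
  rewrite {2 3}/wpow (test_out tf xO) (test_out (test_partial j tf) xO) !mul0r mulr0 addr0.
  apply: (@near_eq_is_derive _ _ _ (fun=> 0)).
  by apply: filterS (wpow_near0 k tf w0) => y ->.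
have dw : derivable w x (e j) by exact: smooth_derivable.
have df : derivable f x (e j) by exact/smooth_derivable/test_smooth.
have dV : derivable (fun y => (w y)^-1) x (e j) by exact: derivableV.
have dVk : derivable ((fun y => (w y)^-1) ^+ k) x (e j) by exact: derivableX.
have Ew : wpow k f = f * (fun y => (w y)^-1) ^+ k.
  by apply/funext => y; rewrite /wpow !fctE.
apply: DeriveDef.
  by rewrite Ew; exact: (derivableM df dVk).
have -> : 'D_(e j) (wpow k f) x = partial j f x * ((fun y => (w y)^-1) ^+ k) x +
    f x * partial j ((fun y => (w y)^-1) ^+ k) x.
  by rewrite Ew; exact: partialM.
rewrite /partial (deriveX k dV) (deriveV w0 dw) -/(partial j w x) partial_w.
rewrite /wpow fctE; congr (_ + _).
rewrite /GRing.scale/=; case: k {dVk Ew} => [|k]; first by rewrite !mul0r mulr0.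
by rewrite /= !exprS; set z := _ ^+ k; field.
Qed.

Lemma continuous_wpow k f : test_function Omega f -> continuous (wpow k f).
Proof.
move=> tf x; have [w0|w0] := eqVneq (w x) 0.
  rewrite /continuous_at (nbhs_singleton (wpow_near0 k tf w0)).
  by apply: (@cvg_near_cst _ _ _ _ _ (nbhs_filter x)); exact: (wpow_near0 k tf w0).
apply: (@continuousM _ _ f (fun x => (w x)^-1 ^+ k)).
  exact/smooth_continuous/test_smooth.
apply: (@continuous_comp _ _ _ (fun x => (w x)^-1) (fun y : R => y ^+ k)).
  by apply: continuousV => //; exact: smooth_continuous.
exact: exprn_continuous.
Qed.

Lemma smooth_wpow k f : test_function Omega f -> smooth (wpow k f).
Proof.
(* Differentiation produces [wpow k.+1] with a polynomial factor, so the generators comprise all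
   [wpow] and all smooth functions. *)
move=> tf; pose G := [set g | smooth g \/ exists k f, test_function Omega f /\ g = wpow k f].
apply: (@smooth_alg_closure _ _ G); last by apply: alg_gen; right; exists k, f.
move=> g [sg|[{tf}k [{}f [tf ->]]]].
  split; first exact: smooth_continuous.
  move=> j; split; first by move=> x; exact: smooth_derivable.
  by apply: alg_gen; left; exact: smooth_partial.
split; first exact: continuous_wpow.
move=> j; split; first by move=> x; case: (is_derive_wpow k j x tf).
have -> : partial j (wpow k f) = (fun x => wpow k (partial j f) x +
    k%:R * (2 * x ord0 i * (j == i)%:R) * wpow k.+1 f x).
  by apply/funext => x; case: (is_derive_wpow k j x tf).
apply: alg_add; first by apply: alg_gen; right; exists k, (partial j f); split=> //; exact: test_partial.
apply: (@alg_mul _ _ _ (fun x => k%:R * (2 * x ord0 i * (j == i)%:R))).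
  apply: (@alg_mul _ _ _ (fun=> k%:R)); first exact: alg_cst.
  apply: (@alg_mul _ _ _ (fun x => 2 * x ord0 i)); last exact: alg_cst.
  apply: (@alg_mul _ _ _ (fun=> 2)); first exact: alg_cst.
  by apply: alg_gen; left; exact: smooth_coord.
by apply: alg_gen; right; exists k.+1, f.
Qed.

Lemma test_wpow k f : test_function Omega f -> test_function Omega (wpow k f).
Proof.
move=> tf; split; first exact: smooth_wpow.
have [sf [K [cK KO fK]]] := tf.
by exists K; split=> // x /fK; rewrite /wpow => ->; rewrite mul0r.
Qed.

Definition tweight u : testf := mk_testf (test_wpow 1 (testfP u)).

Lemma tweightE u x : tweight u x = u x / w x.
Proof. by rewrite /= /wpow expr1. Qed.

Fact tweight_linear : linear tweight.
Proof.
by move=> a u v; apply: testf_eq => x; rewrite testfD testfZ !tweightE testfD testfZ mulrDl mulrA.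
Qed.
HB.instance Definition _ := GRing.isLinear.Build R testf testf *:%R tweight tweight_linear.

(** The ball lies in the slab where [x_i^2 < 1], on which the weight is positive. The abstract
    inequality applies with derivative, multiplication and division in the coordinate [i], the
    others being parameters. *)
Lemma fact_tip_iter m u :
  (2 * m)`!%:R * tip u u <= tip (iter m (tpartial i) u) (iter m (tpartial i) u).
Proof.
apply: (@fact_ip_iter_D R testf tip (tpartial i) (tmul (@smooth_coord R d i)) tweight).
- exact: tip_sip.
- exact: tip_skew.
- exact: tcoord_sym.
- by move=> {}u v; apply: eq_Rintegral => x _; rewrite !tweightE -mulrA [v x * _]mulrC.
- move=> {}u; apply: Rintegral_ge0 => x xO; rewrite tweightE mulrA -expr2.
  by rewrite mulr_ge0 ?sqr_ge0// invr_ge0 ltW// w_gt0.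
- exact: tpartial_coord.
- move=> {}u; apply: testf_eq => x; rewrite testfD testfZ.
  transitivity (partial i (wpow 1 u) x) => //.
  have [_ E] := is_derive_wpow 1 i x (testfP u); apply: (etrans E).
  rewrite /= /wpow /= !expr1 expr2 eqxx (_ : true%:R = 1)//; ring.
- by move=> {}u; apply: testf_eq => x; rewrite tmulE !tweightE tmulE mulrAC.
- move=> {}u; apply: testf_eq => x; rewrite testfB !tweightE !tmulE.
  have [w0|w0] := eqVneq (w x) 0; last by rewrite /w in w0 *; field.
  rewrite (test_out (testfP u)) ?mul0r ?subr0// => /w_gt0.
  by rewrite w0 ltxx.
Qed.

End weight.

End test_functions.

(** * Minimizers of the Rayleigh quotient *)

(** Limits along an ultrafilter replace the extraction of subsequences: the same ultrafilter serves
    all functionals and all precisions. *)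
Lemma ultra_bounded_cvg (R : realType) (F : set_system nat) (u : nat -> R) (M : R) :
  UltraFilter F -> (forall n, `|u n| <= M) -> exists L : R, u @ F --> L.
Proof.
move=> UF uM.
have cM := @segment_compact R (- M) M.
have uF : (u @ F) `[- M, M]%classic.
  suff : F (u @^-1` `[- M, M]%classic) by []. suff -> : u @^-1` `[- M, M]%classic = setT by exact: filterT.
  by apply/seteqP; split=> n _ //=; rewrite in_itv/= -ler_norml uM.
have [L [_ clL]] := cM (u @ F) _ uF.
exists L => B LB; have [//|FC] := in_ultra_setVsetC (u @^-1` B) UF.
have FuC : (u @ F) (u @` (~` (u @^-1` B))).
  suff : F (u @^-1` (u @` (~` (u @^-1` B)))) by [].
  by apply: (filterS _ FC) => n nC; exists n.
by have [y [[n nC <-] By]] := clL _ _ FuC LB; case: nC.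
Qed.

Lemma cvg_rsum (R : realType) I (r : seq I) (u : I -> nat -> R) (a : I -> R) :
  (forall i, u i @ \oo --> a i) ->
  \sum_(i <- r) u i n @[n --> \oo] --> \sum_(i <- r) a i.
Proof.
move=> ua; elim: r => [|i r IH].
  by under eq_fun do rewrite big_nil; rewrite big_nil; exact: cvg_cst.
by under eq_fun do rewrite big_cons; rewrite big_cons; apply: cvgD.
Qed.

Section ball_forms.
Context {R : realType} {d : nat}.
Local Notation rV := ('rV[R]_d).
Local Notation leb := (@lebesgue_rV R d).
Local Notation Omega := (@unit_ball R d).
Local Notation testf := (@testf R d).
Implicit Types (u v : testf) (U V : @jet R d).

Definition tform p u v : R := polyform tip tpartial p u v.

Lemma tform_sip p : sip (tform p). Proof. exact: polyform_sip tip_sip tip_skew p. Qed.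

Lemma tform_grad p u : \sum_i tform p (tpartial i u) (tpartial i u) = tform p.+1 u u.
Proof. exact: polyform_grad tip_sip tip_skew tpartialC p u. Qed.

(** The constant is the [(2 * 1)!] of the factorial inequality. *)
Lemma tpoincare i u : 2 * tip u u <= tip (tpartial i u) (tpartial i u).
Proof. exact: (fact_tip_iter i 1 u). Qed.

(** The Poincare constant 2 exceeds 1, so the forms increase with the order; lower derivatives are
    thereby controlled without extra constants. *)
Lemma tform_le (i : 'I_d) p q u : (p <= q)%N -> tform p u u <= tform q u u.
Proof.
move=> /subnK <-; rewrite addnC.
have := polyform_poincare_iter tip_sip tip_skew tpartialC (ler0n R 2) (tpoincare i) p (q - p) u.
apply: le_trans; rewrite -[X in X <= _]mul1r ler_wpM2r ?(ip_ge0 (tform_sip p))//.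
by rewrite exprn_ege1// ler1n.
Qed.

Lemma tform_partials s u :
  tip (foldr tpartial u s) (foldr tpartial u s) <= tform (size s) u u.
Proof. exact: polyform_foldr_D tip_sip tip_skew tpartialC s u. Qed.

Definition tjet u : jet := fun s => partials s u.

Local Notation lap := (laplacian (@tpartial R d)).

Lemma jet_laplacian_tjet u : jet_laplacian (tjet u) = tjet (lap u).
Proof.
apply/funext => s; apply/funext => x; rewrite /tjet -tpartials_foldr.
have E (r : seq 'I_d) : foldr tpartial (\sum_(i <- r) tpartial i (tpartial i u)) s =
    \sum_(i <- r) foldr tpartial (tpartial i (tpartial i u)) s.
  by elim: s => //= i s ->; rewrite linear_sum.
rewrite /laplacian E testf_sum; apply: eq_bigr => i _.
by rewrite tpartials_foldr /partials foldr_cat.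
Qed.

Lemma iter_jet_laplacian k u : iter k jet_laplacian (tjet u) = tjet (iter k lap u).
Proof. by elim: k => //= k ->; rewrite jet_laplacian_tjet. Qed.

Lemma grad_form_tjet p u v : grad_form Omega p (tjet u) (tjet v) = tform p u v.
Proof.
by rewrite /grad_form /tform /polyform !iter_jet_laplacian; case: (odd p).
Qed.

Definition jet_cvg m (phi : nat -> testf) U := forall s, (size s <= m)%N ->
  L2 leb Omega (U s) /\ L2cvg leb Omega (fun n => partials s (phi n)) (U s).

Lemma partials_L2 s u : L2 leb Omega (partials s u).
Proof. by rewrite -tpartials_foldr; exact: testf_L2. Qed.

(** Each Laplacian consumes two of the [m] available derivatives, whence the bound on the orders. *)
Lemma iter_jet_laplacian_cvg m phi U k s : jet_cvg m phi U -> (size s + k.*2 <= m)%N ->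
  L2 leb Omega (iter k jet_laplacian U s) /\
  L2cvg leb Omega (fun n => iter k jet_laplacian (tjet (phi n)) s)
    (iter k jet_laplacian U s).
Proof.
move=> H; elim: k s => [|k IH] s sm; first by apply: H; rewrite addn0 in sm.
have E (Z : jet) : iter k.+1 jet_laplacian Z s =
    (fun x => \sum_(i < d) iter k jet_laplacian Z (s ++ [:: i; i]) x) by [].
have sm' i : (size (s ++ [:: i; i]) + k.*2 <= m)%N.
  by move: sm; rewrite size_cat /= doubleS !addnS addn0.
split; first by rewrite E; apply: L2_sum => [|i]; [exact: measurable_unit_ball|exact: (IH _ (sm' i)).1].
rewrite E; under eq_fun do rewrite E.
apply: L2cvg_sum => [|i n|i|i]; first exact: measurable_unit_ball.
- by rewrite iter_jet_laplacian; exact: partials_L2.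
- exact: (IH _ (sm' i)).1.
- exact: (IH _ (sm' i)).2.
Qed.

Lemma grad_form_cvg m p phi psi U V : (p <= m)%N -> jet_cvg m phi U -> jet_cvg m psi V ->
  tform p (phi n) (psi n) @[n --> \oo] --> grad_form Omega p U V.
Proof.
move=> pm cU cV; under eq_fun do rewrite -grad_form_tjet.
have pE := odd_double_half p; have mO := @measurable_unit_ball R d.
have L2t k s (chi : nat -> testf) n : L2 leb Omega (iter k jet_laplacian (tjet (chi n)) s).
  by rewrite iter_jet_laplacian; exact: partials_L2.
rewrite /grad_form; case: (odd p) pE => pE.
  apply: cvg_rsum => i.
  have sm : (size [:: i] + p./2.*2 <= m)%N by rewrite /= pE.
  have [LU cU'] := iter_jet_laplacian_cvg cU sm.
  have [LV cV'] := iter_jet_laplacian_cvg cV sm.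
  exact: (L2ip_cvg mO (L2t _ _ _) (L2t _ _ _) LU LV cU' cV').
have sm : (size (@nil 'I_d) + p./2.*2 <= m)%N by rewrite /= pE.
have [LU cU'] := iter_jet_laplacian_cvg cU sm.
have [LV cV'] := iter_jet_laplacian_cvg cV sm.
exact: (L2ip_cvg mO (L2t _ _ _) (L2t _ _ _) LU LV cU' cV').
Qed.

(** At order 0 this is [rellich]; each further order composes the functionals with a partial
    derivative. Their additivity and boundedness are recorded because they are to be followed along
    a bounded sequence and evaluated at its differences. *)
Lemma tform_compact p (eps : R) : 0 < eps ->
  exists (C C' : R) (I : finType) (l : I -> testf -> R), [/\ 0 <= C, 0 <= C',
    forall k u v, l k (u - v) = l k u - l k v,
    forall k u, l k u ^+ 2 <= C' * tform p u u &
    forall u, tform p u u <= eps * tform p.+1 u u + C * \sum_k l k u ^+ 2].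
Proof.
move=> eps0; elim: p => [|p [C [C' [I [l [C0 C'0 lB lC lP]]]]]].
  have [C [I [w [C0 bw wP]]]] := rellich d eps0.
  pose l k u := L2ip leb setT u (w k).
  have Lu u : L2 leb setT u by exact/bbV_L2/testf_bbV.
  have Lw k : L2 leb setT (w k) by exact/bbV_L2/bw.
  have tipT u : tip u u = L2ip leb setT u u by rewrite tipE.
  exists C, (\sum_k L2ip leb setT (w k) (w k)), I, l; split=> //.
  - by apply: sumr_ge0 => k _; exact: L2ip_ge0.
  - move=> k u v; exact: (L2ipBl measurableT (Lu u) (Lu v) (Lw k)).
  - move=> k u; apply: le_trans (L2_CauchySchwarz measurableT (Lu u) (Lw k)) _.
    rewrite /tform polyform0 tipT mulrC ler_wpM2r ?L2ip_ge0// (bigD1 k)//= lerDl.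
    by apply: sumr_ge0 => j _; exact: L2ip_ge0.
  - move=> u; have := wP _ (testf_C1box u); rewrite -tform_grad /tform polyform0 tipE.
    under eq_Rintegral do rewrite expr2.
    move=> /le_trans; apply; apply: lerD => //.
    apply: ler_wpM2l; first exact: ltW.
    by apply: ler_sum => i _; rewrite polyform0 tipE; under eq_Rintegral do rewrite expr2.
exists C, C', ('I_d * I)%type, (fun ik u => l ik.2 (tpartial ik.1 u)); split=> //.
- by move=> [i k] u v /=; rewrite linearB lB.
- move=> [i k] u /=; apply: le_trans (lC _ _) _.
  rewrite ler_wpM2l// -tform_grad (bigD1 i)//= lerDl.
  by apply: sumr_ge0 => j _; exact: (ip_ge0 (tform_sip p)).
- move=> u; have E : \sum_(k : 'I_d * I) l k.2 (tpartial k.1 u) ^+ 2 =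
      \sum_i \sum_k l k (tpartial i u) ^+ 2 by rewrite pair_bigA.
  rewrite -!tform_grad; apply: (@le_trans _ _ (\sum_i (eps * tform p.+1 (tpartial i u) (tpartial i u)
     + C * \sum_k l k (tpartial i u) ^+ 2))).
    by apply: ler_sum => i _; exact: lP.
  by rewrite big_split/= -!mulr_sumr -E.
Qed.

Section minimizer.
Variables (i0 : 'I_d) (m p : nat) (u0 : testf).
Hypothesis pm : (p < m)%N.
Hypothesis u0P : 0 < tip u0 u0.

Let a := tform m.
Let b := tform p.
Let aP : sip a := tform_sip m.
Let bP : sip b := tform_sip p.

Let tip_b u : tip u u <= b u u. Proof. exact: (tform_le i0 u (leq0n p)). Qed.
Let b_a u : b u u <= a u u. Proof. exact: (tform_le i0 u (ltnW pm)). Qed.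

Definition rayleigh_inf : R := inf [set a u u | u in [set u | b u u = 1]].
Local Notation lam := rayleigh_inf.

Let rayleigh_has_inf : has_inf [set a u u | u in [set u | b u u = 1]].
Proof.
split.
  have b0 : 0 < b u0 u0 by exact: lt_le_trans u0P (tip_b _).
  exists (a ((Num.sqrt (b u0 u0))^-1 *: u0) ((Num.sqrt (b u0 u0))^-1 *: u0)).
  exists ((Num.sqrt (b u0 u0))^-1 *: u0) => //=.
  rewrite (ipZl bP) (ipZr bP) mulrA -invfM -expr2 sqr_sqrtr ?ltW//.
  by rewrite mulVf// gt_eqF.
by exists 0 => _ [u _ <-]; exact: (ip_ge0 aP).
Qed.

Lemma rayleigh_inf_ge0 : 0 <= lam.
Proof.
apply: lb_le_inf; first exact: rayleigh_has_inf.1.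
by move=> _ [u _ <-]; exact: (ip_ge0 aP).
Qed.

Lemma rayleigh_inf_le u : lam * b u u <= a u u.
Proof.
have [b0|b0] := eqVneq (b u u) 0; first by rewrite b0 mulr0 (ip_ge0 aP).
have bp : 0 < b u u by rewrite lt_def b0 (ip_ge0 bP).
rewrite -ler_pdivlMr//; pose c := (Num.sqrt (b u u))^-1.
have c2 : c * c = (b u u)^-1 by rewrite -invfM -expr2 sqr_sqrtr// ltW.
apply: ge_inf; first by case: rayleigh_has_inf.
exists (c *: u) => /=.
  by rewrite (ipZl bP) (ipZr bP) mulrA c2 mulVf.
by rewrite (ipZl aP) (ipZr aP) mulrA c2 mulrC.
Qed.

Lemma rayleigh_inf_ge (c : R) : (forall u, c * b u u <= a u u) -> c <= lam.
Proof.
move=> H; apply: lb_le_inf; first exact: rayleigh_has_inf.1.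
by move=> _ [u /= b1 <-]; have := H u; rewrite b1 mulr1.
Qed.

(** Along the ultrafilter the finitely many functionals converge. On one of its sets they are
    therefore nearly constant, and the compactness estimate makes differences small in [b]. *)
Lemma ultra_cauchy (F : set_system nat) (u : nat -> testf) (A delta : R) :
  UltraFilter F -> (forall n, a (u n) (u n) <= A) -> 0 < delta ->
  exists2 S, F S & forall n k, S n -> S k -> b (u n - u k) (u n - u k) <= delta.
Proof.
move=> UF uA delta0.
have A0 : 0 <= A by apply: le_trans (uA 0%N); exact: (ip_ge0 aP).
(* Differences have energy at most [4 * A], so this factor spends at most [delta / 2] on the first
   term. *)
have eps0 : 0 < delta / (8 * (A + 1)) by rewrite divr_gt0// mulr_gt0// ltr_wpDl.
have [C [C' [I [l [C0 C'0 lB lC lP]]]]] := tform_compact p eps0.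
have lim k : exists L : R, (fun n => l k (u n)) @ F --> L.
  apply: (@ultra_bounded_cvg _ F (fun n => l k (u n)) (C' * A + 1) UF) => n /=.
  have : l k (u n) ^+ 2 <= C' * A.
    apply: le_trans (lC _ _) _; apply: ler_wpM2l => //.
    exact: le_trans (b_a _) (uA n).
  have := sqr_ge0 (`|l k (u n)| - 1); have := normr_ge0 (l k (u n)).
  rewrite -[l k (u n) ^+ 2]real_normK ?num_real//; set z := `|_|; nra.
have {lim}[L lim] := choice lim.
pose M : R := C * #|I|%:R + 1.
have M0 : 0 < M by rewrite ltr_wpDl// mulr_ge0.
(* Each functional of a difference is at most [2 * eta], so the second term is at most
   [C * #|I| * 4 * eta ^+ 2], hence at most [delta / 2]. *)
pose eta := Num.sqrt (delta / (8 * M)).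
have eta0 : 0 < eta by rewrite sqrtr_gt0 divr_gt0// mulr_gt0.
exists [set n | forall k, `|L k - l k (u n)| <= eta].
  apply: filter_forall => k.
  by have /cvgrPdist_le/(_ _ eta0) := lim k.
move=> n k nS kS; apply: le_trans (lP _) _.
have H1 : tform p.+1 (u n - u k) (u n - u k) <= 4 * A.
  apply: le_trans (tform_le i0 _ pm) _.
  apply: le_trans (ip_sqrD_le aP _ _) _.
  rewrite (ipNl aP) (ipNr aP) opprK.
  by have := uA n; have := uA k; lra.
have H2 : \sum_j l j (u n - u k) ^+ 2 <= #|I|%:R * (4 * eta ^+ 2).
  apply: (@le_trans _ _ (\sum_(j : I) 4 * eta ^+ 2)); last first.
    by rewrite sumr_const -(mulr_natl (4 * eta ^+ 2)).
  apply: ler_sum => j _; rewrite lB.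
  have := nS j; have := kS j; rewrite !ler_norml => /andP[x1 x2] /andP[y1 y2].
  set x := l j (u n) in y1 y2 *; set y := l j (u k) in x1 x2 *.
  have : `|x - y| <= 2 * eta by rewrite ler_norml; apply/andP; split; lra.
  move=> H; rewrite -real_normK ?num_real//.
  apply: (@le_trans _ _ ((2 * eta) ^+ 2)); last by rewrite exprMn; lra.
  by rewrite ler_pXn2r// nnegrE mulr_ge0// ltW.
have H3 : eta ^+ 2 = delta / (8 * M) by rewrite sqr_sqrtr// ltW// divr_gt0// mulr_gt0.
apply: (@le_trans _ _ (delta / 2 + delta / 2)); last by rewrite -splitr.
apply: lerD.
  apply: le_trans (ler_wpM2l (ltW eps0) H1) _.
  rewrite mulrAC ler_pdivrMr ?mulr_gt0// ?ltr_wpDl//; nra.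
apply: le_trans (ler_wpM2l C0 H2) _.
rewrite H3.
have -> : C * (#|I|%:R * (4 * (delta / (8 * M)))) = delta / 2 * (C * #|I|%:R / M).
  by field; rewrite gt_eqF.
rewrite ger_pMr ?divr_gt0// ler_pdivrMr// mul1r /M; lra.
Qed.

Lemma minimizing_seq : exists u : nat -> testf, [/\ forall n, b (u n) (u n) = 1,
  forall n, a (u n) (u n) <= lam + 1 / 4 ^+ n &
  forall n k, (n <= k)%N -> b (u k - u n) (u k - u n) <= 1 / 4 ^+ n].
Proof.
have min_ n : exists u, b u u = 1 /\ a u u <= lam + 1 / 4 ^+ n.
  have e0 : 0 < 1 / 4 ^+ n :> R by rewrite divr_gt0// exprn_gt0.
  have [_ [u /= bu <-] au] := inf_adherent e0 rayleigh_has_inf.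
  by exists u; split=> //; exact: ltW.
have [u uP] := choice min_.
have [F [UF Foo]] := ultraFilterLemma (@eventually_filter).
have uA n : a (u n) (u n) <= lam + 1.
  apply: le_trans (uP n).2 _; rewrite lerD2l ler_pdivrMr ?exprn_gt0// mul1r.
  by rewrite exprn_ege1// ler1n.
have cau n : exists S, F S /\
    forall j k, S j -> S k -> b (u j - u k) (u j - u k) <= 1 / 4 ^+ n.
  have e0 : 0 < 1 / 4 ^+ n :> R by rewrite divr_gt0// exprn_gt0.
  by have [S FS SP] := ultra_cauchy UF uA e0; exists S.
have {cau}[S SP] := choice cau.
(* A diagonal choice: the [n]-th index lies in the sets of all precisions up to [n], so the [n]-th
   term is close to every later one. *)
have pick n : exists k, (n <= k)%N /\ forall j, (j <= n)%N -> S j k.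
  have FI : F (\bigcap_(j in [set j | (j <= n)%N]) S j).
    have -> : [set j | (j <= n)%N] = [set j | (j < n.+1)%N] by [].
    rewrite bigcap_mkord; elim: n.+1 => [|k IH].
      by rewrite big_ord0; exact: filterT.
    by rewrite big_ord_recr /=; apply: filterI => //; exact: (SP k).1.
  have Fn : F [set k | (n <= k)%N] by apply: Foo; exists n.
  by have [k [kn kS]] := filter_ex (filterI Fn FI); exists k.
have {pick}[g gP] := choice pick.
exists (u \o g); split=> [n|n|n k nk] /=; first exact: (uP _).1.
  apply: le_trans (uP _).2 _; rewrite lerD2l !mul1r lef_pV2 ?posrE ?exprn_gt0//.
  by rewrite ler_weXn2l ?ler1n// (gP n).1.
by apply: (SP n).2; [exact: (gP k).2|exact: (gP n).2].
Qed.

(** In the parallelogram identity, the energy of [u k + u n] is at least [lam] times its value under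
    [b], which is 4 minus that of [u k - u n]. The terms [4 * lam] cancel and a geometric error
    remains. *)
Lemma minimizing_seq_cauchy (u : nat -> testf) :
  (forall n, b (u n) (u n) = 1) -> (forall n, a (u n) (u n) <= lam + 1 / 4 ^+ n) ->
  (forall n k, (n <= k)%N -> b (u k - u n) (u k - u n) <= 1 / 4 ^+ n) ->
  forall n k, (n <= k)%N -> a (u k - u n) (u k - u n) <= (4 + lam) / 4 ^+ n.
Proof.
move=> ub ua uc n k nk; rewrite (ip_parallelogram aP).
have := rayleigh_inf_le (u k + u n); have := ip_parallelogram bP (u k) (u n).
rewrite !ub => E; have := uc n k nk; rewrite {}E => H1 H2.
have H3 : a (u k) (u k) <= lam + 1 / 4 ^+ n.
  apply: le_trans (ua k) _; rewrite lerD2l !mul1r lef_pV2 ?posrE ?exprn_gt0//.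
  by rewrite ler_weXn2l ?ler1n.
have H4 := ua n; move: H1 H2 H3 H4; rewrite mulrDl !mul1r.
set z := (4 ^+ n)^-1; set B := b (u k + u n) _ => H1 H2 H3 H4.
have H5 : lam * (4 - z) <= lam * B by apply: ler_wpM2l; [exact: rayleigh_inf_ge0|lra].
lra.
Qed.

End minimizer.

End ball_forms.

Lemma cvg_mulr0 (R : realType) (c : R) (u : nat -> R) : u @ \oo --> 0 ->
  c * u n @[n --> \oo] --> 0.
Proof. by move=> u0; rewrite -[X in _ --> X](mulr0 c); apply: cvgM => //; exact: cvg_cst. Qed.

Lemma cvg_expr4 (R : realType) : (4 ^+ n)^-1 @[n --> \oo] --> (0 : R).
Proof.
under eq_fun do rewrite -exprVn; apply: cvg_expr.
by rewrite ger0_norm// invf_lt1// ltr1n.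
Qed.

(** * The infimum is the smallest weak eigenvalue *)

Section first_eigenvalue.
Context {R : realType} {d : nat}.
Local Notation rV := ('rV[R]_d).
Local Notation leb := (@lebesgue_rV R d).
Local Notation Omega := (@unit_ball R d).
Local Notation testf := (@testf R d).
Local Notation lap := (laplacian (@tpartial R d)).
Implicit Types (u v : testf) (U V : @jet R d).
Variables (i0 : 'I_d) (m p : nat) (u0 : testf).
Hypothesis pm : (p < m)%N.
Hypothesis u0P : 0 < tip u0 u0.

Let a := @tform R d m.
Let b := @tform R d p.
Let aP : sip a := tform_sip m.
Let bP : sip b := tform_sip p.
Local Notation lam := (@rayleigh_inf R d m p).
Local Notation mO := (@measurable_unit_ball R d).

Lemma sobolev0_jet_cvg V : sobolev0 Omega m V -> exists psi, jet_cvg m psi V.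
Proof.
move=> [SV [phi [tphi cphi]]].
exists (fun n => mk_testf (tphi n)) => s sm.
have LV : L2 leb Omega (V s) by case: (SV s sm).
split=> //; apply/(L2cvgP mO _ LV).
  by move=> n; exact: (partials_L2 s (mk_testf (tphi n))).
exact: cphi.
Qed.

Lemma test_jet_cvg u : jet_cvg m (fun=> u) (tjet u).
Proof.
move=> s sm; split; first exact: partials_L2.
rewrite /L2cvg /L2ip; under eq_fun do under eq_Rintegral do rewrite subrr mulr0.
rewrite (_ : (fun=> _) = fun=> 0); first exact: cvg_cst.
by apply/funext => n; rewrite Rintegral_cst ?mul0r//; exact: mO.
Qed.

Lemma tip_partials s u v : tip (foldr tpartial u s) v =
  (-1) ^+ size s * tip u (foldr tpartial v s).
Proof.
elim: s u v => [|i s IH] u v; first by rewrite mul1r.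
have E : foldr tpartial v (i :: s) = foldr tpartial (tpartial i v) s.
  by rewrite /=; elim: s {IH} => //= j s <-; rewrite tpartialC.
by rewrite E /= tip_skew IH exprS mulN1r mulNr.
Qed.

(** Integration by parts holds for each [phi n], and both sides converge as inner products with a
    fixed function. *)
Lemma jet_cvg_weak phi U s : jet_cvg m phi U -> (size s <= m)%N ->
  weak_derivative Omega s (U [::]) (U s).
Proof.
move=> cU sm psi tpsi; pose v := mk_testf tpsi.
have [L0 c0] := cU [::] (leq0n m); have [Ls cs] := cU s sm.
have vv : L2cvg leb Omega (fun=> v) v by exact: (@test_jet_cvg v [::] (leq0n m)).2.
have dv : L2cvg leb Omega (fun=> partials s v) (partials s v).
  by exact: (@test_jet_cvg v s sm).2.
have H1 := L2ip_cvg mO (fun n => partials_L2 s (phi n)) (fun=> testf_L2 v) Ls (testf_L2 v) cs vv.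
have H2 := L2ip_cvg mO (fun n => testf_L2 (phi n)) (fun=> partials_L2 s v) L0 (partials_L2 s v) c0 dv.
have E n : L2ip leb Omega (partials s (phi n)) v =
    (-1) ^+ size s * L2ip leb Omega (phi n) (partials s v).
  by rewrite -!tpartials_foldr; exact: tip_partials.
have H3 : L2ip leb Omega (partials s (phi n)) v @[n --> \oo] -->
    (-1) ^+ size s * L2ip leb Omega (U [::]) (partials s v).
  by under eq_fun do rewrite E; apply: cvgM => //; exact: cvg_cst.
have := cvg_unique _ H1 H3; rewrite /L2ip => /(_ (@norm_hausdorff _ _)) ->.
by rewrite mulrA -expr2 sqrr_sign mul1r.
Qed.

Lemma jet_cvg_sobolev0 phi U : jet_cvg m phi U -> sobolev0 Omega m U.
Proof.
move=> cU; split.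
  by move=> s sm; split; [exact: (cU s sm).1|exact: jet_cvg_weak cU sm].
exists (fun n => phi n : rV -> R); split; first by move=> n; exact: testfP.
move=> s sm; have [LU cU'] := cU s sm.
by apply/(L2cvgP mO _ LU) => // n; exact: partials_L2.
Qed.

(** The form of order [m] controls every derivative of order at most [m], so these derivatives of
    the minimizing sequence converge separately in [L2]. *)
Lemma minimizer_jet : exists (phi : nat -> testf) U, [/\ jet_cvg m phi U,
  forall n, b (phi n) (phi n) = 1, forall n, a (phi n) (phi n) <= lam + 1 / 4 ^+ n &
  forall n k, (n <= k)%N -> b (phi k - phi n) (phi k - phi n) <= 1 / 4 ^+ n].
Proof.
have [phi [pb pa pc]] := minimizing_seq i0 pm u0P.
have ca := minimizing_seq_cauchy i0 u0P pb pa pc.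
have ex s : exists Us, (size s <= m)%N -> L2 leb Omega Us /\
    L2cvg leb Omega (fun n => partials s (phi n)) Us.
  (* Beyond order [m] nothing is asked of the jet. *)
  have [sm|sm] := leqP (size s) m; last by exists (fun=> 0).
  have [n k nk|g Lg gP] := @L2_complete _ _ _ _ _ mO (fun n => partials s (phi n)) (4 + lam)
    (fun n => partials_L2 s (phi n)).
    apply: le_trans (ca n k nk); apply: le_trans (tform_le i0 _ sm).
    apply: le_trans (tform_partials s _).
    apply: le_of_eq; rewrite /tip /L2ip; apply: eq_Rintegral => x _.
    have -> : foldr tpartial (phi k - phi n) s =
        foldr tpartial (phi k) s - foldr tpartial (phi n) s.
      by elim: s {sm} => //= i s ->; rewrite linearB.
    by rewrite testfB !tpartials_foldr.
  exists g => _; split=> //.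
  apply: (@squeeze_cvgr _ _ _ _ (fun=> 0) (fun n => (4 + lam) / 4 ^+ n)).
  - by apply: nearW => n; rewrite L2ip_ge0 gP.
  - exact: cvg_cst.
  - exact/cvg_mulr0/cvg_expr4.
have [U UP] := choice ex; exists phi, U; split=> // s sm; exact: UP.
Qed.

Lemma rayleigh_inf_weak_eigenvalue t : p = (m - t)%N -> weak_eigenvalue Omega m t lam.
Proof.
move=> pt; have [phi [U [cU pb pa pc]]] := minimizer_jet.
have SU := jet_cvg_sobolev0 cU.
exists U; split=> //.
- move=> U0.
  have [LU0 cU0] := cU [::] (leq0n m).
  have ipU0 v : L2ip leb Omega (U [::]) v = 0.
    rewrite /L2ip /Rintegral (@ae_eq_integral _ _ _ _ Omega (cst 0%E)) ?integral0//.
    + exact: mO.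
    + apply/measurable_EFinP/measurable_funM; first by case: LU0.
      by case: (testf_L2 v).
    + case: U0 => N [mN N0 sN]; exists N; split=> // x /= H; apply: sN => /= Ux.
      by apply: H => xO; rewrite Ux// mul0r.
  (* Putting all derivatives on the fixed [phi 1] leaves only the convergence of [phi n] itself: if
     [U [::]] were 0, then [b (phi n) (phi 1)] would tend to 0. *)
  pose v := iter p lap (phi 1%N).
  have vv : L2cvg leb Omega (fun=> v) v by exact: (@test_jet_cvg v [::] (leq0n m)).2.
  have := L2ip_cvg mO (fun n => testf_L2 (phi n)) (fun=> testf_L2 v) LU0 (testf_L2 v) cU0 vv.
  rewrite ipU0 => lim0.
  have limb : b (phi n) (phi 1%N) @[n --> \oo] --> 0.
    have E n : b (phi n) (phi 1%N) = (-1) ^+ p * L2ip leb Omega (phi n) v.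
      exact: (polyformE tip_sip tip_skew p (phi n) (phi 1%N)).
    by under eq_fun do rewrite E; exact: cvg_mulr0.
  have /cvgrPdist_lt/(_ (1/4)) := limb; rewrite divr_gt0// => /(_ isT) [N _ HN].
  have := HN (maxn N 1) (leq_maxl _ _); rewrite sub0r normrN /=.
  set k := maxn N 1 => Hk.
  have kc := pc 1%N k (leq_maxr _ _).
  (* The unit vector [phi 1] is at squared distance at most [1 / 4] from [phi k], so their product
     is at least [1 / 2], a contradiction. *)
  have := sip_CauchySchwarz bP (phi k - phi 1%N) (phi 1%N).
  rewrite pb mulr1 (ipBl bP) pb => H.
  have : (b (phi k) (phi 1%N) - 1) ^+ 2 <= 1 / 4 ^+ 1 := le_trans H kc.
  by move: Hk; rewrite expr1 ltr_norml => /andP[]; set z := b _ _; nra.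
- move=> V /sobolev0_jet_cvg [psi cV].
  have la := grad_form_cvg (leqnn m) cU cV.
  have lb := grad_form_cvg (ltnW pm) cU cV.
  have lbb := grad_form_cvg (leqnn m) cV cV.
  rewrite -pt; apply/eqP; rewrite -subr_eq0; apply/eqP.
  (* By minimality [q] is nonnegative, and at [phi n] it is at most [1 / 4 ^+ n]. Cauchy-Schwarz for
     [q] then gives the Euler-Lagrange equation in the limit. *)
  pose q u v := a u v - lam * b u v.
  have qP : sip q.
    split=> [u v w|c u v|u v|u]; rewrite /q.
    + by rewrite (ipDl aP) (ipDl bP); ring.
    + by rewrite (ipZl aP) (ipZl bP); ring.
    + by rewrite (ipC aP) (ipC bP).
    + by rewrite subr_ge0; exact: (rayleigh_inf_le i0 _ _ u0P).
  have lq : q (phi n) (psi n) @[n --> \oo] -->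
      grad_form Omega m U V - lam * grad_form Omega p U V.
    by apply: cvgB => //; apply: cvgM => //; exact: cvg_cst.
  have lq0 : q (phi n) (psi n) @[n --> \oo] --> 0.
    apply: (@cvg_sqr0 _ _ (fun n => 1 / 4 ^+ n * a (psi n) (psi n))).
      move=> n; apply: le_trans (sip_CauchySchwarz qP _ _) _.
      apply: ler_pM; rewrite ?(ip_ge0 qP)//.
        by rewrite /q pb mulr1 lerBlDl.
      by rewrite /q lerBlDr lerDl mulr_ge0 ?(ip_ge0 bP)// (rayleigh_inf_ge0 i0 _ _ u0P).
    rewrite -[X in _ --> X](mul0r (grad_form Omega m V V)); apply: cvgM => //.
    exact/cvg_mulr0/cvg_expr4.
  exact: (cvg_unique (@norm_hausdorff _ _) lq lq0).
Qed.

(** Testing the equation with its own solution exhibits [kappa] as a Rayleigh quotient. The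
    denominator is positive since it dominates the [L2] norm, nonzero because [U [::]] is not almost
    everywhere 0. *)
Lemma rayleigh_inf_minimal t kappa : p = (m - t)%N ->
  weak_eigenvalue Omega m t kappa -> lam <= kappa.
Proof.
move=> pt [U [SU U0 /(_ U SU)]]; rewrite -pt => E.
have [phi cU] := sobolev0_jet_cvg SU.
have la := grad_form_cvg (leqnn m) cU cU.
have lb := grad_form_cvg (ltnW pm) cU cU.
have [LU0 cU0] := cU [::] (leq0n m).
have lt := L2ip_cvg mO (fun n => testf_L2 (phi n)) (fun n => testf_L2 (phi n)) LU0 LU0 cU0 cU0.
have tp : 0 < L2ip leb Omega (U [::]) (U [::]).
  rewrite lt_def L2ip_ge0 andbT; apply: contra_notN U0 => /eqP U0.
  have := L2ip_EFin LU0; rewrite U0.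
  under eq_integral do rewrite -[X in (X)%:E]ger0_norm ?sqr_ge0// -abse_EFin.
  move=> /(ae_eq_integral_abs _ mO)[|N [mN N0 sN]].
    by apply/measurable_EFinP/measurable_funX; case: LU0.
  exists N; split=> // x /= H; apply: sN => /= H'; apply: H => xO.
  by have := H' xO; move=> [/eqP]; rewrite sqrf_eq0 => /eqP.
have tb : L2ip leb Omega (U [::]) (U [::]) <= grad_form Omega p U U.
  apply: (ler_cvg_to lt lb); apply: nearW => n.
  exact: (tform_le i0 (phi n) (leq0n p)).
have lamE : lam * grad_form Omega p U U <= grad_form Omega m U U.
  have lb' : lam * tform p (phi n) (phi n) @[n --> \oo] --> lam * grad_form Omega p U U.
    by apply: cvgM => //; exact: cvg_cst.
  apply: (ler_cvg_to lb' la); apply: nearW => n.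
  exact: (rayleigh_inf_le i0 _ _ u0P).
move: lamE; rewrite E ler_pM2r//; exact: lt_le_trans tp tb.
Qed.

Lemma first_eigenvalueE t : p = (m - t)%N -> first_eigenvalue Omega m t = lam.
Proof.
move=> pt; rewrite /first_eigenvalue.
(* The default value is excluded because [lam] is itself a smallest eigenvalue. *)
case: xgetP => [l _ [we lmin]|/(_ lam) []]; last first.
  by split; [exact: rayleigh_inf_weak_eigenvalue|move=> k; exact: rayleigh_inf_minimal].
apply/eqP; rewrite eq_le (rayleigh_inf_minimal pt we) andbT; apply: lmin.
exact: rayleigh_inf_weak_eigenvalue.
Qed.

End first_eigenvalue.

(** * Flat profiles *)

Section flat.
Context {R : realType}.
Variable eps : R.
Hypothesis eps0 : 0 < eps.

Definition flat n (y : R) : R := if 0 < y then y^-1 ^+ n * expR (- (eps / y)) else 0.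

Lemma flat_ge0 n y : 0 <= flat n y.
Proof.
rewrite /flat; case: ifP => // y0; apply: mulr_ge0; last exact: expR_ge0.
by rewrite exprn_ge0// invr_ge0 ltW.
Qed.

(** A single term of the exponential series. With [z = eps / y] it bounds the profiles uniformly in
    [eps]; with [z = n] it provides the lower bound for the factorial in the eigenvalue estimate. *)
Lemma expRN_le n (z : R) : 0 <= z -> z ^+ n * expR (- z) <= n`!%:R.
Proof.
move=> z0; rewrite expRN -[X in _ / X]/(expR z) ler_pdivrMr ?expR_gt0//.
case: n => [|n]; first by rewrite expr0 mul1r -[leLHS]expR0 ler_expR.
have := expR_ge1Dxn n z0; rewrite mulrC => H; rewrite mulrC -ler_pdivrMr ?ltr0n ?fact_gt0//.
by apply: le_trans H; rewrite mulrC lerDr.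
Qed.

(** A bound linear in [y] yields the derivative at 0, because dividing [flat n] by [y] produces
    [flat n.+1], which then tends to 0. *)
Lemma flat_le n y : `|flat n y| <= n.+1`!%:R / eps ^+ n.+1 * `|y|.
Proof.
rewrite ger0_norm ?flat_ge0// /flat; case: ifPn => y0; last first.
  by rewrite mulr_ge0// divr_ge0// exprn_ge0// ltW.
have z0 : 0 <= eps / y by rewrite divr_ge0// ltW.
have := expRN_le n.+1 z0; set E := expR _ => H.
rewrite gtr0_norm// mulrAC ler_pdivlMr ?exprn_gt0//.
have := ler_wpM2r (ltW y0) H; apply: le_trans; apply: le_of_eq.
rewrite expr_div_n exprVn [y ^+ n.+1]exprS; have : y ^+ n != 0 by rewrite expf_neq0// gt_eqF.
by set Y := y ^+ n; move=> Y0; field; rewrite Y0 gt_eqF.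
Qed.

Lemma flat_le0 n y : y <= 0 -> flat n y = 0.
Proof. by rewrite /flat ltNge => ->. Qed.

Lemma is_derive_flat n (y : R) :
  is_derive y 1 (flat n) (- (n%:R * flat n.+1 y) + eps * flat n.+2 y).
Proof.
have [y0|y0|y0] := ltgtP 0 y.
- have yn0 : y != 0 by rewrite gt_eqF.
  have dV : is_derive y 1 (fun z : R => z^-1) (- y ^- 2).
    apply: DeriveDef; first by apply: (@derivableV _ _ id).
    by rewrite (@deriveV _ _ id)// derive_id /GRing.scale/= mulr1.
  have dE : is_derive y 1 (fun z : R => expR (- (eps / z))) (expR (- (eps / y)) * (eps * y ^- 2)).
    have d1 : is_derive y 1 (fun z : R => - (eps / z)) (eps * y ^- 2).
      apply: (is_derive_eq (is_deriveN (is_deriveZ eps dV))).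
      by rewrite /GRing.scale/= mulrN opprK.
    exact: (@is_derive1_comp _ expR (fun z : R => - (eps / z)) y _ _ _ d1).
  have dP : is_derive y 1 ((fun z : R => z^-1) ^+ n * (fun z : R => expR (- (eps / z))))
      (- (n%:R * flat n.+1 y) + eps * flat n.+2 y).
    apply: (is_derive_eq (is_deriveM (is_deriveX n dV) dE)).
    rewrite /flat y0 /GRing.scale/= !fctE.
    case: n => [|n]; first by rewrite !expr0 !mul0r mulr0; field.
    rewrite /= !exprS; set Y := _ ^+ n; set E := expR _; field.
    done.
  apply: (@near_eq_is_derive _ _ _ _ _ _ _ _ _ dP).
  near=> z; have z0 : 0 < z by near: z; exact: lt_nbhsr.
  by rewrite /flat z0 /= !fctE.
- have -> : - (n%:R * flat n.+1 y) + eps * flat n.+2 y = 0.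
    by rewrite !flat_le0 ?ltW// !mulr0 oppr0 addr0.
  apply: (@near_eq_is_derive _ _ _ (fun=> 0)).
  by near=> z; rewrite flat_le0// ltW//; near: z; exact: lt_nbhsl.
- rewrite -{}y0 !flat_le0// !mulr0 oppr0 addr0.
  have H : (fun h : R => h^-1 *: (flat n (h *: 1 + 0) - flat n 0)) @ 0^' --> (0 : R).
    apply/cvgrPdist_le => r r0.
    pose C := n.+2`!%:R / eps ^+ n.+2.
    have C0 : 0 < C by rewrite divr_gt0 ?exprn_gt0// ltr0n fact_gt0.
    have rC : 0 < r / C by rewrite divr_gt0.
    near=> h; rewrite addr0 (flat_le0 n (lexx 0)) subr0 sub0r normrN /GRing.scale/= mulr1.
    have -> : h^-1 * flat n h = flat n.+1 h.
      by rewrite /flat; case: ifP => _; rewrite ?mulr0// exprS mulrA.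
    apply: le_trans (flat_le _ _) _; rewrite -/C mulrC -ler_pdivlMr//.
    near: h; apply: nbhs_dnbhs.
    by apply/nbhs_ballP; exists (r / C) => //= h; rewrite -ball_normE /= sub0r normrN => /ltW.
  by split; [apply/cvg_ex; eexists; exact: H|exact: cvg_lim H].
Unshelve. all: by end_near. Qed.

(* [(c, a, n, i)] encodes [c eps^i y^a y^(-n) exp(-eps/y)]. *)
Definition term : Type := (R * nat * nat * nat)%type.
Implicit Types (t : term) (L : seq term).

Definition term_eval t (y : R) : R :=
  let: (c, a, n, i) := t in c * (eps ^+ i * (y ^+ a * flat n y)).
Definition eval_terms L y : R := \sum_(t <- L) term_eval t y.

(** The product rule. For [n = 0] the middle term is left out instead of being kept with coefficient
    0: it would have [n = 1] possibly with [i = 0], which the bookkeeping of weights forbids. *)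
Definition term_deriv t : seq term := let: (c, a, n, i) := t in
  (c * a%:R, a.-1, n, i) :: (if n is n'.+1 then [:: (- (c * n%:R), a, n.+1, i)] else [::])
    ++ [:: (c, a, n.+2, i.+1)].
Definition deriv_terms L : seq term := flatten [seq term_deriv t | t <- L].
Definition scale_terms (k : R) L : seq term := [seq (k * t.1.1.1, t.1.1.2, t.1.2, t.2) | t <- L].
Definition shift_terms L : seq term := [seq (t.1.1.1, t.1.1.2.+1, t.1.2, t.2) | t <- L].

Lemma eval_cat L L' y : eval_terms (L ++ L') y = eval_terms L y + eval_terms L' y.
Proof. exact: big_cat. Qed.

Lemma eval_scale k L y : eval_terms (scale_terms k L) y = k * eval_terms L y.
Proof.
rewrite /eval_terms big_map mulr_sumr; apply: eq_bigr => -[[[c a] n] i] _ /=.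
exact: esym (mulrA _ _ _).
Qed.

Lemma eval_shift L y : eval_terms (shift_terms L) y = y * eval_terms L y.
Proof.
rewrite /eval_terms big_map mulr_sumr; apply: eq_bigr => -[[[c a] n] i] _ /=.
by rewrite exprS; ring.
Qed.

Lemma is_derive_term t (y : R) :
  is_derive y 1 (term_eval t) (eval_terms (term_deriv t) y).
Proof.
case: t => [[[c a] n] i].
have dX : is_derive y 1 ((fun z : R => z) ^+ a) (a%:R * y ^+ a.-1).
  by apply: (is_derive_eq (is_deriveX a (@is_derive_id _ _ y 1))); rewrite /GRing.scale/= mulr1.
have dM := is_deriveM dX (is_derive_flat n y).
have dc := is_deriveZ (c * eps ^+ i) dM.
have E : term_eval (c, a, n, i) = (c * eps ^+ i) \*: ((fun z : R => z) ^+ a * flat n).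
  apply/funext => z; rewrite /term_eval !fctE.
  by rewrite -[RHS]/((c * eps ^+ i) * (z ^+ a * flat n z)); ring.
rewrite E; apply: (is_derive_eq dc).
rewrite /eval_terms /term_deriv !fctE /GRing.scale/=.
by case: n {dM dc E} => [|n]; rewrite !big_cons ?big_nil /= exprS; ring.
Qed.

Lemma is_derive_eval L (y : R) : is_derive y 1 (eval_terms L) (eval_terms (deriv_terms L) y).
Proof.
elim: L => [|t L IH].
  rewrite (_ : eval_terms [::] = fun=> 0); last by apply/funext => z; rewrite /eval_terms big_nil.
  exact: is_derive_cst.
rewrite /deriv_terms /= eval_cat.
rewrite (_ : eval_terms (t :: L) = term_eval t + eval_terms L); last first.
  by apply/funext => z; rewrite /eval_terms big_cons.
by apply: is_deriveD => //; exact: is_derive_term.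
Qed.

End flat.

(** * Homogeneity of the profile terms and their limits *)

Section weights.
Context {R : realType}.
Implicit Types (L : seq (@term R)).

(* All terms of [L] are homogeneous enough to be bounded after multiplication
   by [y^(s - m)], and only powers of [y] survive as [eps] tends to [0]. *)
Definition well_weighted (m s : nat) L :=
  all (fun t => (t.1.2 + m <= t.1.1.2 + t.2 + s)%N && ((t.2 == 0%N) ==> (t.1.2 == 0%N))) L.

(** A derivative lowers the homogeneity in [y] and [eps] together by one, whether it falls on [y^a],
    on [y^-n] or, with one more [eps], on the exponential. *)
Lemma well_weighted_deriv m s L :
  well_weighted m s L -> well_weighted m s.+1 (deriv_terms L).
Proof.
rewrite /well_weighted /deriv_terms; elim: L => //= -[[[c a] n] i] L IH /andP[/= /andP[H1 H2] /IH H3].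
rewrite /= all_cat H3 andbT.
by case: n H1 H2 => [|n] /= H1 H2; rewrite ?andbT; lia.
Qed.

Lemma well_weighted_scale m s k L : well_weighted m s L -> well_weighted m s (scale_terms k L).
Proof. by rewrite /well_weighted /scale_terms all_map; apply: sub_all => t. Qed.

Lemma well_weighted_shift m s L : well_weighted m s L -> well_weighted m s (shift_terms L).
Proof.
rewrite /well_weighted /shift_terms all_map; apply: sub_all => -[[[c a] n] i] /=.
by move=> /andP[H1 ->]; rewrite andbT; lia.
Qed.

Lemma well_weighted_cat m s L L' :
  well_weighted m s (L ++ L') = well_weighted m s L && well_weighted m s L'.
Proof. exact: all_cat. Qed.

Lemma well_weightedW m s L : well_weighted m s L -> well_weighted m s.+1 L.
Proof.
rewrite /well_weighted; apply: sub_all => -[[[c a] n] i] /=.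
by move=> /andP[H1 ->]; rewrite andbT; lia.
Qed.

Definition limit_poly L : {poly R} :=
  \sum_(t <- L | t.2 == 0%N) t.1.1.1 *: 'X^(t.1.1.2).

Lemma limit_poly_cat L L' : limit_poly (L ++ L') = limit_poly L + limit_poly L'.
Proof. exact: big_cat. Qed.

Lemma limit_poly_scale k L : limit_poly (scale_terms k L) = k *: limit_poly L.
Proof.
by rewrite /limit_poly big_map scaler_sumr; apply: eq_bigr => t _; rewrite scalerA.
Qed.

Lemma limit_poly_shift L : limit_poly (shift_terms L) = 'X * limit_poly L.
Proof.
rewrite /limit_poly big_map mulr_sumr; apply: eq_bigr => t _ /=.
by rewrite exprS scalerAr.
Qed.

(** A power of [eps] is never lost, and the terms coming from the exponential gain one; the terms
    free of [eps] are plain monomials and are differentiated as such. *)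
Lemma limit_poly_deriv m s L : well_weighted m s L ->
  limit_poly (deriv_terms L) = (limit_poly L)^`().
Proof.
elim: L => [|[[[c a] n] i] L IH]; first by rewrite /limit_poly !big_nil deriv0.
rewrite /well_weighted /= => /andP[/andP[_ ni] /IH E].
rewrite -[deriv_terms (_ :: L)]/(term_deriv (c, a, n, i) ++ deriv_terms L) limit_poly_cat E.
have -> : limit_poly ((c, a, n, i) :: L) = limit_poly [:: (c, a, n, i)] + limit_poly L.
  by rewrite -limit_poly_cat.
rewrite derivD; congr (_ + _).
rewrite /limit_poly !big_cons big_cat !big_cons !big_nil/=.
case: i ni => [|i] /= ni; last first.
  by rewrite deriv0; case: n {ni} => [|n]; rewrite ?big_cons ?big_nil/= ?addr0.
rewrite (eqP ni) big_nil !addr0 derivZ derivXn -scalerA.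
by congr (_ *: _); rewrite scaler_nat.
Qed.

End weights.

(** * Radial test functions and their Laplacians *)

Section trial.
Context {R : realType} {d : nat}.
Local Notation rV := ('rV[R]_d).
Local Notation leb := (@lebesgue_rV R d).
Local Notation Omega := (@unit_ball R d).
Local Notation e i := (delta_mx ord0 i : 'rV[R]_d).
Implicit Types (i j : 'I_d) (x : rV).

Lemma smooth_sum I (r : seq I) (F : I -> rV -> R) : (forall k, smooth (F k)) ->
  smooth (fun x => \sum_(k <- r) F k x).
Proof.
move=> sF; elim: r => [|k r IH].
  by under eq_fun do rewrite big_nil; exact: smooth_cst.
by under eq_fun do rewrite big_cons; exact: smoothD.
Qed.

Lemma is_derive_comp_partial (g : R -> R) (f : rV -> R) (dg : R) i x :
  derivable f x (e i) -> is_derive (f x) 1 g dg ->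
  is_derive x (e i) (fun y => g (f y)) (dg * partial i f x).
Proof.
move=> df gd.
have x0 : x + (0 : R) *: e i = x by rewrite scale0r addr0.
have dl : is_derive (0 : R) 1 (fun s : R => f (x + s *: e i)) (partial i f x).
  by rewrite -{2}x0; apply: is_derive_line; rewrite x0.
have gd' : is_derive ((fun s : R => f (x + s *: e i)) 0) 1 g dg by rewrite x0.
have [D1 D2] := @is_derive1_comp _ g _ _ _ _ gd' dl.
have E (h : R) : (g \o (fun s : R => f (x + s *: e i))) (h *: 1 + 0) -
    (g \o (fun s : R => f (x + s *: e i))) 0 = g (f (h *: e i + x)) - g (f x).
  by rewrite /= x0 addr0 -[h *: 1]/(h * 1) mulr1 [_ + x]addrC.
apply: DeriveDef; first exact: eq_derivable D1.
by rewrite -D2; apply: esym; exact: eq_derive.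
Qed.

Variable rho : R.

Definition depth x : R := rho - \sum_i x ord0 i ^+ 2.

Lemma smooth_depth : smooth depth.
Proof.
have E : depth = (fun x => rho + \sum_i (-1) * (x ord0 i * x ord0 i)).
  by apply/funext => x; rewrite /depth -sumrN; congr (_ + _); apply: eq_bigr => i _; rewrite expr2 mulN1r.
rewrite E; apply: smoothD; first exact: smooth_cst.
apply: smooth_sum => i; apply: smoothM; first exact: smooth_cst.
by apply: smoothM; exact: smooth_coord.
Qed.

Lemma partial_depth i x : partial i depth x = - 2 * x ord0 i.
Proof.
have E : depth = cst rho - \sum_j (fun y : rV => y ord0 j) ^+ 2.
  by apply/funext => y; rewrite /depth !fctE; congr (_ - _); rewrite fct_sumE.
have dS := is_derive_sum (fun j => is_deriveX 2 (@is_derive_coord R d i j x)).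
have [_ D] := is_deriveB (is_derive_cst rho x (e i)) dS.
rewrite /partial E D sub0r (bigD1 i)//= big1 => [|j ji].
  by rewrite addr0 eqxx /GRing.scale/= expr1 (_ : true%:R = 1 :> R)//; ring.
by rewrite eq_sym (negbTE ji) scaler0.
Qed.

Variable eps : R.
Hypothesis eps0 : 0 < eps.
Local Notation evalL L := (fun x => eval_terms eps L (depth x)).

Lemma is_derive_radial L i x :
  is_derive x (e i) (evalL L) (eval_terms eps (deriv_terms L) (depth x) * (- 2 * x ord0 i)).
Proof.
rewrite -partial_depth; apply: is_derive_comp_partial; first exact/smooth_derivable/smooth_depth.
exact: is_derive_eval.
Qed.

Lemma smooth_radial L : smooth (evalL L).
Proof.
pose G := [set g : rV -> R | smooth g \/ exists L, g = evalL L].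
apply: (@smooth_alg_closure _ _ G); last by apply: alg_gen; right; exists L.
move=> g [sg|[{}L ->]].
  split; first exact: smooth_continuous.
  move=> j; split; first by move=> x; exact: smooth_derivable.
  by apply: alg_gen; left; exact: smooth_partial.
split.
  move=> x; apply: (@continuous_comp _ _ _ depth (eval_terms eps L)).
    exact/smooth_continuous/smooth_depth.
  apply: differentiable_continuous; apply/derivable1_diffP.
  by case: (is_derive_eval eps0 L (depth x)).
move=> j; split; first by move=> x; case: (is_derive_radial L j x).
have -> : partial j (evalL L) = fun x => eval_terms eps (deriv_terms L) (depth x) * (- 2 * x ord0 j).
  by apply/funext => x; case: (is_derive_radial L j x).
apply: (@alg_mul _ _ _ (evalL (deriv_terms L))); first by apply: alg_gen; right; exists (deriv_terms L).
apply: (@alg_mul _ _ _ (fun=> - 2)); first exact: alg_cst.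
by apply: alg_gen; left; exact: smooth_coord.
Qed.

Lemma eval_le0 L (y : R) : y <= 0 -> eval_terms eps L y = 0.
Proof.
move=> y0; rewrite /eval_terms big1// => -[[[c a] n] i] _ /=.
by rewrite flat_le0// !mulr0.
Qed.

Hypothesis rho1 : rho < 1.

(** The support lies in the closed ball of squared radius [rho], which is compact in the open unit
    ball because [rho < 1]. *)
Lemma test_radial L : test_function Omega (evalL L).
Proof.
split; first exact: smooth_radial.
exists [set x | 0 <= depth x]; split.
- apply: (@subclosed_compact _ _ [set v : rV | forall i, `[(- 1 : R), 1]%classic (v ord0 i)]).
  + apply: (@closed_comp _ _ depth [set t : R | 0 <= t]); last exact: closed_ge.
    by move=> x _; apply: smooth_continuous; exact: smooth_depth.
  + by apply: (@rV_compact _ _ (fun=> `[(- 1 : R), 1]%classic)) => _; exact: segment_compact.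
  + move=> x xr i; have : Omega x.
      by apply: le_lt_trans rho1; rewrite -subr_ge0.
    by move=> /unit_ball_box /(_ i); rewrite /= in_itv/= -ler_norml.
- by move=> x; rewrite /= /depth subr_ge0 => xr; apply: le_lt_trans rho1.
- by move=> x /negP; rewrite /= -ltNge => /ltW; exact: eval_le0.
Qed.

Definition radial L : @testf R d := mk_testf (test_radial L).

Lemma radialE L x : radial L x = eval_terms eps L (depth x). Proof. by []. Qed.

(* With [g] the profile, [g (depth x)] has Laplacian
   [4 |x|^2 g'' - 2 d g'], and [|x|^2 = rho - depth x]. *)
Definition laplace_terms L : seq (@term R) :=
  let L' := deriv_terms L in let L'' := deriv_terms L' in
  scale_terms (4 * rho) L'' ++ scale_terms (- 4) (shift_terms L'') ++ scale_terms (- 2 * d%:R) L'.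

Lemma laplacian_radial L : laplacian (@tpartial R d) (radial L) = radial (laplace_terms L).
Proof.
apply: testf_eq => x; rewrite testf_sum radialE.
rewrite /laplace_terms !eval_cat !eval_scale eval_shift.
set y := depth x; set A := eval_terms eps (deriv_terms L) y.
set B := eval_terms eps (deriv_terms (deriv_terms L)) y.
have P j : tpartial j (radial L) = (fun x => eval_terms eps (deriv_terms L) (depth x) * (- 2 * x ord0 j)) :> (rV -> R).
  by apply/funext => z; case: (is_derive_radial L j z).
have E j : tpartial j (tpartial j (radial L)) x = 4 * B * x ord0 j ^+ 2 - 2 * A.
  transitivity (partial j (fun x => eval_terms eps (deriv_terms L) (depth x) * (- 2 * x ord0 j)) x).
    by rewrite -P.
  have [d1 p1] := is_derive_radial (deriv_terms L) j x.
  have d2 : derivable (fun x : rV => - 2 * x ord0 j) x (e j).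
    by apply/smooth_derivable/smoothM; [exact: smooth_cst|exact: smooth_coord].
  have p2 : partial j (fun x : rV => - 2 * x ord0 j) x = - 2.
    rewrite (@partialM _ _ (fun=> - 2)); [|exact: derivable_cst|exact: derivable_coord].
    by rewrite partial_cst partial_coord eqxx (_ : true%:R = 1 :> R)//; ring.
  rewrite (@partialM _ _ (evalL (deriv_terms L)) (fun x => - 2 * x ord0 j))//.
  by rewrite p2 /partial p1 -/y -/A -/B; ring.
rewrite (eq_bigr (fun j => 4 * B * x ord0 j ^+ 2 - 2 * A)) => [|j _]; last exact: E.
rewrite sumrB -mulr_sumr sumr_const card_ord -mulr_natr.
have -> : \sum_j x ord0 j ^+ 2 = rho - y by rewrite /y /depth; ring.
ring.
Qed.

Lemma iter_laplacian_radial k L :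
  iter k (laplacian (@tpartial R d)) (radial L) = radial (iter k laplace_terms L).
Proof. by elim: k => //= k ->; exact: laplacian_radial. Qed.

Lemma well_weighted_laplace m s L :
  well_weighted m s L -> well_weighted m s.+2 (laplace_terms L).
Proof.
move=> /well_weighted_deriv w1; have w2 := well_weighted_deriv w1.
rewrite /laplace_terms !well_weighted_cat; apply/and3P; split.
- exact: well_weighted_scale.
- exact/well_weighted_scale/well_weighted_shift.
- exact/well_weighted_scale/well_weightedW.
Qed.

Lemma well_weighted_iter_laplace m s k L :
  well_weighted m s L -> well_weighted m (s + k.*2) (iter k laplace_terms L).
Proof.
move=> wL; elim: k => [|k IH]; first by rewrite addn0.
by rewrite doubleS 2!addnS; exact: well_weighted_laplace.
Qed.

Definition laplace_poly (P : {poly R}) : {poly R} :=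
  (4 * rho) *: P^`()^`() - 4 *: ('X * P^`()^`()) - (2 * d%:R) *: P^`().

Lemma limit_laplace m s L : well_weighted m s L ->
  limit_poly (laplace_terms L) = laplace_poly (limit_poly L).
Proof.
move=> wL; have w1 := well_weighted_deriv wL.
rewrite /laplace_terms !limit_poly_cat !limit_poly_scale limit_poly_shift.
rewrite (limit_poly_deriv w1) (limit_poly_deriv wL) /laplace_poly -addrA.
by rewrite scaleNr mulNr scaleNr.
Qed.

Lemma limit_iter_laplace m s k L : well_weighted m s L ->
  limit_poly (iter k laplace_terms L) = iter k laplace_poly (limit_poly L).
Proof.
move=> wL; elim: k => // k IH /=.
by rewrite (limit_laplace (well_weighted_iter_laplace k wL)) IH.
Qed.

(* [laplace_poly] lowers the degree, with leading factor [- 2 j (2 j - 2 + d)]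
   in degree [j]. *)
Lemma iter_laplace_poly n (P : {poly R}) : (size P <= n.+1)%N ->
  iter n laplace_poly P =
  (P`_n * \prod_(j < n) (- (2 * j.+1%:R * (2 * j%:R + d%:R))))%:P.
Proof.
elim: n P => [|n IH] P sP; first by rewrite big_ord0 mulr1 [LHS]size1_polyC.
have s1 (Q : {poly R}) k : (size Q <= k.+1)%N -> (size Q^`() <= k)%N.
  move=> sQ; have [->|Q0] := eqVneq Q 0; first by rewrite deriv0 size_poly0.
  by rewrite -ltnS; apply: leq_trans sQ; exact: lt_size_deriv.
have sP1 := s1 _ _ sP; have sP2 := s1 _ _ sP1.
rewrite iterSr IH; last first.
  rewrite /laplace_poly; apply: leq_trans (size_polyD _ _) _; rewrite geq_max size_polyN; apply/andP; split; last first.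
    by apply: leq_trans (size_scale_leq _ _) _.
  apply: leq_trans (size_polyD _ _) _; rewrite geq_max size_polyN; apply/andP; split.
    by apply: leq_trans (size_scale_leq _ _) _; exact: leqW.
  apply: leq_trans (size_scale_leq _ _) _.
  by rewrite mulrC; apply: leq_trans (size_polyMleq _ _) _; rewrite size_polyX addn2.
rewrite big_ord_recr/= /laplace_poly !coefB !coefZ coefXM !coef_deriv.
(* The term with [4 * rho] would need this coefficient; hence the leading factor does not involve
   [rho]. *)
have P0 : P`_n.+2 = 0 by rewrite nth_default.
congr (_%:P); rewrite P0 !mul0rn mulr0 sub0r.
case: n {IH sP sP1 sP2 P0} => [|n] /=.
  by rewrite big_ord0 mulr1n; ring.
move: (\prod_(_ < _) _) (P`_n.+2) => p c.
rewrite -[c *+ _ *+ _]mulr_natr -[c *+ _]mulr_natr -[n.+2%:R]natr1; move: (n.+1%:R) => k; ring.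
Qed.

End trial.

(** * Integrals of powers of the depth *)

Section bounded_convergence.
Context {R : realType} {n : nat}.
Local Notation leb := (@lebesgue_rV R n).

Lemma bbV_cst_indic (M N : R) : bbV (fun x : 'rV[R]_n => M * \1_(box N) x).
Proof.
split; first by apply: measurable_funM => //; apply: measurable_indic; exact: measurable_box.
exists (`|M| + `|N|); split=> x; rewrite indicE.
  rewrite normrM; case: (_ \in _); rewrite ?normr1 ?normr0 ?mulr1 ?mulr0 ?addr_ge0//.
  by rewrite lerDl.
case: (boolP (x \in _)) => [|_]; last by rewrite mulr0 eqxx.
by rewrite inE => xN _; apply: sub_box xN; rewrite (le_trans (ler_norm N))// lerDr.
Qed.

Lemma bounded_convergence (f_ : nat -> 'rV[R]_n -> R) f (M N : R) :
  (forall k, measurable_fun setT (f_ k)) -> (forall k x, `|f_ k x| <= M) ->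
  (forall k x, f_ k x != 0 -> box N x) -> (forall x, f_ k x @[k --> \oo] --> f x) ->
  \int[leb]_x f_ k x @[k --> \oo] --> \int[leb]_x f x.
Proof.
move=> mf fM fN ff.
have mlim : measurable_fun setT f by apply: (measurable_fun_cvg mf) => x _; exact: ff.
have [] := @dominated_convergence _ _ R leb setT measurableT (fun k => EFin \o f_ k) (EFin \o f)
   (EFin \o (fun x : 'rV[R]_n => M * \1_(box N) x)).
- by move=> k; exact/measurable_EFinP.
- exact/measurable_EFinP.
- by apply: aeW => x _; apply: cvg_EFin; [exact: nearW|exact: ff].
- exact/bbV_integrable/bbV_cst_indic.
- apply: aeW => x k _ /=; rewrite lee_fin indicE.
  have [->|fx] := eqVneq (f_ k x) 0.
    by rewrite normr0 mulr_ge0// (le_trans _ (fM k x)).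
  by rewrite mem_set ?mulr1//; exact: fN fx.
move=> fi _ H; apply: fine_cvg; rewrite fineK; first exact: H.
exact: integrable_fin_num.
Qed.

End bounded_convergence.

Section box_volume.
Context {R : realType}.
Local Notation leb n := (@lebesgue_rV R n).

Lemma box_preimage n (M : R) :
  (@rV_cons R n) @^-1` (@box R n.+1 M) = seg M `*` @box R n M.
Proof.
apply/seteqP; split=> -[a v] /=.
  by move=> /norm_rV_cons[aM vM]; split=> //; rewrite /seg/= in_itv/= -ler_norml.
by move=> [aM vM]; apply/norm_rV_cons; split=> //; move: aM; rewrite /seg/= in_itv/= -ler_norml.
Qed.

Lemma box_volume n (M : R) : 0 <= M -> leb n (@box R n M) = ((2 * M) ^+ n)%:E.
Proof.
move=> M0; elim: n => [|n IH].
  by rewrite /= diracE mem_set// => -[].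
rewrite /= /cons_measure /pushforward box_preimage.
rewrite product_measure1E//; [|exact: measurable_seg|exact: measurable_box].
have H := lebesgue_measure_itv `[- M, M].
rewrite [X in (X * _)%E]H [X in (_ * X)%E]IH /= lte_fin.
case: ltP => MM; first by rewrite -EFinB -EFinM exprS; congr (_%:E); ring.
have -> : M = 0 by lra.
by rewrite mulr0 exprS mul0r mul0e.
Qed.

End box_volume.

Section depth_integrals.
Context {R : realType} {d : nat}.
Local Notation rV := ('rV[R]_d).
Local Notation leb := (@lebesgue_rV R d).
Variable rho : R.
Hypothesis rho0 : 0 < rho.
Hypothesis rho1 : rho < 1.
Local Notation depth := (@depth R d rho).

Definition depth_poly (P : {poly R}) (x : rV) : R :=
  if 0 < depth x then P.[depth x] else 0.
Definition depth_int P : R := \int[leb]_x depth_poly P x.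

Lemma depth_le x : depth x <= rho.
Proof. by rewrite /depth gerBl; apply: sumr_ge0 => i _; exact: sqr_ge0. Qed.

Lemma depth_le1 x : depth x <= 1. Proof. exact: le_trans (depth_le x) (ltW rho1). Qed.

Lemma depth_box x : 0 < depth x -> box 1 x.
Proof.
move=> x0; apply: unit_ball_box; apply: lt_trans rho1.
by rewrite -subr_gt0.
Qed.

Lemma measurable_depth : measurable_fun setT depth.
Proof. by apply: continuous_measurable; apply: smooth_continuous; exact: smooth_depth. Qed.

Lemma bbV_depth_poly P : bbV (depth_poly P).
Proof.
split.
  apply: measurable_fun_ifT => //.
    by apply: measurable_fun_ltr => //; exact: measurable_depth.
  apply: continuous_measurable => x; apply: (@continuous_comp _ _ _ depth (horner P)); last exact: continuous_horner.
  by apply: smooth_continuous; exact: smooth_depth.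
exists (1 + \sum_(i < size P) `|P`_i|); split=> x; rewrite /depth_poly; case: ifP => x0.
- rewrite horner_coef ler_wpDl// (le_trans (ler_norm_sum _ _ _))// ler_sum// => i _.
  by rewrite normrM ler_piMr// normrX exprn_ile1// gtr0_norm// depth_le1.
- by rewrite normr0 addr_ge0// sumr_ge0.
- by move=> _; apply: sub_box (depth_box x0); rewrite lerDl sumr_ge0.
- by rewrite eqxx.
Qed.

Lemma depth_intD P Q : depth_int (P + Q) = depth_int P + depth_int Q.
Proof.
rewrite /depth_int -RintegralD//; [|exact/bbV_integrable/bbV_depth_poly..].
apply: eq_Rintegral => x _; rewrite /depth_poly hornerD.
by case: ifP => // _; rewrite addr0.
Qed.

Lemma depth_intZ c P : depth_int (c *: P) = c * depth_int P.
Proof.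
rewrite /depth_int -RintegralZl//; last exact/bbV_integrable/bbV_depth_poly.
apply: eq_Rintegral => x _; rewrite /depth_poly hornerZ.
by case: ifP => // _; rewrite mulr0.
Qed.

Lemma depth_intXn_gt0 a : 0 < depth_int 'X^a.
Proof.
(* As [r <= 1], each squared coordinate on the box is at most [r], so the [d] squares sum to at most
   [rho / 2] and the depth stays above [rho / 2]. *)
pose r := Num.min 1 (rho / (2 * d.+1%:R)).
have r0 : 0 < r by rewrite lt_min ltr01 divr_gt0// mulr_gt0// ltr0n.
have dr x : box r x -> rho / 2 <= depth x.
  move=> xr; rewrite /depth lerBrDr -lerBrDl.
  apply: (@le_trans _ _ (\sum_(i < d) rho / (2 * d.+1%:R))).
    apply: ler_sum => i _; have := xr i; rewrite le_min -real_normK ?num_real// => /andP[a1 a2].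
    by rewrite expr2 (le_trans _ a2)// ler_piMr.
  rewrite sumr_const card_ord -[leLHS]mulr_natr.
  have d0 : 0 < d.+1%:R :> R by rewrite ltr0n.
  rewrite (_ : rho / (2 * d.+1%:R) * d%:R = rho / 2 * (d%:R / d.+1%:R)); last by field; rewrite gt_eqF.
  rewrite (_ : rho - _ = rho / 2 * 1); last by field.
  by apply: ler_wpM2l; [rewrite divr_ge0// ltW|rewrite ler_pdivrMr// mul1r ler_nat].
apply: (@lt_le_trans _ _ (\int[leb]_x ((rho / 2) ^+ a * \1_(box r) x))).
  rewrite RintegralZl//; last first.
    rewrite (_ : \1_(box r) = fun x => 1 * \1_(box r) x); first exact/bbV_integrable/bbV_cst_indic.
    by apply/funext => x; rewrite mul1r.
  rewrite mulr_gt0 ?exprn_gt0 ?divr_gt0// /Rintegral integral_indic//; last exact: measurable_box.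
  by rewrite setIT [X in fine X](box_volume d (ltW r0))/= exprn_gt0// mulr_gt0.
apply: le_Rintegral => //; [exact/bbV_integrable/bbV_cst_indic|exact/bbV_integrable/bbV_depth_poly|].
move=> x _; rewrite indicE /depth_poly hornerXn.
case: (boolP (x \in _)) => [|_]; last first.
  by rewrite mulr0; case: ifP => // x0; rewrite exprn_ge0// ltW.
rewrite inE => /dr dx; rewrite mulr1 ifT; last by rewrite (lt_le_trans _ dx)// divr_gt0.
by rewrite lerXn2r// ?nnegrE ?divr_ge0 ?(le_trans _ dx) ?divr_ge0// ltW.
Qed.

End depth_integrals.

Lemma cvg_eqr (R : realType) (u : nat -> R) (a b : R) : a = b -> u @ \oo --> a -> u @ \oo --> b.
Proof. by move=> ->. Qed.

Lemma cvg_ext (R : realType) (u v : nat -> R) (a : R) :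
  (forall k, u k = v k) -> u @ \oo --> a -> v @ \oo --> a.
Proof. by move=> /funext ->. Qed.

(** * Limits of the profiles as eps vanishes *)

Section vanishing_eps.
Context {R : realType}.
Implicit Types (y eps : R) (t : @term R) (L : seq (@term R)).

(** In the variable [z = eps / y] the term is a power of [y] times [z^i exp(-z)], which is at most
    [i!] and, at fixed [y], tends to 0 with [eps] unless [i = 0]. *)
Lemma term_factor eps a n i y : 0 < y -> (n <= a + i)%N ->
  eps ^+ i * (y ^+ a * flat eps n y) =
  y ^+ (a + i - n) * ((eps / y) ^+ i * expR (- (eps / y))).
Proof.
move=> y0 nai; rewrite /flat y0 expr_div_n exprVn; set E := expR _.
have yn k : y ^+ k != 0 by rewrite expf_neq0// gt_eqF.
have : y ^+ (a + i - n) * y ^+ n = y ^+ a * y ^+ i by rewrite -!exprD subnK.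
move=> H; have -> : y ^+ (a + i - n) = y ^+ a * y ^+ i / y ^+ n by rewrite -H mulfK.
by move: (yn i) (yn n); set p := y ^+ i; set q := y ^+ n => p0 q0; field; rewrite p0 q0.
Qed.

Definition terms_bound L : R := \sum_(t <- L) `|t.1.1.1| * (t.2)`!%:R.

Lemma terms_bound_ge0 L : 0 <= terms_bound L.
Proof. by apply: sumr_ge0 => t _; rewrite mulr_ge0. Qed.

Lemma eval_terms_bound eps L y : 0 < eps -> y <= 1 -> well_weighted 0 0 L ->
  `|eval_terms eps L y| <= terms_bound L.
Proof.
move=> eps0 y1; have [y0|y0] := leP y 0.
  by rewrite eval_le0// normr0 terms_bound_ge0.
rewrite /terms_bound /eval_terms; elim: L => [|[[[c a] n] i] L IH]; first by rewrite !big_nil normr0.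
rewrite /well_weighted /= !addn0 => /andP[/andP[nai _] /IH H]; rewrite !big_cons.
apply: le_trans (ler_normD _ _) _; apply: lerD => //=.
rewrite (term_factor _ y0 nai) normrM; apply: ler_wpM2l => //.
have z0 : 0 <= eps / y by rewrite divr_ge0 ?ltW.
rewrite ger0_norm; last by rewrite !mulr_ge0 ?exprn_ge0 ?expR_ge0// ltW.
apply: le_trans (expRN_le i z0); rewrite ler_piMl//.
  by rewrite mulr_ge0 ?exprn_ge0 ?expR_ge0.
by rewrite exprn_ile1// ltW.
Qed.

Lemma cvg_exp_term i (z : nat -> R) : z @ \oo --> (0 : R) ->
  z k ^+ i * expR (- z k) @[k --> \oo] --> ((i == 0%N)%:R : R).
Proof.
move=> z0; have e1 : expR (- z k) @[k --> \oo] --> (1 : R).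
  rewrite -expR0 -oppr0; apply: (@continuous_cvg _ _ _ _ _ _ expR); first exact: continuous_expR.
  exact: cvgN.
elim: i => [|i IH].
  by rewrite eqxx; under eq_fun do rewrite mul1r.
under eq_fun do rewrite exprS -mulrA.
by apply: (cvg_eqr (mul0r (i == 0%N)%:R)); apply: cvgM.
Qed.

Lemma cvg_eval_terms L y : 0 < y -> well_weighted 0 0 L ->
  eval_terms (harmonic k) L y @[k --> \oo] --> (limit_poly L).[y].
Proof.
move=> y0; have z0 : harmonic k / y @[k --> \oo] --> (0 : R).
  by apply: (cvg_eqr (mul0r y^-1)); apply: cvgM; [exact: cvg_harmonic|exact: cvg_cst].
rewrite /eval_terms; elim: L => [|[[[c a] n] i] L IH].
  by move=> _; rewrite /limit_poly big_nil horner0; under eq_fun do rewrite big_nil; exact: cvg_cst.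
rewrite /well_weighted /= !addn0 => /andP[/andP[nai i0] /IH H].
rewrite -[_ :: L]cat1s limit_poly_cat hornerD.
under eq_fun do rewrite big_cat big_seq1.
apply: cvgD; last exact: H.
rewrite /= /limit_poly big_cons big_nil /=.
have -> : (if i == 0%N then c *: 'X^a + 0 else 0).[y] = c * (y ^+ (a + i - n) * (i == 0%N)%:R).
  case: eqP i0 => [->|_] /= n0; last by rewrite !mulr0 horner0.
  by rewrite (eqP n0) addn0 subn0 addr0 hornerZ hornerXn mulr1.
under eq_fun do rewrite (term_factor _ y0 nai).
apply: cvgMl_tmp; apply: cvgMl_tmp.
exact: (@cvg_exp_term i (fun k => k.+1%:R^-1 / y) z0).
Qed.

End vanishing_eps.

Section radial_limits.
Context {R : realType} {d : nat}.
Local Notation leb := (@lebesgue_rV R d).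
Variable rho : R.
Hypothesis rho1 : rho < 1.
Local Notation depth := (@depth R d rho).

Local Notation depthI := (@depth_int R d rho).

Local Notation radial k L := (@radial R d rho _ (@harmonic_gt0 R k) rho1 L).

Definition mono_term a : seq (@term R) := [:: ((1 : R), a, 0%N, 0%N)].

Lemma eval_mono_term (eps : R) a y : eval_terms eps (mono_term a) y = y ^+ a * flat eps 0 y.
Proof. by rewrite /eval_terms big_seq1 /= !mul1r. Qed.

Lemma flat0_itv (eps y : R) : 0 < eps -> 0 <= flat eps 0 y <= 1.
Proof.
move=> eps0; rewrite flat_ge0// /flat; case: ifP => y0; last by rewrite ler01.
by rewrite mul1r -expR0 ler_expR oppr_le0 divr_ge0// ltW.
Qed.

(** The exponent [r] covers products of two profiles ([r = 1], the exponential of one of them being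
    split off) and single profiles ([r = 0]). *)
Lemma cvg_Rint_radial L r : well_weighted 0 0 L ->
  \int[leb]_x (flat (@harmonic R k) 0 (depth x) ^+ r * radial k L x) @[k --> \oo] -->
  depthI (limit_poly L).
Proof.
move=> wL; apply: (@bounded_convergence _ _ _ _ (terms_bound L) 1) => [k|k x|k x|x].
- apply: measurable_funM; last by apply: bounded_in_measurable; exact: testf_bbV.
  apply: measurable_funX.
  rewrite (_ : (fun x => _) = radial k (mono_term 0)).
    by apply: bounded_in_measurable; exact: testf_bbV.
  by apply/funext => x; rewrite radialE eval_mono_term mul1r.
- have /andP[f0 f1] := flat0_itv (depth x) (@harmonic_gt0 R k).
  rewrite normrM -[leRHS]mul1r; apply: ler_pM => //.
    by rewrite normrX ger0_norm// exprn_ile1.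
  by apply: eval_terms_bound => //; [exact: (@harmonic_gt0 R)|exact: depth_le1].
- have [x0|x0 _] := leP (depth x) 0; first by rewrite radialE eval_le0// mulr0 eqxx.
  exact: depth_box x0.
- rewrite /depth_poly; case: ltP => x0; last first.
    under eq_fun do rewrite radialE eval_le0// mulr0.
    exact: cvg_cst.
  apply: (cvg_eqr (mul1r _)); apply: cvgM; last exact: cvg_eval_terms.
  have e1 : flat (@harmonic R k) 0 (depth x) @[k --> \oo] --> (1 : R).
    rewrite /flat x0; apply: (@cvg_exp_term _ 0 (fun k => (@harmonic R k) / depth x)).
    by apply: (cvg_eqr (mul0r (depth x)^-1)); apply: cvgM; [exact: cvg_harmonic|exact: cvg_cst].
  elim: r => [|r IH]; first exact: cvg_cst.
  under eq_fun do rewrite exprS.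
  by apply: (cvg_eqr (mul1r _)); apply: cvgM.
Qed.

Lemma eval_iter_shift eps k (L : seq (@term R)) y :
  eval_terms eps (iter k (@shift_terms R) L) y = y ^+ k * eval_terms eps L y.
Proof. by elim: k => [|k IH]; rewrite ?mul1r//= eval_shift IH exprS mulrA. Qed.

Lemma limit_poly_iter_shift k (L : seq (@term R)) :
  limit_poly (iter k (@shift_terms R) L) = 'X^k * limit_poly L.
Proof. by elim: k => [|k IH]; rewrite ?mul1r//= limit_poly_shift IH exprS mulrA. Qed.

Lemma limit_mono_term a : limit_poly (mono_term a) = 'X^a.
Proof. by rewrite /limit_poly big_cons big_nil /= scale1r addr0. Qed.

Lemma well_weighted_iter_shift m k (L : seq (@term R)) :
  well_weighted m (m + k) L -> well_weighted 0 0 (iter k (@shift_terms R) L).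
Proof.
have -> : iter k (@shift_terms R) L = [seq (t.1.1.1, (t.1.1.2 + k)%N, t.1.2, t.2) | t <- L].
  elim: k => [|k IH] /=.
    by rewrite -[LHS]map_id; apply: eq_map => -[[[c a] n] i] /=; rewrite addn0.
  by rewrite IH /shift_terms -map_comp; apply: eq_map => t /=; rewrite addnS.
rewrite /well_weighted all_map; apply: sub_all => -[[[c a] n] i] /=.
by move=> /andP[H1 ->]; rewrite andbT; lia.
Qed.

Variable m : nat.
Local Notation phi k := (radial k (mono_term m)).

(** A profile of this weight may be as singular as [y^-m], which the factor [w^m] of [phi k] just
    compensates; bounded convergence then applies. *)
Lemma cvg_tip_radial L : well_weighted m (m + m) L ->
  tip (phi k) (radial k L) @[k --> \oo] --> depthI ('X^m * limit_poly L).
Proof.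
move=> wL; have := cvg_Rint_radial 1 (well_weighted_iter_shift wL).
rewrite limit_poly_iter_shift; apply: cvg_ext => k; rewrite tipE; apply: eq_Rintegral => x _.
by rewrite !radialE eval_mono_term eval_iter_shift expr1; ring.
Qed.

Lemma well_weighted_mono_term a s : (m <= a + s)%N -> well_weighted m s (mono_term a).
Proof. by move=> mas; rewrite /well_weighted /= addn0 add0n mas. Qed.

Lemma cvg_tip_phi :
  tip (phi k) (phi k) @[k --> \oo] --> depthI 'X^(m + m).
Proof.
have := @cvg_tip_radial (mono_term m) (well_weighted_mono_term _).
by rewrite limit_mono_term -exprD; apply; lia.
Qed.

(** With all derivatives on one factor, that factor has a constant limit polynomial. The two signs
    [(-1) ^+ m], one from the form and one from the iterated Laplacian, cancel. *)
Lemma cvg_tform_phi :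
  tform m (phi k) (phi k) @[k --> \oo] -->
  (\prod_(j < m) (2 * j.+1%:R * (2 * j%:R + d%:R))) * depthI 'X^m.
Proof.
have w0 : well_weighted m 0 (mono_term m) by apply: well_weighted_mono_term; lia.
have w2 : well_weighted m (m + m) (iter m (@laplace_terms R d rho) (mono_term m)).
  by have := well_weighted_iter_laplace rho m w0; rewrite add0n addnn.
have E : 'X^m * limit_poly (iter m (@laplace_terms R d rho) (mono_term m)) =
   ((-1) ^+ m * \prod_(j < m) (2 * j.+1%:R * (2 * j%:R + d%:R))) *: 'X^m.
  rewrite (limit_iter_laplace rho m w0) limit_mono_term iter_laplace_poly ?size_polyXn//.
  rewrite coefXn eqxx mul1r mulrC mul_polyC; congr (_ *: _).
  by rewrite prodrN card_ord.
have := cvg_tip_radial w2; rewrite E depth_intZ// => H.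
have E2 k : tform m (phi k) (phi k) =
    (-1) ^+ m * tip (phi k) (radial k (iter m (@laplace_terms R d rho) (mono_term m))).
  by rewrite /tform (polyformE tip_sip tip_skew) iter_laplacian_radial.
apply: (cvg_ext (fun k => esym (E2 k))).
have S : (-1) ^+ m * (-1) ^+ m = 1 :> R by rewrite -exprMn mulrNN mul1r expr1n.
apply: cvg_eqr; last by apply: cvgMl_tmp; exact: H.
by rewrite !mulrA S mul1r.
Qed.

Lemma cvg_tcoord_phi :
  \sum_i tip (tcoord i (phi k)) (tcoord i (phi k)) @[k --> \oo] -->
  rho * depthI 'X^(m + m) - depthI 'X^((m + m).+1).
Proof.
pose L := scale_terms rho (mono_term m) ++ scale_terms (-1) (shift_terms (mono_term m)).
have w0 s : (m <= m + s)%N -> well_weighted m s (mono_term m) by exact: well_weighted_mono_term.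
have wL : well_weighted m (m + m) L.
  rewrite well_weighted_cat; apply/andP; split; first by apply: well_weighted_scale; rewrite w0 ?leq_addr.
  by apply: well_weighted_scale; apply: well_weighted_shift; rewrite w0// leq_addr.
have E : 'X^m * limit_poly L = rho *: 'X^(m + m) + (-1) *: 'X^((m + m).+1).
  rewrite /L limit_poly_cat !limit_poly_scale limit_poly_shift limit_mono_term.
  by rewrite mulrDr -!scalerAr exprS exprD mulrCA.
have := cvg_tip_radial wL; rewrite E depth_intD// !depth_intZ// mulN1r.
apply: cvg_ext => k.
have -> : \sum_i tip (tcoord i (phi k)) (tcoord i (phi k)) =
    tip (phi k) (\sum_i tcoord i (tcoord i (phi k))).
  by rewrite (ip_sumr tip_sip); apply: eq_bigr => i _; rewrite tcoord_sym.
congr (tip _ _); apply: testf_eq => x; rewrite testf_sum radialE.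
rewrite /L eval_cat !eval_scale eval_shift.
rewrite (eq_bigr (fun i => phi k x * x ord0 i ^+ 2)) => [|i _]; last first.
  by rewrite !tmulE -mulrA expr2.
rewrite -mulr_sumr; set S := \sum_i _; have -> : depth x = rho - S by [].
by rewrite radialE (_ : depth x = rho - S)//; ring.
Qed.

(** The divergence of [x w^(a+1)] integrates to 0, and [|x|^2 = rho - w] turns this into a relation
    between consecutive powers. It is computed on the smooth profiles and passed to the limit. *)
Lemma depth_int_rec a :
  rho * depthI 'X^a = (1 + d%:R / (2 * a.+1%:R)) * depthI 'X^(a.+1).
Proof.
pose M := mono_term a.+1; pose M' := deriv_terms M.
pose L := scale_terms (- 2 * rho) M' ++ scale_terms 2 (shift_terms M') ++ scale_terms d%:R M.
have wM : well_weighted 0 0 M by [].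
have wM1 : well_weighted 0 0 M' by rewrite /well_weighted /= !addn0 addn1.
have wL : well_weighted 0 0 L.
  rewrite /L !well_weighted_cat !well_weighted_scale//=.
have E : limit_poly L = (- 2 * rho * a.+1%:R) *: 'X^a + (2 * a.+1%:R + d%:R) *: 'X^(a.+1).
  rewrite /L !limit_poly_cat !limit_poly_scale limit_poly_shift (limit_poly_deriv wM).
  have X : 'X^a *+ a.+1 = a.+1%:R *: 'X^a :> {poly R} by rewrite scaler_nat.
  by rewrite limit_mono_term derivXn /= X -scalerAr -exprS !scalerA scalerDl addrA.
have Z k : \int[leb]_x (flat (harmonic k) 0 (depth x) ^+ 0 * radial k L x) = 0.
  set u := radial k M.
  transitivity (\int[leb]_x \sum_i tpartial i (tcoord i u) x).
    apply: eq_Rintegral => x _; rewrite mul1r radialE /L !eval_cat !eval_scale eval_shift.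
    set y := depth x; set A := eval_terms _ M' y; set B := eval_terms _ M y.
    have P j : tpartial j (tcoord j u) x = - 2 * A * x ord0 j ^+ 2 + B.
      rewrite tpartial_coord testfD tmulE.
      have -> : tpartial j u x = A * (- 2 * x ord0 j).
        by have [_] := is_derive_radial rho (@harmonic_gt0 R k) M j x.
      by rewrite [u x]radialE -/y -/B; ring.
    rewrite (eq_bigr _ (fun j _ => P j)) big_split -mulr_sumr sumr_const card_ord -[B *+ d]mulr_natr.
    have -> : \sum_j x ord0 j ^+ 2 = rho - y by rewrite /y /depth; ring.
    rewrite -[RHS]/(- 2 * A * (rho - y) + B * d%:R); ring.
  rewrite (Rint_sum (@measurable_box R d) (@box_fin R d) (@sub_box R d)) => [|i _]; last exact: testf_bbV.
  rewrite big1// => i _; have [_ /(_ i) C1 s1] := testf_C1box (tcoord i u).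
  exact: Rint_partial s1 C1.
have H0 := cvg_Rint_radial 0 wL.
have Z0 : \int[leb]_x (flat (harmonic k) 0 (depth x) ^+ 0 * radial k L x) @[k --> \oo] --> (0 : R).
  by apply: (cvg_ext (fun k => esym (Z k))); exact: cvg_cst.
have := norm_cvg_unique H0 Z0.
rewrite E depth_intD// !depth_intZ// => H1.
have a0 : a.+1%:R != 0 :> R by rewrite pnatr_eq0.
move: a0 H1; move: (a.+1%:R : R) (depthI 'X^a) (depthI 'X^(a.+1)) => A I J A0 H1.
apply/eqP; rewrite -subr_eq0; apply/eqP.
transitivity ((- 2 * rho * A * I + (2 * A + d%:R) * J) / (- 2 * A)); first by field.
by rewrite H1 mul0r.
Qed.

End radial_limits.

(** * Upper bound for the Rayleigh infimum *)

Section trial_bound.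
Context {R : realType} {d : nat}.
Variable i0 : 'I_d.

Lemma exists_testf : exists u : @testf R d, 0 < tip u u.
Proof.
have r0 : 0 < 2^-1 :> R by rewrite invr_gt0.
have r1 : 2^-1 < 1 :> R by rewrite invf_lt1// ltr1n.
have [N _ H] := cvgr_gt _ (@cvg_tip_phi R d _ r1 0) _ (depth_intXn_gt0 r0 r1 _).
by eexists; apply: (H N); exact: leqnn.
Qed.

Definition upper_const m : R := \prod_(j < m) (2 * j.+1%:R * (2 * j%:R + d%:R)).

Section fixed.
Variables (m : nat).
Hypothesis m0 : (0 < m)%N.

Let M : R := m%:R.
Let M0 : 0 < M. Proof. by rewrite ltr0n. Qed.
Let rho : R := M / (M + 1).
Let rho0 : 0 < rho. Proof. by rewrite divr_gt0// addr_gt0. Qed.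
Let rho1 : rho < 1. Proof. by rewrite ltr_pdivrMr ?addr_gt0// mul1r ltrDl. Qed.
Local Notation I := (fun a => @depth_int R d rho 'X^a).

(** The factor [1 / rho = 1 + 1 / M] and the factor of the recursion, at most [1 + d / (2 M)], are
    both put under exponentials, so that [m] steps multiply to a constant. *)
Lemma depth_int_step a : (m <= a)%N -> I a <= expR ((1 + d%:R / 2) / M) * I a.+1.
Proof.
move=> ma; rewrite -(ler_pM2l rho0) (depth_int_rec rho1) mulrA.
have J0 := depth_intXn_gt0 rho0 rho1 a.+1; apply: ler_wpM2r; first exact: ltW.
have A0 : 0 < a.+1%:R :> R by rewrite ltr0n.
have D0 : 0 <= d%:R :> R by [].
apply: (@le_trans _ _ (1 + d%:R / 2 / M)).
  rewrite lerD2l -mulrA ler_wpM2l// -invfM lef_pV2 ?posrE ?mulr_gt0//.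
  by rewrite ler_pM2l// ler_nat leqW.
apply: (@le_trans _ _ (expR (d%:R / 2 / M))); first exact: expR_ge1Dx.
rewrite mulrDl mul1r expRD mulrA -[leLHS]mul1r; apply: ler_wpM2r; first exact: expR_ge0.
have H := expR_ge1Dx (M^-1).
apply: le_trans (ler_wpM2l (ltW rho0) H).
by rewrite (_ : rho * _ = 1)// /rho; field; rewrite !gt_eqF ?addr_gt0.
Qed.

Lemma depth_int_ratio : I m <= expR (1 + d%:R / 2) * I (m + m)%N.
Proof.
have H k : I m <= expR (k%:R * ((1 + d%:R / 2) / M)) * I (m + k)%N.
  elim: k => [|k IH]; first by rewrite mul0r expR0 mul1r addn0.
  apply: le_trans IH _; set q := _ / M; rewrite -[k.+1%:R]natr1 (mulrDl _ 1 q) mul1r expRD -mulrA.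
  apply: ler_wpM2l; first exact: expR_ge0.
  by rewrite addnS; apply: depth_int_step; exact: leq_addr.
by have := H m; rewrite -/M [M * _]mulrC divfK// gt_eqF.
Qed.

Lemma depth_int_succ_le a : I a.+1 <= I a.
Proof.
have J0 := depth_intXn_gt0 rho0 rho1 a; have J1 := depth_intXn_gt0 rho0 rho1 a.+1.
apply: (@le_trans _ _ (rho * I a)); last by rewrite ler_piMl// ltW.
rewrite (depth_int_rec rho1) ler_peMl//; first exact: ltW.
by rewrite lerDl divr_ge0.
Qed.

Local Notation phi k := (@radial R d rho _ (@harmonic_gt0 R k) rho1 (mono_term m)).

(** In the limit, the second moment of [phi k] is [d / (2 t)] times the integral of [w^(2m+1)] for
    [t = 2 m + 1]. Up to the ratio of the integrals of [w^(2m)] and [w^(2m+1)], this [t] is the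
    optimal one. *)
Lemma trial_first_form k :
  let t := (m + m).+1%:R in
  t * d%:R * tip (phi k) (phi k) -
    t ^+ 2 * \sum_i tip (tcoord i (phi k)) (tcoord i (phi k)) <= tform 1 (phi k) (phi k).
Proof.
exact: (polyform1_uncertainty tip_sip tip_skew tpartialC _ _ tcoord_sym tpartial_coord).
Qed.

Lemma cvg_trial_first_form :
  let t := (m + m).+1%:R : R in
  t * d%:R * tip (phi k) (phi k) -
    t ^+ 2 * \sum_i tip (tcoord i (phi k)) (tcoord i (phi k)) @[k --> \oo] -->
  t * d%:R * (I (m + m)%N - I (m + m).+1 / 2).
Proof.
move=> t; have t0 : t != 0 by rewrite pnatr_eq0.
apply: cvg_eqr; last first.
  apply: cvgB; apply: cvgMl_tmp; [exact: cvg_tip_phi|exact: cvg_tcoord_phi].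
by rewrite (depth_int_rec rho1) -/t; field.
Qed.

(** Limits are available for the forms of order 0 and [m], while those of order 1 and [h] are only
    bounded below. The inequalities are therefore combined, without divisions, for each [phi k]
    before passing to the limit. *)
Lemma rayleigh_inf_upper h :
  @rayleigh_inf R d m h * M ^+ h <= upper_const m * expR (1 + d%:R / 2).
Proof.
have [u0 u0P] := exists_testf.
set lam := rayleigh_inf m h.
have lam0 : 0 <= lam by exact: (rayleigh_inf_ge0 i0 _ _ u0P).
set J := I (m + m)%N; have J0 : 0 < J := depth_intXn_gt0 rho0 rho1 (m + m).
have J1 := depth_int_succ_le (m + m); rewrite -/J in J1.
pose t := (m + m).+1%:R : R.
set B := t * d%:R * (J - I (m + m).+1 / 2).
have D1 : 1 <= d%:R :> R by rewrite ler1n; case: d i0 => [[]|].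
(* [I (m + m).+1 <= J] leaves at least half of [t * d * J], and [t >= 2 * M], [d >= 1]. *)
have BJ : M * J <= B.
  have tE : t = 2 * M + 1 by rewrite /t -natr1 natrD -/M; ring.
  apply: (@le_trans _ _ (t * d%:R * (J / 2))); last first.
    apply: ler_wpM2l; first by rewrite mulr_ge0.
    by move: J1; lra.
  rewrite tE; have := ler_wpM2r (ltW J0) D1; have := ltW M0; move: (ltW J0).
  by move: (J) (M) (d%:R : R) => x y z; nra.
have B0 : 0 < B by apply: lt_le_trans BJ; exact: mulr_gt0.
have cvgX (u : nat -> R) (l : R) n : u @ \oo --> l -> u k ^+ n @[k --> \oo] --> l ^+ n.
  by move=> ul; apply: (@continuous_cvg _ _ _ _ _ _ (fun z : R => z ^+ n)) => //; exact: exprn_continuous.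
have ct : tip (phi k) (phi k) @[k --> \oo] --> J by exact: cvg_tip_phi.
have H : lam * B ^+ h * J <= upper_const m * I m * J ^+ h.
  have c1 : lam * (t * d%:R * tip (phi k) (phi k) -
      t ^+ 2 * \sum_i tip (tcoord i (phi k)) (tcoord i (phi k))) ^+ h * tip (phi k) (phi k)
      @[k --> \oo] --> lam * B ^+ h * J.
    by apply: cvgM => //; apply: cvgMl_tmp; apply: cvgX; exact: cvg_trial_first_form.
  have c2 : tform m (phi k) (phi k) * tip (phi k) (phi k) ^+ h @[k --> \oo] -->
      upper_const m * I m * J ^+ h.
    by apply: cvgM; [exact: cvg_tform_phi|exact: cvgX].
  apply: (ler_cvg_to c1 c2).
  near=> k.
  have x0 : 0 < tip (phi k) (phi k).
    by near: k; exact: (cvgr_gt _ ct _ J0).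
  have b0 : 0 < t * d%:R * tip (phi k) (phi k) -
      t ^+ 2 * \sum_i tip (tcoord i (phi k)) (tcoord i (phi k)).
    by near: k; exact: (cvgr_gt _ cvg_trial_first_form _ B0).
  have pos p : 0 < tform p (phi k) (phi k) by apply: lt_le_trans x0 (tform_le i0 _ (leq0n p)).
  have P := polyform_power tip_sip tip_skew h pos.
  have L := rayleigh_inf_le i0 m h u0P (phi k).
  have T := trial_first_form k.
  have {T} T := lerXn2r h (ltW b0) (ltW (pos 1%N)) T.
  rewrite -/lam in L; apply: (@le_trans _ _ (lam * tform 1 (phi k) (phi k) ^+ h * tip (phi k) (phi k))).
    by apply: ler_wpM2r; [exact: ltW|apply: ler_wpM2l].
  rewrite -mulrA; apply: le_trans (ler_wpM2l lam0 P) _.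
  by rewrite mulrA; apply: ler_wpM2r L; rewrite exprn_ge0 ?ltW.
have C0 : 0 <= upper_const m.
  by apply: prodr_ge0 => j _; rewrite !mulr_ge0// addr_ge0// mulr_ge0.
have H2 : lam * (M * J) ^+ h * J <= upper_const m * (expR (1 + d%:R / 2) * J) * J ^+ h.
  apply: (@le_trans _ _ (lam * B ^+ h * J)).
    apply: ler_wpM2r; first exact: ltW.
    by apply: ler_wpM2l => //; apply: lerXn2r BJ; rewrite nnegrE; apply: ltW => //; exact: mulr_gt0.
  apply: le_trans H _; apply: ler_wpM2r; first by rewrite exprn_ge0// ltW.
  by apply: ler_wpM2l => //; exact: depth_int_ratio.
rewrite -(ler_pM2r (mulr_gt0 (exprn_gt0 h J0) J0)).
apply: le_trans (le_trans _ H2) _; apply: le_of_eq; first by rewrite exprMn; ring.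
by ring.
Unshelve. all: by end_near. Qed.

End fixed.
End trial_bound.

(** * Asymptotics *)

Section elementary_bounds.
Context {R : realType}.

(** The difference [g] of the two sides vanishes at 0, and its derivative is nonnegative because
    [1 - 2 x <= expR (- 2 x)]. *)
Lemma expR_le_Pade (w : R) : 0 <= w -> (1 - w) * expR (2 * w) <= 1 + w.
Proof.
move=> w0; pose g (x : R) := 1 + x - (1 - x) * expR (2 * x).
pose dg (x : R) := 1 - (1 - 2 * x) * expR (2 * x).
have Dg (x : R) : is_derive x 1 g (dg x).
  have d2 : is_derive x 1 (fun y : R => 2 * y) 2.
    by apply: (is_derive_eq (is_deriveZ 2 (@is_derive_id _ _ x 1))); rewrite /GRing.scale/= mulr1.
  have dE := @is_derive1_comp _ expR (fun y : R => 2 * y) x _ _ (is_derive_expR _) d2.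
  have d1 := is_deriveB (is_derive_cst (1 : R) x (1 : R)) (@is_derive_id _ _ x 1).
  have dA := is_deriveD (is_derive_cst (1 : R) x (1 : R)) (@is_derive_id _ _ x 1).
  have -> : g = (cst 1 + id) - (cst 1 - id) * (expR \o (fun y : R => 2 * y)).
    by apply/funext => y; rewrite /g !fctE.
  apply: (is_derive_eq (is_deriveB dA (is_deriveM d1 dE))).
  by rewrite /GRing.scale/= /dg !fctE /=; ring.
have [] := @MVT_segment R g dg 0 w w0.
- apply: continuous_subspaceT => x; apply: differentiable_continuous.
  by apply/derivable1_diffP; case: (Dg x).
move=> c; rewrite in_itv/= => /andP[c0 _] E.
have dgc : 0 <= dg c.
  rewrite subr_ge0 -ler_pdivlMr ?expR_gt0// mul1r.
  by rewrite -expRN; have := expR_ge1Dx (- (2 * c)).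
have : 0 <= g w - g 0 by rewrite E mulr_ge0// subr0.
by rewrite /g mulr0 expR0 subr0 addr0 mulr1 subrr subr0 subr_ge0.
Qed.

(** For [w = 1 / (2 m + 1)] the Pade quotient is [(m + 1) / m]. The midpoint makes the error of
    third order in [1 / m], still summable after multiplication by [2 m], as a Stirling bound
    requires. *)
Lemma lnS_ge m : (0 < m)%N -> 2 / (2 * m%:R + 1) <= ln m.+1%:R - ln m%:R :> R.
Proof.
move=> m0; have M0 : 0 < m%:R :> R by rewrite ltr0n.
have M1 : 0 < 2 * m%:R + 1 :> R by rewrite addr_gt0// mulr_gt0.
have := @expR_le_Pade ((2 * m%:R + 1)^-1) _; rewrite invr_ge0 ltW// => /(_ isT) H.
rewrite -ler_expR expRB !lnK ?posrE ?ltr0n// ler_pdivlMr//.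
have E1 : 1 - (2 * m%:R + 1)^-1 = m%:R * (2 / (2 * m%:R + 1)) :> R by field; rewrite gt_eqF.
have E2 : 1 + (2 * m%:R + 1)^-1 = (m%:R + 1) * (2 / (2 * m%:R + 1)) :> R by field; rewrite gt_eqF.
move: H; rewrite E1 E2 mulrAC ler_pM2r; last by rewrite divr_gt0.
by rewrite natr1 mulrC.
Qed.

(** The exponent is shaped by the induction: the constant 3 makes it vanish at [m = 1], and the
    correction [- m^-1] absorbs an error of order [1 / m^2] at each step. *)
Lemma prod_factorial_le (s : R) m : 0 < s -> (0 < m)%N ->
  \prod_(j < m) (j.+1%:R * (j%:R + s)) <=
  s * expR ((2 * m%:R + s) * ln m%:R - 2 * m%:R + 3 - m%:R^-1).
Proof.
move=> s0; case: m => // m _; elim: m => [|m IH].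
  rewrite big_ord_recl big_ord0 mulr1 mul1r add0r ln1 mulr0 sub0r invr1.
  rewrite (_ : - (2 * 1) + 3 - 1 = 0); last by ring.
  by rewrite expR0 mulr1.
rewrite big_ord_recr/=; set n := m.+1 in IH *.
have N0 : 0 < n%:R :> R by rewrite ltr0n.
have N1 : 0 < n.+1%:R :> R by rewrite ltr0n.
apply: (@le_trans _ _ (s * expR ((2 * n%:R + s) * ln n%:R - 2 * n%:R + 3 - n%:R^-1) *
   expR (2 * ln n.+1%:R + (s - 1) / n.+1%:R))).
  apply: ler_pM IH _; first by apply: prodr_ge0 => j _; rewrite mulr_ge0// addr_ge0// ltW.
    by rewrite mulr_ge0// addr_ge0// ltW.
  rewrite (_ : 2 * ln n.+1%:R = ln n.+1%:R + ln n.+1%:R); last by ring.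
  rewrite 2!expRD !lnK ?posrE// -mulrA.
  apply: ler_wpM2l; first exact: ltW.
  rewrite (_ : n%:R + s = n.+1%:R * (1 + (s - 1) / n.+1%:R)); last by rewrite -[n.+1%:R]natr1; field; rewrite natr1 gt_eqF.
  by apply: ler_wpM2l; [exact: ltW|exact: expR_ge1Dx].
rewrite -mulrA -expRD ler_pM2l// ler_expR.
have := lnS_ge (isT : (0 < n)%N); rewrite -[n.+1%:R]natr1.
move: (ln n%:R) (ln (n%:R + 1)) N0 => a b; move: (n%:R : R) => x x0 H.
have H1 : 0 < 2 * x + 1 by rewrite addr_gt0// mulr_gt0.
have H2 := ler_wpM2l (_ : 0 <= 2 * x + s) H.
rewrite -subr_ge0.
apply: (@le_trans _ _ ((2 * x + s) * (2 / (2 * x + 1)) - 2 + x^-1 - (x + 1)^-1 - (s - 1) / (x + 1))).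
  (* Once the logarithms are replaced by their lower bound, a rational function remains, visibly
     nonnegative. *)
  rewrite (_ : _ - _ = (1 + x + s * x) / (x * (x + 1) * (2 * x + 1))); last first.
    by field; rewrite !gt_eqF// addr_gt0.
  by rewrite divr_ge0 ?mulr_ge0 ?addr_ge0 ?mulr_ge0// ltW.
have {}H2 : (2 * x + s) * (2 / (2 * x + 1)) <= (2 * x + s) * (b - a).
  by apply: H2; rewrite addr_ge0 ?mulr_ge0// ltW.
by move: H2; set q := _ / (2 * x + 1); lra.
Qed.

End elementary_bounds.

(** * Upper and lower bounds for the eigenvalue *)

Section eigenvalue_bounds.
Context {R : realType} {d : nat}.
Variable i0 : 'I_d.

Lemma tform_gt0 p (u : @testf R d) : 0 < tip u u -> 0 < tform p u u.
Proof. by move=> u0; apply: lt_le_trans u0 (tform_le i0 u (leq0n p)). Qed.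

(** Log-convexity propagates a zero from one order to the next. *)
Lemma tform_eq0 p (u : @testf R d) : tip u u = 0 -> tform p u u = 0.
Proof.
move=> u0; elim: p => [|p IH]; first by rewrite /tform polyform0.
have := polyform_log_convex tip_sip tip_skew p u.
by rewrite -!/(tform _ _ _) IH mul0r => H; apply/eqP; rewrite -sqrf_eq0 eq_le H sqr_ge0.
Qed.

Lemma rayleigh_inf_mono m h : (h < m)%N ->
  @rayleigh_inf R d (m - h) 0 <= @rayleigh_inf R d m h.
Proof.
move=> hm; have [u0 u0P] := @exists_testf R d.
apply: (rayleigh_inf_ge i0 u0P) => u.
(* Functions of zero norm are set apart, as the comparison of ratios needs positive forms. *)
have := ip_ge0 (@tip_sip R d) u; rewrite le_eqVlt => /orP[/eqP ue|up].
  by rewrite !tform_eq0// mulr0.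
have L := rayleigh_inf_le i0 (m - h) 0 u0P u.
have := polyform_ratio tip_sip tip_skew (m - h) h (fun p => tform_gt0 p up).
rewrite (subnK (ltnW hm)) -!/(tform _ _ _) => H.
have f0 := tform_gt0 0 up; have fh := tform_gt0 h up.
rewrite -(ler_pM2r f0); apply: le_trans H; rewrite mulrAC.
by apply: ler_wpM2r L; exact: ltW.
Qed.

Lemma rayleigh_inf_fact n : ((2 * n)`!)%:R <= @rayleigh_inf R d n 0.
Proof.
have [u0 u0P] := @exists_testf R d.
apply: (rayleigh_inf_ge i0 u0P) => u; rewrite [tform 0 u u]polyform0.
apply: le_trans (fact_tip_iter i0 n u) _.
exact: polyform_iter_D tip_sip tip_skew tpartialC n i0 u.
Qed.

Lemma first_eigenvalue_inf m h : (h < m)%N ->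
  first_eigenvalue (@unit_ball R d) m (m - h) = @rayleigh_inf R d m h.
Proof.
move=> hm; have [u0 u0P] := @exists_testf R d.
by apply: (first_eigenvalueE i0 hm u0P); rewrite subKn// ltnW.
Qed.

Let s : R := d%:R / 2.

Lemma first_eigenvalue_upper h : exists2 K : R, 0 < K & forall m, (h < m)%N ->
  first_eigenvalue (@unit_ball R d) m (m - h) <=
  K * expR ((2 * m)%:R * (ln 2 - 1) + ((2 * m)%:R - h%:R + s) * ln m%:R).
Proof.
have s0 : 0 < s by rewrite divr_gt0// ltr0n; case: d i0 => [[]|].
(* [4 + s] adds the 3 of the factorial bound to the [1 + s] of the comparison of integrals. *)
exists (s * expR (4 + s)); first by rewrite mulr_gt0// expR_gt0.
move=> m hm; have m0 : (0 < m)%N by apply: leq_ltn_trans hm.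
have M0 : 0 < m%:R :> R by rewrite ltr0n.
rewrite first_eigenvalue_inf// -(ler_pM2r (exprn_gt0 h M0)).
apply: le_trans (rayleigh_inf_upper i0 m0 h) _.
have -> : upper_const (R := R) (d := d) m = expR ((2 * m)%:R * ln 2) * \prod_(j < m) (j.+1%:R * (j%:R + s)).
  have -> : expR ((2 * m)%:R * ln 2) = \prod_(j < m) (4 : R).
    by rewrite expRM_natl lnK ?posrE// exprM prodr_const card_ord; congr (_ ^+ _); ring.
  rewrite -big_split/=; apply: eq_bigr => j _; rewrite /s; by field.
apply: (@le_trans _ _ (expR ((2 * m)%:R * ln 2) * (s * expR ((2 * m%:R + s) * ln m%:R - 2 * m%:R + 3)) * expR (1 + s))).
  apply: ler_wpM2r; first exact: expR_ge0.
  apply: ler_wpM2l; first exact: expR_ge0.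
  apply: le_trans (prod_factorial_le s0 m0) _; apply: ler_wpM2l; first exact: ltW.
  by rewrite ler_expR gerBl invr_ge0.
have -> : m%:R ^+ h = expR (h%:R * ln m%:R) :> R by rewrite expRM_natl lnK.
have E1 (a b c : R) : expR a * (s * expR b) * expR c = s * expR (a + b + c).
  by rewrite !expRD; ring.
have E2 (a b c : R) : s * expR a * expR b * expR c = s * expR (a + b + c).
  by rewrite !expRD; ring.
by rewrite E1 E2; apply: le_of_eq; congr (_ * expR _); rewrite natrM; ring.
Qed.

Lemma ln_first_eigenvalue_lower h m : (h < m)%N ->
  0 < first_eigenvalue (@unit_ball R d) m (m - h) /\
  (2 * (m - h))%:R * (ln (2 * (m - h))%:R - 1) <= ln (first_eigenvalue (@unit_ball R d) m (m - h)) :> R.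
Proof.
move=> hm; rewrite first_eigenvalue_inf//; set n := (2 * (m - h))%N.
have n0 : 0 < n%:R :> R by rewrite ltr0n /n; lia.
have L : n`!%:R <= @rayleigh_inf R d m h.
  exact: le_trans (rayleigh_inf_fact (m - h)) (rayleigh_inf_mono hm).
have l0 : 0 < @rayleigh_inf R d m h by apply: lt_le_trans L; rewrite ltr0n fact_gt0.
split=> //; rewrite -ler_expR lnK ?posrE//; apply: le_trans L.
apply: le_trans (expRN_le n (ltW n0)).
by rewrite mulrBr mulr1 expRD expRM_natl lnK.
Qed.

End eigenvalue_bounds.

(** Turns a multiplicative error [expR y] with bounded [y] into an additive one. *)
Lemma expR_le1Mx (R : realType) (y A : R) : 0 <= y -> y <= A -> expR y <= 1 + y * expR A.
Proof.
move=> y0 yA; have H : expR y * (1 - y) <= 1.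
  by rewrite mulrC -ler_pdivlMr ?expR_gt0// mul1r -expRN; exact: expR_ge1Dx.
have : y * expR y <= y * expR A by apply: ler_wpM2l => //; rewrite ler_expR.
by move: H; rewrite mulrBr mulr1 [expR y * y]mulrC; lra.
Qed.

Lemma powR_first_eigenvalue_bound (R : realType) (d h : nat) (i0 : 'I_d) :
  exists2 C : R, 0 < C & forall m, (h < m)%N -> (2 * h <= m)%N -> 1 <= ln m%:R :> R ->
  `|first_eigenvalue (@unit_ball R d) m (m - h) `^ (2 * (m - h))%:R^-1 - 2 * m%:R / expR 1|
    <= C * ln m%:R.
Proof.
have [K K0 HK] := @first_eigenvalue_upper R d i0 h; pose s : R := d%:R / 2.
have s0 : 0 <= s by rewrite divr_ge0.
(* [A * ln m] dominates what the upper bound on [ln Lam] has beyond [n * (ln (2 m) - 1)], where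
   [n = 2 (m - h)]; the terms without logarithm use [1 <= ln m]. *)
pose A : R := `|ln K| + 2 * h%:R * `|ln 2 - 1| + (h%:R + s).
have A0 : 0 <= A by rewrite !addr_ge0// mulr_ge0.
exists (2 * A * expR A + 2 * h%:R + 1).
  by rewrite ltr_wpDl// addr_ge0// !mulr_ge0// expR_ge0.
move=> m hm h2 lm1; have m0 : 0 < m%:R :> R by rewrite ltr0n; lia.
have [l0 low] := @ln_first_eigenvalue_lower R d i0 h m hm.
have := HK m hm; set Lam := first_eigenvalue _ _ _ in l0 low *.
set n := (2 * (m - h))%N in low *; have n0 : 0 < n%:R :> R by rewrite ltr0n /n; lia.
rewrite -[X in X <= _]lnK ?posrE// -[X in X * _](@lnK _ K) ?posrE// -expRD ler_expR => up.
have -> : Lam `^ n%:R^-1 = expR (ln Lam / n%:R) by rewrite /powR gt_eqF// mulrC.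
(* From [2 * h <= m]: dividing by [n] is no worse than dividing by [m]. *)
have mn : m%:R <= n%:R :> R by rewrite ler_nat /n; lia.
have nE : (2 * m)%:R = n%:R + 2 * h%:R :> R by rewrite -natrM -natrD; congr _%:R; rewrite /n; lia.
have e1 : 1 <= expR 1 :> R by rewrite -[leLHS]expR0 ler_expR.
have E (x : R) : 0 < x -> expR (ln x - 1) = x / expR 1 by move=> x0; rewrite expRB lnK.
have lower : n%:R / expR 1 <= expR (ln Lam / n%:R).
  by rewrite -E// ler_expR ler_pdivlMr// mulrC.
pose y := A * ln m%:R / m%:R.
have y0 : 0 <= y by rewrite divr_ge0 ?mulr_ge0// (le_trans _ lm1).
have yA : y <= A.
  by rewrite /y -mulrA ler_piMr// ler_pdivrMr// mul1r ltW// ln_sublinear.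
have upper : expR (ln Lam / n%:R) <= 2 * m%:R / expR 1 * expR y.
  rewrite -E ?mulr_gt0// -expRD ler_expR ler_pdivrMr// lnM ?posrE//.
  apply: le_trans up _; rewrite nE -/s.
  have yn : A * ln m%:R <= y * n%:R.
    rewrite /y mulrAC ler_pdivlMr//; apply: ler_wpM2l => //.
    by rewrite mulr_ge0// (le_trans _ lm1).
  have b1 : ln K <= `|ln K| * ln m%:R.
    by apply: le_trans (ler_norm _) _; rewrite ler_peMr.
  have b2 : 2 * h%:R * (ln 2 - 1) <= 2 * h%:R * `|ln 2 - 1| * ln m%:R :> R.
    apply: (@le_trans _ R (2 * h%:R * `|ln 2 - 1|)).
      by apply: ler_wpM2l; [rewrite mulr_ge0|exact: ler_norm].
    by rewrite ler_peMr// !mulr_ge0.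
  by move: yn b1 b2; rewrite /A; lra.
have {upper} upper : expR (ln Lam / n%:R) <= 2 * m%:R / expR 1 + 2 * A * expR A * ln m%:R.
  apply: le_trans upper _.
  have q0 : 0 <= 2 * m%:R / expR 1 :> R by rewrite divr_ge0 ?mulr_ge0// expR_ge0.
  apply: le_trans (ler_wpM2l q0 (expR_le1Mx y0 yA)) _; rewrite mulrDr mulr1 lerD2l.
  rewrite (_ : 2 * m%:R / expR 1 * (y * expR A) = 2 * A * expR A * ln m%:R / expR 1); last first.
    by rewrite /y; field; rewrite (gt_eqF m0) gt_eqF// expR_gt0.
  rewrite ler_pdivrMr ?expR_gt0//.
  apply: ler_peMr => //; rewrite !mulr_ge0 ?expR_ge0//.
  by rewrite (le_trans _ lm1).
have h0 : 2 * h%:R / expR 1 <= 2 * h%:R * ln m%:R :> R.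
  rewrite ler_pdivrMr ?expR_gt0// -[leRHS]mulrA; apply: ler_peMr; first by rewrite mulr_ge0.
  by rewrite -[leLHS]mulr1 ler_pM.
have m2 : 2 * m%:R / expR 1 = n%:R / expR 1 + 2 * h%:R / expR 1 :> R.
  by rewrite -mulrDl -nE natrM.
have t0 : 0 <= 2 * A * expR A * ln m%:R.
  by rewrite !mulr_ge0 ?expR_ge0// (le_trans _ lm1).
have hl : 0 <= 2 * h%:R * ln m%:R :> R by rewrite !mulr_ge0// (le_trans _ lm1).
rewrite (_ : (_ + 1) * _ = 2 * A * expR A * ln m%:R + 2 * h%:R * ln m%:R + ln m%:R); last by ring.
move: upper lower h0 m2 t0 hl lm1; clear -R.
move: (2 * A * expR A * ln m%:R) (2 * h%:R * ln m%:R : R) (2 * h%:R / expR 1 : R) (ln m%:R : R).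
move: (expR (ln Lam / n%:R)) (n%:R / expR 1 : R) (2 * m%:R / expR 1 : R) => a b c u v w l H1 H2 H3 H4 H5 H6 H7.
by rewrite ler_norml; apply/andP; split; lra.
Qed.

Theorem theorem3p9 (R : realType) (d : nat) (hd : (1 <= d)%N) (h : nat) :
  let lambda1 (m t : nat) : R := first_eigenvalue (@unit_ball R d) m t in
  [/\ forall m : nat, (h < m)%N ->
        lambda1 (m - h)%N (m - h)%N <= lambda1 m (m - h)%N,
      (fun m : nat => lambda1 m (m - h)%N) =O_\oo
        (fun m : nat => 2 ^+ (2 * m) * expR (- (2 * m)%:R)
           * m%:R `^ ((2 * m)%:R - h%:R + d%:R / 2)) &
      (fun m : nat => lambda1 m (m - h)%N `^ (2 * (m - h))%:R^-1)
        = (fun m : nat => 2 * m%:R / expR 1) +O_\oo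
        (fun m : nat => ln m%:R)].
Proof.
move=> lambda1; pose i0 := Ordinal hd; split.
- move=> m hm; rewrite /lambda1 (first_eigenvalue_inf i0 hm).
  (* The eigenvalue of order [m - h] with [t] equal to the order is the case [h = 0], hence the
     rewriting of [m - h] as [m - h - 0]. *)
  rewrite -{2}[(m - h)%N]subn0 (first_eigenvalue_inf i0); first exact: rayleigh_inf_mono i0 _ _ hm.
  by rewrite subn_gt0.
- have [K K0 HK] := @first_eigenvalue_upper R d i0 h.
  apply/eqO_exP; exists K => //; near=> m.
  have hm : (h < m)%N by near: m; exact: nbhs_infty_gt.
  have m0 : 0 < m%:R :> R by rewrite ltr0n (leq_ltn_trans _ hm).
  have [l0 _] := @ln_first_eigenvalue_lower R d i0 h m hm.
  rewrite gtr0_norm// (le_trans (HK m hm))// ler_pM2l//.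
  apply: le_trans (ler_norm _); rewrite /powR gt_eqF// expRD; apply: ler_wpM2r; first exact: expR_ge0.
  by rewrite mulrBr mulr1 expRD expRM_natl lnK// posrE.
- have [C C0 HC] := @powR_first_eigenvalue_bound R d h i0.
  apply/eqaddOP/bigO_exP; exists C => //; near=> m.
  have lm1 : 1 <= ln m%:R :> R.
    rewrite -ler_expR lnK; first by near: m; exact: nbhs_infty_ger.
    by rewrite posrE ltr0n; near: m; exact: nbhs_infty_gt.
  rewrite [X in _ <= _ * X]ger0_norm ?(le_trans _ lm1)//.
  by apply: HC lm1; [near: m; exact: nbhs_infty_gt|near: m; exact: nbhs_infty_ge].
Unshelve. all: by end_near. Qed.
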